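(* Let $k$ be a field with $\mathrm{char}\,k\neq2$ and let $G=G_{7,j,3}$ $(j=2,3,5)$ act on $K(x_1,x_2,x_3)$ by purely quasi-monomial $k$-automorphisms. Assume that $H=\{\sigma\in G\mid\sigma(\alpha)=\alpha\text{ for any }\alpha\in K\}=\langle\tau_3,\lambda_3,\sigma_{3B}\rangle\simeq\mathcal{A}_4$. (1) Let $G=G_{7,2,3}=\langle H,-I_3\rangle$. There exist $w_1,w_2,w_3\in K(x_1,x_2,x_3)^H$ such that $K(x_1,x_2,x_3)^H=K(w_1,w_2,w_3)$ and $$-I_3: w_1\mapsto w_1,\ w_2\mapsto-w_2,\ w_3\mapsto\frac{w_1(1+w_1+w_1^2)^2-(2+3w_1+4w_1^2+2w_1^3)w_2^2+(w_1+2)w_2^4}{w_3}.$$ In particular, $K(x_1,x_2,x_3)^G=k(X,Y,W_1,W_2)$ where $K=k(\sqrt b)$ and $$X^2-bY^2=W_1(1+W_1+W_1^2)^2-b(2+3W_1+4W_1^2+2W_1^3)W_2^2+b^2(W_1+2)W_2^4.$$ (2) Let $G=G_{7,3,3}=\langle H,-\beta_3\rangle$. There exist $u_1,u_2,u_3\in K(x_1,x_2,x_3)^H$ such that $K(x_1,x_2,x_3)^H=K(u_1,u_2,u_3)$ and $$-\beta_3: u_1\mapsto u_1,\ u_2\mapsto-u_2,\ u_3\mapsto\frac{2(5-u_2^2)(u_1^2-u_2^2+1)}{u_3}.$$ We have $K(x_1,x_2,x_3)^G=k(X,Y,U_1,U_2)$ where $X^2-dY^2=2(5-dU_2^2)(U_1^2-dU_2^2+1)$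 and $K=k(\sqrt d)$. Moreover, if $\sqrt5\in k$, then the following conditions are equivalent: (i) $K(x_1,x_2,x_3)^G$ is $k$-rational; (ii) $K(x_1,x_2,x_3)^G$ is $k$-unirational; (iii) the quadratic form $X^2-dY^2-2v_0^2-2v_1^2+2dv_2^2$ (in the variables $X,Y,v_0,v_1,v_2$) has a non-trivial $k$-zero, where $K=k(\sqrt d)$. In particular, if $\sqrt5,\sqrt2\in k$ or $\sqrt5,\sqrt{-1}\in k$, then $K(x_1,x_2,x_3)^G$ is $k$-rational. (3) Let $G=G_{7,5,3}=\langle H,\beta_3,-I_3\rangle$. There exist $p_1,p_2,p_3\in K(x_1,x_2,x_3)^H$ such that $K(x_1,x_2,x_3)^H=K(p_1,p_2,p_3)$ and $$\beta_3: p_1\mapsto-p_1,\ p_2\mapsto-p_2,\ p_3\mapsto-p_3,$$ $$-I_3: p_1\mapsto p_1,\ p_2\mapsto-p_2,\ p_3\mapsto\frac{-1-5p_1^2-7p_2^2-(p_1^2-p_2^2)(3p_1^2+17p_2^2)+9(p_1^2-p_2^2)^3}{p_3}.$$ In particular, $K(x_1,x_2,x_3)^G=k(X,Y,P_1,P_2)$ where $K=k(\sqrt a,\sqrt b)$ and $$X^2-bY^2=-\tfrac1a-5P_1^2-7bP_2^2-a(P_1^2-bP_2^2)(3P_1^2+17bP_2^2)+9a^2(P_1^2-bP_2^2)^3.$$ (4) For $G=G_{7,2,3}=\langle H,-I_3\rangle$, assume that $\sqrt{-3}\in k$. Then there exist $t_1,t_2,t_3\in K(x_1,x_2,x_3)^H$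 such that $K(x_1,x_2,x_3)^H=K(t_1,t_2,t_3)$ and $$-I_3: t_1\mapsto-t_1,\ t_2\mapsto t_2,\ t_3\mapsto\frac{(t_1^2+4)(t_1^2-t_2^2+1)}{t_3}.$$ In particular, if $\sqrt{-3},\sqrt{-1}\in k$, then $K(x_1,x_2,x_3)^G$ is $k$-rational. (5) If $\mathrm{char}\,k=3$, then $K(x_1,x_2,x_3)^G$ is $k$-rational for $G=G_{7,j,3}$ $(j=2,3,5)$.
   Context: Purely quasi-monomial action: $K/k$ is a finite field extension and a finite subgroup $G\le GL_n(\mathbb{Z})$ acts on the rational function field $K(x_1,\dots,x_n)$ by $k$-automorphisms such that $\sigma(K)\subset K$ for all $\sigma\in G$, $K^G=k$, and $\sigma=[a_{ij}]\in G$ acts on variables by $\sigma(x_j)=\prod_{i=1}^n x_i^{a_{ij}}$. In the displayed formulas only the action on variables is shown; the elements also act on $K$ through the given action. In (1) $-I_3$ acts on $K=k(\sqrt b)$ by $\sqrt b\mapsto-\sqrt b$; in (2) $-\beta_3$ acts on $K=k(\sqrt d)$ by $\sqrt d\mapsto-\sqrt d$; in (3) $\beta_3:\sqrt a\mapsto-\sqrt a,\ \sqrt b\mapsto\sqrt b$ and $-I_3:\sqrt a\mapsto\sqrt a,\ \sqrt b\mapsto-\sqrt b$ on $K=k(\sqrt a,\sqrt b)$; here $a,b,d\in k$. An assertion such as $K(x_1,x_2,x_3)^G=k(X,Y,W_1,W_2)$ means that the fixed field is generated over $k$ by elements $X,Y,W_1,W_2$ satisfying the displayed relation, with $W_1,W_2$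 (resp. $U_1,U_2$; $P_1,P_2$) algebraically independent over $k$. A finitely generated extension $F/k$ is $k$-rational if it is purely transcendental over $k$, and $k$-unirational if $k\subset F\subset k(x_1,\dots,x_m)$ for some $m$. $\mathcal{A}_4$ is the alternating group of degree $4$; $I_3$ is the $3\times3$ identity matrix. Matrices: $\sigma_{3B}=\begin{bmatrix}0&0&1\\1&0&0\\0&1&0\end{bmatrix}$, $\tau_3=\begin{bmatrix}0&1&-1\\1&0&-1\\0&0&-1\end{bmatrix}$, $\lambda_3=\begin{bmatrix}0&-1&1\\0&-1&0\\1&-1&0\end{bmatrix}$, $\beta_3=\begin{bmatrix}1&0&-1\\0&1&-1\\0&0&-1\end{bmatrix}$. Groups: $G_{7,2,3}=\langle\tau_3,\lambda_3,\sigma_{3B},-I_3\rangle$, $G_{7,3,3}=\langle\tau_3,\lambda_3,\sigma_{3B},-\beta_3\rangle$, $G_{7,5,3}=\langle\tau_3,\lambda_3,\sigma_{3B},\beta_3,-I_3\rangle$. *)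

(* Defs.v *)
(* Mathematical Components, with multinomials for polynomials in several
   variables. *)
From HB Require Import structures.
From mathcomp Require Import all_boot all_order all_fingroup all_algebra.
From mathcomp Require Import all_solvable all_field.
From mathcomp Require Import fraction mpoly.

Set Implicit Arguments.
Unset Strict Implicit.
Unset Printing Implicit Defensive.

Import GRing.Theory.
Local Open Scope ring_scope.

(* The field K(x_1, ..., x_n), with variables indexed from 0. *)
Notation ratfun K n := {fraction {mpoly K[n]}}.

Definition var (K : fieldType) (n : nat) (i : 'I_n) : ratfun K n :=
  tofrac ('X_i : {mpoly K[n]}).

Definition cst (K : fieldType) (n : nat) (c : K) : ratfun K n :=
  tofrac (c%:MP_[n]).

Definition bcst (k : fieldType) (K : fieldExtType k) (n : nat) (c : k) :
  ratfun K n := cst n (c%:A : K).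

Arguments var K {n} i.
Arguments cst {K n} c.
Arguments bcst {k} K {n} c.

(* Subfields of an ambient field F are predicates F -> Prop. The field k enters
   through an embedding iota : k -> F. *)
Section Subfields.
Variables (k F : fieldType) (iota : k -> F).

(* The subfield iota(k)(s) of F. *)
Inductive adjoin (s : seq F) : F -> Prop :=
| adjoin_base c : adjoin s (iota c)
| adjoin_gen x : x \in s -> adjoin s x
| adjoin_sub x y : adjoin s x -> adjoin s y -> adjoin s (x - y)
| adjoin_div x y : adjoin s x -> adjoin s y -> adjoin s (x / y).

Definition alg_indep (m : nat) (v : m.-tuple F) : Prop :=
  forall p : {mpoly k[m]}, mmap iota (tnth v) p = 0 -> p = 0.

Definition rational (L : F -> Prop) : Prop :=
  exists (m : nat) (v : m.-tuple F),
    alg_indep v /\ forall f, L f <-> adjoin v f.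

(* phi is a k-embedding of L into k(x_1, ..., x_m); its values outside L are
   irrelevant. *)
Definition unirational (L : F -> Prop) : Prop :=
  exists (m : nat) (phi : F -> ratfun k m),
    [/\ forall c, L (iota c) /\ phi (iota c) = cst c,
        forall x y, L x -> L y -> phi (x + y) = phi x + phi y
      & forall x y, L x -> L y -> phi (x * y) = phi x * phi y].

End Subfields.

Section IntegerMatrixGroups.
Variable n : nat.
Implicit Types (G : 'M[int]_n -> Prop) (s : seq 'M[int]_n).

Inductive mxgen s : 'M[int]_n -> Prop :=
| mxgen1 : mxgen s 1%:M
| mxgen_gen A : A \in s -> mxgen s A
| mxgenM A B : mxgen s A -> mxgen s B -> mxgen s (A *m B)
| mxgenV A : mxgen s A -> mxgen s (invmx A).

Definition finite_subgroup G : Prop :=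
  [/\ G 1%:M,
      forall A B, G A -> G B -> G (A *m B),
      forall A, G A -> A \in unitmx /\ G (invmx A)
    & exists s, forall A, G A -> A \in s].

Definition isog_Alt4 G : Prop :=
  exists f : {perm 'I_4} -> 'M[int]_n,
    [/\ {in ('Alt_('I_4))%g &, injective f},
        {in ('Alt_('I_4))%g &, forall u v, f (u * v)%g = f u *m f v}
      & forall A, G A <-> exists2 u, u \in ('Alt_('I_4))%g & f u = A].

End IntegerMatrixGroups.

Section Actions.
Variables (k : fieldType) (K : fieldExtType k) (n : nat).
Implicit Types (G : 'M[int]_n -> Prop).
Implicit Types (act : 'M[int]_n -> {rmorphism ratfun K n -> ratfun K n}).

(* G acts through act on K(x_1, ..., x_n); act is unconstrained outside G.
   As G is a group, the first three conditions make each act s, s in G,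
   bijective. *)
Definition purely_quasi_monomial G act : Prop :=
  finite_subgroup G
  /\ (forall f, act 1%:M f = f)
  /\ (forall s t f, G s -> G t -> act (s *m t) f = act s (act t f))
  /\ (forall s (c : k), G s -> act s (bcst K c) = bcst K c)
  /\ (forall s (c : K), G s -> exists c' : K, act s (cst c) = cst c')
  /\ (forall c : K, (forall s, G s -> act s (cst c) = cst c) ->
        exists c' : k, c = c'%:A)
  /\ (forall s (j : 'I_n), G s ->
        act s (var K j) = \prod_(i < n) var K i ^ (s i j)).

Definition fixed_field G act (f : ratfun K n) : Prop :=
  forall s, G s -> act s f = f.

Definition const_kernel G act (s : 'M[int]_n) : Prop :=
  G s /\ forall c : K, act s (cst c) = cst c.

End Actions.

Definition mx3 (rows : seq (seq int)) : 'M[int]_3 :=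
  \matrix_(i, j) nth 0 (nth [::] rows i) j.

Definition sigma3B : 'M[int]_3 :=
  mx3 [:: [:: 0; 0; 1];
          [:: 1; 0; 0];
          [:: 0; 1; 0]].

Definition tau3 : 'M[int]_3 :=
  mx3 [:: [:: 0; 1; -1];
          [:: 1; 0; -1];
          [:: 0; 0; -1]].

Definition lambda3 : 'M[int]_3 :=
  mx3 [:: [:: 0; -1; 1];
          [:: 0; -1; 0];
          [:: 1; -1; 0]].

Definition beta3 : 'M[int]_3 :=
  mx3 [:: [:: 1; 0; -1];
          [:: 0; 1; -1];
          [:: 0; 0; -1]].

Definition I3 : 'M[int]_3 := 1%:M.

Definition H3 := mxgen [:: tau3; lambda3; sigma3B].
Definition G723 := mxgen [:: tau3; lambda3; sigma3B; - I3].
Definition G733 := mxgen [:: tau3; lambda3; sigma3B; - beta3].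
Definition G753 := mxgen [:: tau3; lambda3; sigma3B; beta3; - I3].

Section Setting.
Variables (k : fieldType) (K : fieldExtType k).
Variable act : 'M[int]_3 -> {rmorphism ratfun K 3 -> ratfun K 3}.

Definition setting (G : 'M[int]_3 -> Prop) : Prop :=
  purely_quasi_monomial G act /\
  (forall s, const_kernel G act s <-> H3 s).

(* K(x_1, x_2, x_3)^H = K(w1, w2, w3) *)
Definition H_fixed_eq (w1 w2 w3 : ratfun K 3) : Prop :=
  forall f, fixed_field H3 act f <-> adjoin (@cst K 3) [:: w1; w2; w3] f.

(* K(x_1, x_2, x_3)^G = k(X, Y, Z1, Z2), with Z1, Z2 algebraically independent
   over k *)
Definition G_fixed_eq G (X Y Z1 Z2 : ratfun K 3) : Prop :=
  (forall f, fixed_field G act f <-> adjoin (@bcst k K 3) [:: X; Y; Z1; Z2] f)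
  /\ alg_indep (@bcst k K 3) [tuple Z1; Z2].

Definition G_rational G := rational (@bcst k K 3) (fixed_field G act).
Definition G_unirational G := unirational (@bcst k K 3) (fixed_field G act).

End Setting.

Definition has_sqrt (k : fieldType) (a : k) : Prop := exists r : k, r ^+ 2 = a.

Definition has_nontrivial_zero (k : fieldType) (d : k) : Prop :=
  exists X Y v0 v1 v2 : k,
    [|| X != 0, Y != 0, v0 != 0, v1 != 0 | v2 != 0] /\
    X ^+ 2 - d * Y ^+ 2 - 2 * v0 ^+ 2 - 2 * v1 ^+ 2 + 2 * d * v2 ^+ 2 = 0.

(* Main.v *)
From HB Require Import structures.
From Stdlib Require Import ClassicalEpsilon ZArith.
Require Import Defs.
From mathcomp Require Import all_boot all_order all_fingroup all_algebra.
From mathcomp Require Import all_solvable all_field.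
From mathcomp Require Import fraction mpoly ring ssrZ.

(* The Klein four-group <tau3, lambda3> has the invariants y1, y2, y3, permuted
   cyclically by sigma3B, and invariants u, v, g of this cyclic permutation give
   K(x1, x2, x3)^H = K(u, v, g). This field has generators t, t', p for which
   the involution phi = -I3 exchanges t and t' and maps p to p' = (t t' - 1) / p;
   -beta3 does the same for other generators. As p p' = t t' - 1 is a split
   quadric, there are generators A, B, C mapped to A, -B, -C by phi and, for
   phi = -I3, to -A, -B, -C by beta3. Dividing them by constants with the same
   signs yields generators of K(x1, x2, x3)^G over k: all the fixed fields are
   rational, without any condition on k, and accordingly the quadratic form in
   (iii) always has the zero (2, 0, 1, 1, 0). The displayed generators come from
   birational changes of the variables A, B, C; even and odd parts of w3, u3, p3
   for phi then give X and Y. *)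

Set Implicit Arguments.
Unset Strict Implicit.
Unset Printing Implicit Defensive.

Import GRing.Theory.
Local Open Scope ring_scope.

(** * Algebraic dependence over subfields *)

(** All fields are described by generators inside one ambient field, so no degree of an extension is
    computed. An invariant field is found from an explicit spanning set 1, theta or 1, w, w^2 over
    the candidate: a fixed element keeps only its coordinate at 1. Independence of new generators
    reduces to algebraicity: three elements over which F is algebraic are independent by Steinitz
    exchange.

    The coordinates t, t' come from q = (2g + u + v) / (u - v) and p = (2Q + g(u + v)) / (g(u - v)),
    where Q = u^2 - uv + v^2, which -I3 exchanges up to sign; t and t' are images of p, q under a
    Cremona map, up to sign. Used directly, p and q would give the displayed equations for w3 and p3
    with the opposite sign on the right, and this sign cannot simply be absorbed. Hence the passage
    to A, B, C, from which a quadric with the right sign is parametrized anew.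

    Constants of K with prescribed signs exist because an element acting nontrivially on K(x1, x2,
    x3)^H lies outside H and so moves some element of K. *)

Section Adjoin.
Variables (k F : fieldType) (iota : {rmorphism k -> F}).
Implicit Types (s t : seq F) (x y : F).

Lemma adjoin0 s : adjoin iota s 0.
Proof. by rewrite -(rmorph0 iota); apply: adjoin_base. Qed.

Lemma adjoin1 s : adjoin iota s 1.
Proof. by rewrite -(rmorph1 iota); apply: adjoin_base. Qed.

Lemma adjoinN s x : adjoin iota s x -> adjoin iota s (- x).
Proof. by move=> sx; rewrite -sub0r; apply: adjoin_sub => //; apply: adjoin0. Qed.

Lemma adjoinD s x y : adjoin iota s x -> adjoin iota s y -> adjoin iota s (x + y).
Proof. by move=> sx sy; rewrite -[y]opprK; apply/adjoin_sub/adjoinN. Qed.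

Lemma adjoinV s x : adjoin iota s x -> adjoin iota s x^-1.
Proof. by move=> sx; rewrite -div1r; apply: adjoin_div => //; apply: adjoin1. Qed.

Lemma adjoinM s x y : adjoin iota s x -> adjoin iota s y -> adjoin iota s (x * y).
Proof. by move=> sx sy; rewrite -[y]invrK; apply/adjoin_div/adjoinV. Qed.

Lemma adjoinX s x n : adjoin iota s x -> adjoin iota s (x ^+ n).
Proof.
move=> sx; elim: n => [|n IHn]; first by rewrite expr0; apply: adjoin1.
by rewrite exprS; apply: adjoinM.
Qed.

Lemma adjoin_nat s n : adjoin iota s n%:R.
Proof. by rewrite -(rmorph_nat iota); apply: adjoin_base. Qed.

Lemma adjoin_trans s t : (forall x, x \in s -> adjoin iota t x) ->
  forall x, adjoin iota s x -> adjoin iota t x.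
Proof.
move=> st x; elim=> [c|y /st //|y z _ ty _ tz|y z _ ty _ tz].
- exact: adjoin_base.
- exact: adjoin_sub.
- exact: adjoin_div.
Qed.

Lemma adjoin_fixed (phi : {rmorphism F -> F}) s :
  (forall c, phi (iota c) = iota c) -> (forall x, x \in s -> phi x = x) ->
  forall x, adjoin iota s x -> phi x = x.
Proof.
move=> phik phis x; elim=> [c|y /phis //|y z _ e1 _ e2|y z _ e1 _ e2] //.
- by rewrite rmorphB e1 e2.
- by rewrite fmorph_div e1 e2.
Qed.

(** Excluded middle makes the inductive predicate boolean, so that the generated subfield becomes a
    field type [adjoinT] to which [algebraicOver] and the theory of integral elements apply. *)
Definition in_adjoin s : {pred F} :=
  fun x => if excluded_middle_informative (adjoin iota s x) then true else false.

Lemma in_adjoinP s x : reflect (adjoin iota s x) (x \in in_adjoin s).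
Proof.
rewrite unfold_in /in_adjoin.
by case: excluded_middle_informative => h; constructor.
Qed.

Lemma in_adjoin_divring s : divring_closed (in_adjoin s).
Proof.
split; first exact/in_adjoinP/adjoin1.
- by move=> x y /in_adjoinP sx /in_adjoinP sy; apply/in_adjoinP/adjoin_sub.
- by move=> x y /in_adjoinP sx /in_adjoinP sy; apply/in_adjoinP/adjoin_div.
Qed.

HB.instance Definition _ s :=
  GRing.isDivringClosed.Build F (in_adjoin s) (in_adjoin_divring s).

Record adjoinT s := AdjoinT { adjoin_val :> F; _ : adjoin_val \in in_adjoin s }.
HB.instance Definition _ s := [isSub for @adjoin_val s].
HB.instance Definition _ s := [Choice of adjoinT s by <:].
HB.instance Definition _ s := [SubChoice_isSubIntegralDomain of adjoinT s by <:].
HB.instance Definition _ s := [SubIntegralDomain_isSubField of adjoinT s by <:].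


Lemma adjoinT_val s (c : adjoinT s) : adjoin iota s (val c).
Proof. exact/in_adjoinP/(valP c). Qed.

Lemma adjoinT_lift s x : adjoin iota s x -> exists c : adjoinT s, val c = x.
Proof. by move/in_adjoinP => sx; exists (AdjoinT sx). Qed.

End Adjoin.

(** Turns an equation over a field of fractions into a polynomial relation over [A]; the common
    denominator is the product of those of the coefficients. *)
Lemma clear_denominators (A : comNzRingType) (F : fieldType)
    (phi : {rmorphism A -> F}) (p : {poly F}) :
  (forall i, exists a b, phi b != 0 /\ p`_i = phi a / phi b) ->
  exists (r : {poly A}) (d : A), phi d != 0 /\ map_poly phi r = phi d *: p.
Proof.
elim/poly_ind: p => [_|p c IHp frac_p].
  by exists 0, 1; rewrite rmorph1 rmorph0 scaler0 oner_eq0.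
have [i|r [d [nz_d def_r]]] := IHp.
  by have := frac_p i.+1; rewrite coefD coefMX coefC addr0.
have [a [b [nz_b]]] := frac_p 0%N; rewrite coefD coefMX coefC add0r => /= def_c.
exists (b *: r * 'X + (d * a)%:P), (d * b).
rewrite rmorphM mulf_neq0 //; split=> //.
rewrite rmorphD rmorphM /= map_polyZ map_polyX map_polyC /= def_r rmorphM /=.
rewrite def_c scalerDr scalerA -scalerAl [phi d * phi b]mulrC; congr (_ + _).
by rewrite -mul_polyC -polyCM; congr _%:P; field.
Qed.

Lemma horner_eval_swapXY (R S : comNzRingType) (f : {rmorphism R -> S})
    (r : {poly {poly R}}) y z :
  (map_poly (horner_eval z \o map_poly f) r).[y]
    = (map_poly (horner_eval y \o map_poly f) (swapXY r)).[z].
Proof.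
elim/poly_ind: r => [|r c IHr]; first by rewrite !rmorph0 !horner0.
have evC : map_poly (horner_eval y \o map_poly f) c^:P = map_poly f c.
  by rewrite -map_poly_comp; apply: eq_map_poly => a; rewrite /= map_polyC /horner_eval hornerC.
rewrite !rmorphD !rmorphM /= swapXY_X swapXY_polyC !map_polyX !map_polyC evC.
by rewrite !hornerE IHr /= map_polyX /horner_eval hornerX.
Qed.

Section AlgebraicClosure.
Variables (k F : fieldType) (iota : {rmorphism k -> F}).
Implicit Types (s t : seq F) (x y z : F).
Local Notation adjoin := (adjoin iota).
Local Notation valF s := (\val : adjoinT iota s -> F).

Definition alg s y := algebraicOver (valF s) y.

Lemma alg_adjoin s y : adjoin s y -> alg s y.
Proof. by move/adjoinT_lift=> [c <-]; apply: algebraic_id. Qed.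

Lemma alg_mem s y : y \in s -> alg s y.
Proof. by move/(adjoin_gen iota)/alg_adjoin. Qed.

Lemma algB s x y : alg s x -> alg s y -> alg s (x - y).
Proof. exact: algebraic_sub. Qed.

Lemma algD s x y : alg s x -> alg s y -> alg s (x + y).
Proof. exact: algebraic_add. Qed.

Lemma algN s x : alg s x -> alg s (- x).
Proof. exact: algebraic_opp. Qed.

Lemma algM s x y : alg s x -> alg s y -> alg s (x * y).
Proof. exact: algebraic_mul. Qed.

Lemma alg_div s x y : alg s x -> alg s y -> alg s (x / y).
Proof. exact: algebraic_div. Qed.

Lemma algX s x n : alg s x -> alg s (x ^+ n).
Proof.
move=> sx; elim: n => [|n IHn]; first exact/alg_adjoin/adjoin1.
by rewrite exprS; apply: algM.
Qed.

Lemma alg_nat s n : alg s n%:R.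
Proof. exact/alg_adjoin/adjoin_nat. Qed.

(** Over a field, algebraic and integral mean the same, so transitivity of integral dependence
    allows coefficients that are themselves only algebraic. *)
Lemma alg_root s (p : {poly F}) y :
  p != 0 -> (forall i, alg s p`_i) -> root p y -> alg s y.
Proof.
move=> nz_p sp py; apply/integral_algebraic/(integral_root nz_p py).
by move=> _ /(nthP 0)[i _ <-]; apply/integral_algebraic/sp.
Qed.

Lemma alg_trans s t y : (forall x, x \in s -> alg t x) -> alg s y -> alg t y.
Proof.
move=> st [p nz_p py]; apply: alg_root py; first by rewrite map_poly_eq0.
suff tP x : adjoin s x -> alg t x by move=> i; rewrite coef_map; apply/tP/adjoinT_val.
elim=> // [c|x1 x2 _ tx1 _|x1 x2 _ tx1 _]; first by apply: alg_adjoin; apply: adjoin_base.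
- exact: algB.
- exact: alg_div.
Qed.

Lemma alg_sqrt s y : alg s (y ^+ 2) -> alg s y.
Proof.
move=> sy2; apply: (@alg_root _ ('X^2 - (y ^+ 2)%:P)).
- by rewrite -size_poly_eq0 size_XnsubC.
- move=> i; rewrite coefB coefXn coefC; apply: algB; first by case: eqP => _; apply: alg_nat.
  by case: eqP => _ //; apply: (alg_nat _ 0).
- by rewrite rootE !hornerE subrr.
Qed.

Lemma alg_cubic s y a b c : y ^+ 3 = a * y ^+ 2 + b * y + c ->
  alg s a -> alg s b -> alg s c -> alg s y.
Proof.
move=> def_y3 sa sb sc; apply: (@alg_root _ ('X^3 - Poly [:: c; b; a])).
- rewrite -size_poly_eq0 size_polyDl ?size_polyXn //.
  by rewrite size_polyN (leq_ltn_trans (size_Poly _)).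
- move=> i; rewrite coefB coefXn coef_Poly; apply: algB; first by case: eqP => _; apply: alg_nat.
  by case: i => [|[|[|i]]] //=; rewrite nth_nil; apply: (alg_nat _ 0).
- by rewrite rootE !hornerE /= def_y3; apply/eqP; ring.
Qed.

Lemma alg_subset s t y : {subset s <= t} -> alg s y -> alg t y.
Proof. by move=> st; apply: alg_trans => x /st/alg_mem. Qed.

Definition evalL s z : {rmorphism {poly adjoinT iota s} -> F} :=
  horner_eval z \o map_poly (valF s).
Arguments evalL : simpl never.

Let evalLE s z p : evalL s z p = (map_poly (valF s) p).[z]. Proof. by []. Qed.

Lemma adjoin_cons_frac s z x : adjoin (z :: s) x ->
  exists a b, evalL s z b != 0 /\ x = evalL s z a / evalL s z b.
Proof.
pose ev := evalL s z.
have evX : ev 'X = z by rewrite /ev evalLE map_polyX hornerX.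
have evC c : ev c%:P = val c by rewrite /ev evalLE map_polyC hornerC.
have frac0 a : exists a' b, ev b != 0 /\ ev a = ev a' / ev b.
  by exists a, 1; rewrite rmorph1 divr1 oner_eq0.
elim=> [c|y|y y' _ [a [b [nz_b ->]]] _ [a' [b' [nz_b' ->]]]|].
- have [d <-] := adjoinT_lift (adjoin_base iota s c).
  by have := frac0 d%:P; rewrite {1}evC.
- rewrite inE => /predU1P[->|/(adjoin_gen iota)/adjoinT_lift[d <-]].
    by have := frac0 'X; rewrite {1}evX.
  by have := frac0 d%:P; rewrite {1}evC.
- exists (a * b' - a' * b), (b * b'); rewrite rmorphB !rmorphM mulf_neq0 //.
  by split=> //; field; rewrite nz_b nz_b'.
- move=> y y' _ [a [b [nz_b ->]]] _ [a' [b' [nz_b' ->]]].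
have [a'0|nz_a'] := eqVneq (evalL s z a') 0.
  by exists 0, 1; rewrite rmorph1 oner_eq0 rmorph0; rewrite a'0 mul0r invr0 mulr0 mul0r.
exists (a * b'), (b * a'); rewrite !rmorphM mulf_neq0 //.
by split=> //; field; rewrite nz_b nz_b' nz_a'.
Qed.

Lemma evalL_swap s y z (r : {poly {poly adjoinT iota s}}) :
  (map_poly (evalL s z) r).[y] = (map_poly (evalL s y) (swapXY r)).[z].
Proof. exact: horner_eval_swapXY. Qed.

(** After clearing denominators, an equation for y over k(s, z) is a polynomial in two variables
    vanishing at (z, y). Exchanging the variables makes it an equation for z over k(s, y). *)
Lemma alg_exchange s y z : alg (z :: s) y -> ~ alg s y -> alg (y :: s) z.
Proof.
move=> [p nz_p py] not_sy.
have [r [d [nz_d def_r]]] : exists (r : {poly {poly adjoinT iota s}}) d,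
    evalL s z d != 0 /\
    map_poly (evalL s z) r = evalL s z d *: map_poly (valF (z :: s)) p.
  apply: clear_denominators => i; rewrite coef_map.
  exact/adjoin_cons_frac/adjoinT_val.
have nz_r : swapXY r != 0.
  rewrite swapXY_eq0; apply/eqP=> r0; move/eqP: def_r; rewrite r0 rmorph0.
  by rewrite eq_sym scaler_eq0 (negPf nz_d) map_poly_eq0 (negPf nz_p).
have zr : root (map_poly (evalL s y) (swapXY r)) z.
  by rewrite /root -evalL_swap def_r hornerZ (rootP py) mulr0.
(* If that equation is trivial, every coefficient vanishes at y; the leading one is a nonzero
   polynomial over k(s), so y would be algebraic over s. *)
have [q0|nz_q] := eqVneq (map_poly (evalL s y) (swapXY r)) 0; last first.
  suff sy q : alg (y :: s) (evalL s y q).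
    by apply: alg_root nz_q _ zr => i; rewrite coef_map; apply: sy.
  rewrite evalLE horner_coef;  elim/big_rec: _ => [|j u _ su]; first exact: (alg_nat _ 0).
  apply/algD/su/algM/algX/alg_mem/mem_head; rewrite coef_map.
  apply/(@alg_subset s); first by move=> u' su'; rewrite inE su' orbT.
  exact/alg_adjoin/adjoinT_val.
case: not_sy; move: nz_r; rewrite -lead_coef_eq0 lead_coefE => nz_c.
exists (swapXY r)`_(size (swapXY r)).-1 => //.
by have := coef_map (evalL s y) (swapXY r) (size (swapXY r)).-1;
  rewrite q0 coef0 => /esym/eqP.
Qed.

Fixpoint algfree s := if s is x :: s' then ~ alg s' x /\ algfree s' else True.

(** Elements of [t] are skipped from the left as long as x stays algebraic over the rest; the first
    one that is essential for x is exchanged with it. *)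
Lemma algfree_replace s t x : ~ alg s x -> alg (s ++ t) x ->
  exists2 t', (size t').+1 = size t & forall z, z \in t -> alg (x :: s ++ t') z.
Proof.
move=> not_sx; elim: t => [|z t IHt]; first by rewrite cats0.
move=> st; have [/IHt [t' def_t' tt']|not_st] :=
  excluded_middle_informative (alg (s ++ t) x).
  exists (z :: t') => [|y]; first by rewrite /= def_t'.
  rewrite inE => /predU1P[->|/tt']; last first.
    by apply: alg_subset => u; rewrite !(inE, mem_cat) => /or3P[]->; rewrite ?orbT.
  by apply: alg_mem; rewrite inE mem_cat mem_head !orbT.
exists t => // y; rewrite inE => /predU1P[->|ty]; last first.
  by apply: alg_mem; rewrite inE mem_cat ty !orbT.
apply: alg_exchange not_st; apply: alg_subset st => u.
by rewrite !(inE, mem_cat); case: (u == z); rewrite ?orbT.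
Qed.

Lemma steinitz s t : algfree s -> (forall x, x \in s -> alg t x) ->
  (size s <= size t)%N.
Proof.
(* The elements of [s] replace elements of [t] one by one, and t' is what remains of [t]. *)
move=> free_s st; suff [t' def_t' _] : exists2 t', (size t' + size s)%N = size t
    & forall z, z \in t -> alg (s ++ t') z by rewrite -def_t' leq_addl.
elim: s free_s st => [|x s IHs] /=; first by move=> _ _; exists t => [|z]; [rewrite addn0 | apply: alg_mem].
case=> not_sx free_s st; have [y sy|t' def_t' tt'] := IHs free_s.
  by apply: st; rewrite inE sy orbT.
have [|t2 def_t2 t't2] := @algfree_replace s t' x not_sx.
  exact: alg_trans tt' (st x (mem_head _ _)).
exists t2 => [|z /tt']; first by rewrite addnS -addSn def_t2.
apply: alg_trans => y; rewrite mem_cat => /orP[sy|/t't2//].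
by apply: alg_mem; rewrite inE mem_cat sy orbT.
Qed.

Lemma not_algfree s : ~ algfree s ->
  exists2 t, (size t < size s)%N & forall x, x \in s -> alg t x.
Proof.
elim: s => [|x s IHs] /=; first by case.
move=> not_xs; have [free_s|/IHs[t lt_ts st]] := excluded_middle_informative (algfree s).
  have [sx|] := excluded_middle_informative (alg s x); last by move=> not_sx; case: not_xs.
  by exists s => // y; rewrite inE => /predU1P[->|/alg_mem].
exists (x :: t) => // y; rewrite inE => /predU1P[->|/st].
  exact/alg_mem/mem_head.
by apply: alg_subset => u tu; rewrite inE tu orbT.
Qed.

End AlgebraicClosure.

Lemma alg_base_change (k K F : fieldType) (iota : {rmorphism k -> F})
    (iota' : {rmorphism K -> F}) s y :
  (forall c, alg iota [::] (iota' c)) -> alg iota' s y -> alg iota s y.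
Proof.
move=> algK [p nz_p py]; apply: alg_root py; first by rewrite map_poly_eq0.
suff sP x : adjoin iota' s x -> alg iota s x by move=> i; rewrite coef_map; apply/sP/adjoinT_val.
elim=> [c|x1|x1 x2 _ sx1 _|x1 x2 _ sx1 _].
- by apply: alg_trans (algK c).
- exact: alg_mem.
- exact: algB.
- exact: alg_div.
Qed.

(** * Multivariate polynomials and algebraic independence *)

Lemma mpoly_rmorph_eq n (R : nzRingType) (S : nzRingType)
    (f g : {rmorphism {mpoly R[n]} -> S}) :
  (forall c, f c%:MP = g c%:MP) -> (forall i, f 'X_i = g 'X_i) -> f =1 g.
Proof.
move=> eqC eqX p; rewrite [p]mpolyE !rmorph_sum; apply: eq_bigr => m _.
rewrite -mul_mpolyC !rmorphM /= eqC; congr (_ * _).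
by rewrite mpolyXE_id !rmorph_prod; apply: eq_bigr => i _; rewrite !rmorphXn /= eqX.
Qed.

Local Notation widen := (widen_ord (leqnSn _)).

Section Muni.
Variables (n : nat) (R : comNzRingType).

Lemma muni_widen (p : {mpoly R[n]}) : muni (mwiden p) = p%:P.
Proof.
pose f : {rmorphism {mpoly R[n]} -> {poly {mpoly R[n]}}} := @muni n R \o @mwiden n R.
pose g : {rmorphism {mpoly R[n]} -> {poly {mpoly R[n]}}} := polyC.
apply: (@mpoly_rmorph_eq _ _ _ f g) => [c|i]; rewrite /f /g /=.
  by rewrite mwidenC muniC.
rewrite mwidenX mnmwiden1 muniE msuppX big_seq1 mcoeffX eqxx scale1r.
have -> : [multinom (U_(widen i) (widen j))%MM | j < n]%MM = U_(i)%MM.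
  by apply/mnmP=> j; rewrite mnmE !mnm1E.
rewrite mnm1E; case: eqP => [/(congr1 val)/= def_n|_].
  by have := ltn_ord i; rewrite def_n ltnn.
by rewrite expr0 alg_polyC.
Qed.

Lemma muni_last : muni ('X_ord_max : {mpoly R[n.+1]}) = 'X.
Proof.
rewrite muniE msuppX big_seq1 mcoeffX eqxx scale1r mnm1E eqxx expr1.
have -> : [multinom (U_(ord_max) (widen j))%MM | j < n]%MM = 0%MM.
  apply/mnmP=> j; rewrite mnmE mnm1E mnm0E; case: eqP => // /(congr1 val)/= def_n.
  by have := ltn_ord j; rewrite -def_n ltnn.
by rewrite mpolyX0 scale1r.
Qed.

Definition of_uni : {rmorphism {poly {mpoly R[n]}} -> {mpoly R[n.+1]}} :=
  horner_eval 'X_ord_max \o map_poly (@mwiden n R).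

Lemma of_uniE p : of_uni p = (map_poly (@mwiden n R) p).['X_ord_max].
Proof. by []. Qed.

Lemma of_uniK (p : {poly {mpoly R[n]}}) : muni (of_uni p) = p.
Proof.
elim/poly_ind: p => [|p c IHp]; first by rewrite !raddf0.
rewrite rmorphD rmorphM [of_uni 'X]of_uniE map_polyX hornerX.
rewrite [of_uni c%:P]of_uniE map_polyC hornerC.
by rewrite rmorphD rmorphM /= muni_last IHp muni_widen.
Qed.

Lemma uniK (p : {mpoly R[n.+1]}) : of_uni (muni p) = p.
Proof.
pose f : {rmorphism {mpoly R[n.+1]} -> {mpoly R[n.+1]}} := of_uni \o @muni n R.
apply: (@mpoly_rmorph_eq _ _ _ f idfun) => [c|i]; rewrite /f /=.
  by rewrite muniC -[LHS]/(of_uni _) of_uniE map_polyC hornerC /= mwidenC.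
have [->|ne_i] := eqVneq i ord_max.
  by rewrite muni_last -[LHS]/(of_uni _) of_uniE map_polyX hornerX.
have lt_i : (i < n)%N.
  by have := ltn_ord i; rewrite ltnS leq_eqVlt => /predU1P[def_i|//]; case/eqP: ne_i; apply: val_inj.
have -> : i = widen (Ordinal lt_i) by apply: val_inj.
by rewrite -mnmwiden1 -mwidenX muni_widen -[LHS]/(of_uni _) of_uniE map_polyC hornerC.
Qed.

End Muni.
Arguments of_uni {n R}.

Section AlgIndep.
Variables (k F : fieldType) (iota : {rmorphism k -> F}).
Implicit Types (s : seq F).

Definition aindep n (v : 'I_n -> F) := forall p, mmap iota v p = 0 -> p = 0.

Definition front n (v : 'I_n.+1 -> F) (i : 'I_n) := v (widen i).

Lemma mmap_of_uni n (v : 'I_n.+1 -> F) (p : {poly {mpoly k[n]}}) :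
  mmap iota v (of_uni p) = (map_poly (mmap iota (front v)) p).[v ord_max].
Proof.
have vw c : mmap iota v (mwiden c) = mmap iota (front v) c.
  pose f : {rmorphism {mpoly k[n]} -> F} := mmap iota v \o @mwiden n k.
  apply: (@mpoly_rmorph_eq _ _ _ f (mmap iota (front v))) => [a|i]; rewrite /f /=.
    by rewrite mwidenC !mmapC.
  by rewrite mwidenX mnmwiden1 !mmapX !mmap1U.
elim/poly_ind: p => [|p c IHp]; first by rewrite !raddf0 horner0.
rewrite (rmorphD of_uni) (rmorphM of_uni) [of_uni 'X]of_uniE [of_uni c%:P]of_uniE.
rewrite map_polyX map_polyC hornerX hornerC mmapD.
have -> : mmap iota v (of_uni p * 'X_ord_max) = mmap iota v (of_uni p) * v ord_max.
  by rewrite rmorphM /= mmapX mmap1U.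
rewrite IHp vw.
by rewrite !rmorphD !rmorphM /= map_polyX map_polyC !hornerE.
Qed.

Lemma aindep_front n (v : 'I_n.+1 -> F) : aindep v -> aindep (front v).
Proof.
move=> indep_v p p0; apply/(@inj_mwiden n k); rewrite raddf0; apply: indep_v.
by rewrite -(hornerC (mwiden p) 'X_ord_max) -(map_polyC (@mwiden n k)) -of_uniE mmap_of_uni map_polyC hornerC.
Qed.

Lemma adjoin_mmap_frac n (v : 'I_n -> F) x :
  adjoin iota (codom v) x -> exists p q : {mpoly k[n]},
    mmap iota v q != 0 /\ x = mmap iota v p / mmap iota v q.
Proof.
elim=> [c|_ /codomP[i ->]|y y' _ [a [b [nz_b ->]]] _ [a' [b' [nz_b' ->]]]|].
- by exists c%:MP, 1; rewrite rmorph1 divr1 oner_eq0 mmapC.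
- by exists 'X_i, 1; rewrite rmorph1 divr1 oner_eq0 mmapX mmap1U.
- exists (a * b' - a' * b), (b * b'); rewrite rmorphB !rmorphM mulf_neq0 //.
  by split=> //; field; rewrite nz_b nz_b'.
- move=> y y' _ [a [b [nz_b ->]]] _ [a' [b' [nz_b' ->]]].
  have [a'0|nz_a'] := eqVneq (mmap iota v a') 0.
    by exists 0, 1; rewrite rmorph1 oner_eq0 rmorph0; rewrite a'0 mul0r invr0 mulr0 mul0r.
  exists (a * b'), (b * a'); rewrite !rmorphM mulf_neq0 //.
  by split=> //; field; rewrite nz_b nz_b' nz_a'.
Qed.

Lemma adjoin_mmap n (v : 'I_n -> F) p : adjoin iota (codom v) (mmap iota v p).
Proof.
rewrite /mmap; elim/big_rec: _ => [|m x _ sx]; first exact: adjoin0.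
apply/adjoinD/sx/adjoinM; first exact: adjoin_base.
rewrite /mmap1; elim/big_rec: _ => [|i y _ sy]; first exact: adjoin1.
exact/adjoinM/sy/adjoinX/adjoin_gen/codom_f.
Qed.

(** Induction on the number of variables, reading a polynomial as one in the last variable over the
    others. The list is reversed because [algfree] splits off the head and [front] drops the last
    element. *)
Lemma aindepP n (v : 'I_n -> F) : aindep v <-> algfree iota (rev (codom v)).
Proof.
elim: n v => [|n IHn] v.
  rewrite /codom /image_mem enum_ord0; split=> // _ p.
  have -> : p = (p@_0)%:MP.
    apply/mpolyP=> m; have -> : m = 0%MM by apply/mnmP; case.
    by rewrite mcoeffC eqxx mulr1.
  by rewrite mmapC => /eqP; rewrite fmorph_eq0 => /eqP->; rewrite mpolyC0.
have -> : codom v = rcons (codom (front v)) (v ord_max).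
  by rewrite /codom /image_mem enum_ordSr map_rcons -map_comp; congr rcons; apply: eq_map => i; congr v; apply: val_inj.
rewrite rev_rcons /=; split=> [indep_v|[not_alg /IHn indep_v] p].
  split; last exact/IHn/aindep_front.
  case=> p nz_p vp; have [i|r [d [nz_d def_r]]] := @clear_denominators _ _ (mmap iota (front v)) (map_poly val p).
    by rewrite coef_map; apply: adjoin_mmap_frac; have := adjoinT_val p`_i; apply: adjoin_trans => x; rewrite mem_rev; apply: adjoin_gen.
  have r0 : r = 0.
    apply: (can_inj (@of_uniK n k)); rewrite raddf0; apply: indep_v.
    by rewrite mmap_of_uni def_r hornerZ (rootP vp) mulr0.
  by move/eqP: def_r; rewrite r0 rmorph0 eq_sym scaler_eq0 (negPf nz_d) map_poly_eq0 (negPf nz_p).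
rewrite -{1}[p]uniK mmap_of_uni => p0; rewrite -[p]uniK.
suff -> : muni p = 0 by rewrite raddf0.
apply/polyP=> i; rewrite coef0; apply: indep_v; rewrite -coef_map.
have [->|nz_q] := eqVneq (map_poly (mmap iota (front v)) (muni p)) 0; first exact: coef0.
case: not_alg; apply: alg_root nz_q _ (introT rootP p0) => j.
rewrite coef_map; apply: alg_adjoin; have := @adjoin_mmap _ (front v) (muni p)`_j.
by apply: adjoin_trans => x; rewrite -mem_rev; apply: adjoin_gen.
Qed.

Lemma codom_tnth n (v : n.-tuple F) : codom (tnth v) = v.
Proof. by rewrite /codom /image_mem map_tnth_enum. Qed.

Lemma alg_indepP n (v : n.-tuple F) : alg_indep iota v <-> algfree iota (rev v).
Proof. by have := aindepP (tnth v); rewrite codom_tnth. Qed.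

(** If v were dependent, it would be algebraic over a list of fewer than n elements, and so would x,
    against [steinitz]. *)
Lemma alg_indep_span n (x v : n.-tuple F) : alg_indep iota x ->
  (forall y, y \in (x : seq F) -> alg iota v y) -> alg_indep iota v.
Proof.
move=> /alg_indepP free_x vx; apply/alg_indepP.
have [//|/not_algfree[t]] := excluded_middle_informative (algfree iota (rev v)).
rewrite size_rev size_tuple => lt_tn tv; suff : (n <= size t)%N by rewrite leqNgt lt_tn.
rewrite -{1}(size_tuple x) -(size_rev x); apply: (steinitz free_x) => y.
rewrite mem_rev => /vx; apply: alg_trans => z vz; apply: tv; by rewrite mem_rev.
Qed.

End AlgIndep.

(** * Rational function fields and nonvanishing *)

(** The embedding sends each generator to a variable. Its value at f is chosen by [epsilon] among
    the fractions representing f, which are all equal by algebraic independence. *)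
Lemma rational_unirational (k F : fieldType) (iota : {rmorphism k -> F})
    (L : F -> Prop) : rational iota L -> unirational iota L.
Proof.
move=> [m [v [indep_v defL]]].
pose P f (r : ratfun k m) := exists p q : {mpoly k[m]},
  [/\ mmap iota (tnth v) q != 0, f = mmap iota (tnth v) p / mmap iota (tnth v) q
    & r = tofrac p / tofrac q].
have nzq (q : {mpoly k[m]}) : mmap iota (tnth v) q != 0 -> tofrac q != 0.
  by apply: contraNneq => /eqP; rewrite tofrac_eq0 => /eqP->; rewrite raddf0.
have Puniq f r r' : P f r -> P f r' -> r = r'.
  move=> [p [q [nz_q -> ->]]] [p' [q' [nz_q' /eqP eq_f ->]]].
  apply/eqP; rewrite eqr_div ?nzq // -!tofracM tofrac_eq -subr_eq0; apply/eqP.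
  apply: indep_v; apply/eqP; rewrite rmorphB !rmorphM subr_eq0.
  by rewrite eqr_div in eq_f.
have PL f : L f -> exists r, P f r.
  move=> /defL; rewrite -{1}(codom_tnth v) => /adjoin_mmap_frac[p [q [nz_q ->]]].
  by exists (tofrac p / tofrac q), p, q.
pose phi f := epsilon (inhabits 0) (P f).
have phiP f : L f -> P f (phi f) by move=> /PL; apply: epsilon_spec.
have LC c : L (iota c) by apply/defL; apply: adjoin_base.
exists m, phi; split=> [c|x y Lx Ly|x y Lx Ly].
- split=> //; apply: Puniq (phiP _ (LC c)) _; exists c%:MP, 1.
  by rewrite !rmorph1 !divr1 oner_eq0 mmapC.
- apply: Puniq (phiP _ _) _; first by apply/defL/adjoinD; apply/defL.
  have [p [q [nz_q def_x ->]]] := phiP x Lx; have [p' [q' [nz_q' def_y ->]]] := phiP y Ly.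
  exists (p * q' + p' * q), (q * q').
  split; first by rewrite rmorphM mulf_neq0.
    by rewrite {1}def_x {1}def_y addf_div // rmorphD !rmorphM.
  by rewrite addf_div ?nzq // rmorphD !rmorphM.
- apply: Puniq (phiP _ _) _; first by apply/defL/adjoinM; apply/defL.
  have [p [q [nz_q def_x ->]]] := phiP x Lx; have [p' [q' [nz_q' def_y ->]]] := phiP y Ly.
  exists (p * p'), (q * q').
  split; first by rewrite rmorphM mulf_neq0.
    by rewrite {1}def_x {1}def_y mulf_div !rmorphM.
  by rewrite mulf_div !rmorphM.
Qed.

Lemma alg_indep_base (k K F : fieldType) (j : {rmorphism k -> K})
    (iota : {rmorphism K -> F}) n (v : n.-tuple F) :
  alg_indep iota v -> alg_indep (iota \o j) v.
Proof.
move=> indep_v p p0; have /indep_v : mmap iota (tnth v) (map_mpoly j p) = 0.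
  rewrite -p0; pose f : {rmorphism {mpoly k[n]} -> F} := mmap iota (tnth v) \o map_mpoly j.
  apply: (@mpoly_rmorph_eq _ _ _ f (mmap (iota \o j) (tnth v))) => [c|i]; rewrite /f /=.
    by rewrite map_mpolyC !mmapC.
  by rewrite map_mpolyX !mmapX !mmap1U.
move/mpolyP=> jp0; apply/mpolyP=> m; apply/eqP.
by have := jp0 m; rewrite mcoeff_map_mpoly !mcoeff0 => /eqP; rewrite fmorph_eq0.
Qed.

(* Polynomial expressions in three variables are tested for being nonzero by
   the Kronecker substitution X_i -> X^(d_i), computing with integer
   coefficients: a coefficient +-2^n survives in characteristic other than 2. *)
Inductive pexpr :=
  PV of nat | PN of nat | PD of pexpr & pexpr | PM of pexpr & pexpr
| PO of pexpr | PX of pexpr & nat.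

Fixpoint peval (R : comNzRingType) (env : nat -> R) (e : pexpr) : R :=
  match e with
  | PV i => env i
  | PN n => n%:R
  | PD a b => peval env a + peval env b
  | PM a b => peval env a * peval env b
  | PO a => - peval env a
  | PX a n => peval env a ^+ n
  end.

Lemma peval_rmorph (R S : comNzRingType) (f : {rmorphism R -> S}) env e :
  f (peval env e) = peval (f \o env) e.
Proof.
elim: e => //= [n|a <- b <-|a <- b <-|a <-|a <- n].
- by rewrite rmorph_nat.
- by rewrite rmorphD.
- by rewrite rmorphM.
- by rewrite rmorphN.
- by rewrite rmorphXn.
Qed.

Fixpoint ladd (p q : seq Z) : seq Z :=
  match p, q with
  | [::], _ => q
  | _, [::] => p
  | a :: p', b :: q' => Z.add a b :: ladd p' q'
  end.

Fixpoint lmul (p q : seq Z) : seq Z :=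
  if p is a :: p' then ladd (map (Z.mul a) q) (Z0 :: lmul p' q) else [::].

Fixpoint lexp (p : seq Z) n : seq Z :=
  if n is n'.+1 then lmul p (lexp p n') else [:: Zpos xH].

Fixpoint leval (d : nat -> nat) (e : pexpr) : seq Z :=
  match e with
  | PV i => nseq (d i) Z0 ++ [:: Zpos xH]
  | PN n => [:: Z.of_nat n]
  | PD a b => ladd (leval d a) (leval d b)
  | PM a b => lmul (leval d a) (leval d b)
  | PO a => map Z.opp (leval d a)
  | PX a n => lexp (leval d a) n
  end.

Fixpoint pow2pos (p : positive) : bool :=
  match p with xH => true | xO q => pow2pos q | xI _ => false end.

Definition pow2Z (z : Z) : bool :=
  match z with Z0 => false | Zpos p | Zneg p => pow2pos p end.

Section Reflection.
Variable k : fieldType.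
Hypothesis two_neq0 : 2 != 0 :> k.

Definition zval (z : Z) : k := (int_of_Z z)%:~R.

Lemma zvalD a b : zval (Z.add a b) = zval a + zval b.
Proof. exact: (rmorphD (intr \o int_of_Z)). Qed.

Lemma zvalM a b : zval (Z.mul a b) = zval a * zval b.
Proof. exact: (rmorphM (intr \o int_of_Z)). Qed.

Lemma zvalN a : zval (Z.opp a) = - zval a.
Proof. exact: (rmorphN (intr \o int_of_Z)). Qed.

Lemma zval_nat n : zval (Z.of_nat n) = n%:R.
Proof.
elim: n => // n IHn.
by rewrite Nat2Z.inj_succ -Z.add_1_r zvalD IHn -natr1.
Qed.

Definition lpoly (l : seq Z) : {poly k} :=
  foldr (fun c p => (zval c)%:P + 'X * p) 0 l.

Lemma lpolyD p q : lpoly (ladd p q) = lpoly p + lpoly q.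
Proof.
elim: p q => [|a p IHp] [|b q] //=; rewrite ?add0r ?addr0 // IHp.
by rewrite zvalD polyCD mulrDr addrACA.
Qed.

Lemma lpolyZ a p : lpoly (map (Z.mul a) p) = (zval a)%:P * lpoly p.
Proof.
elim: p => [|b p IHp] /=; first by rewrite mulr0.
by rewrite IHp zvalM polyCM mulrDr mulrCA.
Qed.

Lemma lpolyM p q : lpoly (lmul p q) = lpoly p * lpoly q.
Proof.
elim: p => [|a p IHp] /=; first by rewrite mul0r.
by rewrite lpolyD lpolyZ /= IHp polyC0 add0r mulrDl mulrA.
Qed.

Lemma leval_poly d e : lpoly (leval d e) = peval (fun i => 'X ^+ d i) e.
Proof.
elim: e => [i|n|a IHa b IHb|a IHa b IHb|a IHa|a IHa n] /=.
- elim: (d i) => [|n IHn] /=; first by rewrite mulr0 addr0 polyC1.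
  by rewrite IHn polyC0 add0r exprS.
- by rewrite mulr0 addr0 zval_nat polyC_natr.
- by rewrite lpolyD IHa IHb.
- by rewrite lpolyM IHa IHb.
- rewrite -IHa; elim: (leval d a) => [|c l IHl] /=; first by rewrite oppr0.
  by rewrite IHl zvalN polyCN opprD mulrN.
- rewrite -IHa; elim: n => [|n IHn] /=; first by rewrite mulr0 addr0.
  by rewrite lpolyM IHn exprS.
Qed.

Lemma pow2_neq0 z : pow2Z z -> zval z != 0.
Proof.
have pow2P p : pow2pos p -> zval (Zpos p) != 0.
  elim: p => //= [p IHp|_]; last by rewrite oner_eq0.
  move=> /IHp nz_p; have -> : Zpos (xO p) = Z.mul (Z.of_nat 2) (Zpos p) by [].
  by rewrite zvalM zval_nat mulf_neq0.
case: z => //= p /pow2P nz_p.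
by have -> : Zneg p = Z.opp (Zpos p) by []; rewrite zvalN oppr_eq0.
Qed.

Lemma leval_neq0 d e : has pow2Z (leval d e) ->
  peval (fun i => 'X ^+ d i) e != 0 :> {poly k}.
Proof.
move=> /hasP[c lc /pow2_neq0]; apply: contraNneq; rewrite -leval_poly => l0.
have [i lt_i def_c] := nthP Z0 lc; rewrite -def_c -(coef0 _ i) -{}l0 {c lc def_c} eq_sym.
elim: (leval d e) i lt_i => //= c l IHl [_|i lt_i] /=.
  by rewrite coefD coefC coefXM addr0.
by rewrite coefD coefC coefXM add0r; apply: IHl.
Qed.

End Reflection.

Lemma eq_peval (R : comNzRingType) (env env' : nat -> R) e :
  env =1 env' -> peval env e = peval env' e.
Proof. by move=> eq_env; elim: e => //= [a -> b ->|a -> b ->|a ->|a ->]. Qed.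

(** The default 1 matches the default exponent 0 of the Kronecker substitution. *)
Definition env3 (R : nzRingType) (x y z : R) (i : nat) : R := nth 1 [:: x; y; z] i.

Lemma free3_neq0 (k F : fieldType) (iota : {rmorphism k -> F}) x y z d0 d1 d2 e :
  2 != 0 :> k -> alg_indep iota [tuple x; y; z] ->
  has pow2Z (leval (fun i => nth 0%N [:: d0; d1; d2] i) e) ->
  peval (env3 x y z) e != 0.
Proof.
move=> nz2 indep /(leval_neq0 nz2); apply: contraNneq => e0.
pose env (i : nat) : {mpoly k[3]} := if insub i is Some j then 'X_j else 1.
have env0 : peval env e = 0.
  apply: indep; rewrite -{}e0 (peval_rmorph (mmap iota _)).
  apply: eq_peval => -[|[|[|i]]] /=; rewrite /env /=.
  - by case: insubP => // j _ def_j; rewrite mmapX mmap1U (tnth_nth 0) def_j.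
  - by case: insubP => // j _ def_j; rewrite mmapX mmap1U (tnth_nth 0) def_j.
  - by case: insubP => // j _ def_j; rewrite mmapX mmap1U (tnth_nth 0) def_j.
  - by rewrite insubN // rmorph1 /env3 nth_default.
pose d i := nth 0%N [:: d0; d1; d2] i.
pose g : {rmorphism {mpoly k[3]} -> {poly k}} := mmap polyC (fun j : 'I_3 => 'X ^+ d j).
have := congr1 g env0; rewrite rmorph0 => <-; rewrite peval_rmorph.
apply/eqP/eq_peval => i; rewrite /= /env; case: insubP => [j _ <-|]; last first.
  by rewrite -leqNgt rmorph1 => le3i; rewrite nth_default // expr0.
by rewrite [RHS]mmapX mmap1U.
Qed.

Ltac pe_reify x y z t :=
  lazymatch t with
  | x => constr:(PV 0%N)
  | y => constr:(PV 1%N)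
  | z => constr:(PV 2%N)
  | @GRing.add _ ?a ?b =>
      let a' := pe_reify x y z a in let b' := pe_reify x y z b in constr:(PD a' b')
  | @GRing.mul _ ?a ?b =>
      let a' := pe_reify x y z a in let b' := pe_reify x y z b in constr:(PM a' b')
  | @GRing.opp _ ?a => let a' := pe_reify x y z a in constr:(PO a')
  | @GRing.exp _ ?a ?n => let a' := pe_reify x y z a in constr:(PX a' n)
  | @GRing.natmul _ (GRing.one _) ?n => constr:(PN n)
  | GRing.one _ => constr:(PN 1%N)
  end.

(* [free] is a proof of algebraic independence of x, y, z; the degrees d0, d1,
   d2 define the Kronecker substitution. *)
Ltac neq0_by nz2 free x y z d0 d1 d2 :=
  lazymatch goal with
  | |- is_true (?t != 0) =>
      let e := pe_reify x y z t in
      apply: (@free3_neq0 _ _ _ x y z d0 d1 d2 e nz2 free); vm_compute; reflexivity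
  end.

(** * Galois descent *)

Ltac in_adj :=
  try assumption;
  lazymatch goal with
  | |- adjoin _ _ (_ + _) => apply: adjoinD; in_adj
  | |- adjoin _ _ (_ * _) => apply: adjoinM; in_adj
  | |- adjoin _ _ (- _) => apply: adjoinN; in_adj
  | |- adjoin _ _ (_^-1) => apply: adjoinV; in_adj
  | |- adjoin _ _ (_ ^+ _) => apply: adjoinX; in_adj
  | |- adjoin _ _ (_%:R) => exact: adjoin_nat
  | |- adjoin _ _ 1 => exact: adjoin1
  | |- adjoin _ _ 0 => exact: adjoin0
  | |- adjoin _ _ _ => try by apply: adjoin_gen; rewrite !inE eqxx ?orbT
  | |- _ => idtac
  end.

Section QuadraticDescent.
Variables (k k' F : fieldType) (iota : {rmorphism k -> F}) (iota' : {rmorphism k' -> F}).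
Variables (s t : seq F) (phi : {rmorphism F -> F}) (theta : F).
Local Notation M := (adjoin iota s).
Hypothesis nz2 : 2 != 0 :> F.
Hypothesis phi_fix : forall x, M x -> phi x = x.
Hypothesis phi_theta : phi theta = - theta.
Hypothesis nz_theta : theta != 0.
Hypothesis M_theta2 : M (theta ^+ 2).

Definition qspan (x : F) := exists a b : F, [/\ M a, M b & x = a + b * theta :> F].

Hypothesis span_base : forall c, qspan (iota' c).
Hypothesis span_gen : forall x, x \in t -> qspan x.

Lemma qspanB y z : qspan y -> qspan z -> qspan (y - z).
Proof.
move=> [a [b [Ma Mb ->]]] [c [d [Mc Md ->]]].
by exists (a - c), (b - d); split; in_adj; ring.
Qed.

Lemma qspan_div y z : qspan y -> qspan z -> qspan (y / z).
Proof.
move=> [a [b [Ma Mb def_y]]] [c [d [Mc Md def_z]]].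
have [->|nz_z] := eqVneq z 0.
  by exists 0, 0; rewrite invr0 mulr0 mul0r addr0; split=> //; apply: adjoin0.
(* The conjugate c - d theta is phi z, hence nonzero, and its product with z lies in M. *)
have nz_z' : c - d * theta != 0.
  have -> : c - d * theta = phi z.
    by rewrite def_z rmorphD rmorphM (phi_fix Mc) (phi_fix Md) phi_theta mulrN.
  by rewrite fmorph_eq0.
have nz_N : c ^+ 2 - d ^+ 2 * theta ^+ 2 != 0.
  have -> : c ^+ 2 - d ^+ 2 * theta ^+ 2 = z * (c - d * theta) by rewrite def_z; ring.
  exact: mulf_neq0.
exists ((a * c - b * d * theta ^+ 2) / (c ^+ 2 - d ^+ 2 * theta ^+ 2)),
  ((b * c - a * d) / (c ^+ 2 - d ^+ 2 * theta ^+ 2)).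
split; in_adj; rewrite def_z in nz_z; rewrite def_y def_z.
by field; rewrite exprMn nz_N nz_z.
Qed.

Lemma qspan_adjoin x : adjoin iota' t x -> qspan x.
Proof.
elim=> [c|y /span_gen|y z _ sy _|y z _ sy _] //; [exact: qspanB|exact: qspan_div].
Qed.

(** For x = a + b theta with a, b in M, being fixed by phi means 2 b theta = 0. The two base fields
    differ in order to allow the descent from K to k. *)
Lemma quad_descent x : adjoin iota' t x -> phi x = x -> M x.
Proof.
case/qspan_adjoin=> a [b [Ma Mb ->]].
rewrite rmorphD rmorphM (phi_fix Ma) (phi_fix Mb) phi_theta => /addrI/eqP.
rewrite mulrN -subr_eq0 -opprD oppr_eq0 -mulr2n -mulr_natr !mulf_eq0.
by rewrite (negPf nz_theta) (negPf nz2) !orbF => /eqP->; rewrite mul0r addr0.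
Qed.

End QuadraticDescent.

Section CubicDescent.
Variables (k F : fieldType) (iota : {rmorphism k -> F}).
Variables (s t : seq F) (phi : {rmorphism F -> F}) (w1 w2 w3 p q r : F).
Local Notation M := (adjoin iota s).
Hypothesis phi_fix : forall x, M x -> phi x = x.
Hypotheses (phi1 : phi w1 = w2) (phi2 : phi w2 = w3) (phi3 : phi w3 = w1).
Hypotheses (ne12 : w1 != w2) (ne13 : w1 != w3) (ne23 : w2 != w3).
Hypotheses (Mp : M p) (Mq : M q) (Mr : M r).
Hypothesis def_w : w1 ^+ 3 = p * w1 ^+ 2 + q * w1 + r.

Definition cspan (x : F) := exists a b c : F,
  [/\ M a, M b, M c & x = a + b * w1 + c * w1 ^+ 2 :> F].

Lemma phi_quad a b c x : M a -> M b -> M c ->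
  phi (a + b * x + c * x ^+ 2) = a + b * phi x + c * phi x ^+ 2.
Proof.
move=> Ma Mb Mc; rewrite 2!rmorphD [phi (b * x)]rmorphM [phi (c * _)]rmorphM rmorphXn.
by rewrite (phi_fix Ma) (phi_fix Mb) (phi_fix Mc).
Qed.

Lemma cspan_M x : M x -> cspan x.
Proof. by move=> Mx; exists x, 0, 0; split; in_adj; ring. Qed.

Lemma cspan_w1 : cspan w1.
Proof. by exists 0, 1, 0; split; in_adj; ring. Qed.

Lemma cspanD x y : cspan x -> cspan y -> cspan (x + y).
Proof.
move=> [a [b [c [Ma Mb Mc ->]]]] [a' [b' [c' [Ma' Mb' Mc' ->]]]].
by exists (a + a'), (b + b'), (c + c'); split; in_adj; ring.
Qed.

Lemma cspanM x y : cspan x -> cspan y -> cspan (x * y).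
Proof.
move=> [a [b [c [Ma Mb Mc ->]]]] [a' [b' [c' [Ma' Mb' Mc' ->]]]].
exists (a * a' + (b * c' + c * b') * r + c * c' * p * r),
  (a * b' + b * a' + (b * c' + c * b') * q + c * c' * (p * q + r)),
  (a * c' + b * b' + c * a' + (b * c' + c * b') * p + c * c' * (p ^+ 2 + q)).
split; in_adj.
have -> : (a + b * w1 + c * w1 ^+ 2) * (a' + b' * w1 + c' * w1 ^+ 2) =
  a * a' + (a * b' + b * a') * w1 + (a * c' + b * b' + c * a') * w1 ^+ 2
  + (b * c' + c * b') * w1 ^+ 3 + c * c' * (w1 * w1 ^+ 3) by ring.
have -> : w1 * w1 ^+ 3 = (p ^+ 2 + q) * w1 ^+ 2 + (p * q + r) * w1 + p * r.
  rewrite def_w; transitivity (p * w1 ^+ 3 + q * w1 ^+ 2 + r * w1); first by ring.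
  by rewrite def_w; ring.
by rewrite def_w; ring.
Qed.

Lemma cspanB x y : cspan x -> cspan y -> cspan (x - y).
Proof.
move=> sx sy; rewrite -mulN1r; apply/cspanD/cspanM => //.
by apply: cspan_M; in_adj.
Qed.

Hypotheses (span2 : cspan w2) (span_gen : forall x, x \in t -> cspan x).

Lemma cspan_phi x : cspan x -> cspan (phi x).
Proof.
move=> [a [b [c [Ma Mb Mc ->]]]]; rewrite phi_quad // phi1.
apply: cspanD; last by rewrite expr2; apply: cspanM; [apply: cspan_M|apply: cspanM].
by apply: cspanD; [apply: cspan_M | apply: cspanM => //; apply: cspan_M].
Qed.

Lemma cspan_phi3 x : cspan x -> phi (phi (phi x)) = x.
Proof.
move=> [a [b [c [Ma Mb Mc ->]]]].
by rewrite !phi_quad // phi1 phi2 phi3.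
Qed.

(** The polynomial a + b T + c T^2 takes the value x at the three distinct conjugates w1, w2, w3, so
    its divided differences vanish and b = c = 0. *)
Lemma cspan_fixed x : cspan x -> phi x = x -> M x.
Proof.
move=> [a [b [c [Ma Mb Mc def_x]]]] fix1; have fix2 := congr1 phi fix1.
have e2 : x = a + b * w2 + c * w2 ^+ 2.
  by rewrite -{1}fix1 def_x phi_quad // phi1.
have e3 : x = a + b * w3 + c * w3 ^+ 2.
  by rewrite -{1}fix1 e2 phi_quad // phi2.
have e12 : b + c * (w1 + w2) = 0.
  apply: (mulIf (x := w1 - w2)); first by rewrite subr_eq0.
  transitivity ((a + b * w1 + c * w1 ^+ 2) - (a + b * w2 + c * w2 ^+ 2)); first by ring.
  by rewrite -def_x -e2 subrr mul0r.
have e13 : b + c * (w1 + w3) = 0.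
  apply: (mulIf (x := w1 - w3)); first by rewrite subr_eq0.
  transitivity ((a + b * w1 + c * w1 ^+ 2) - (a + b * w3 + c * w3 ^+ 2)); first by ring.
  by rewrite -def_x -e3 subrr mul0r.
have c0 : c = 0.
  apply: (mulIf (x := w2 - w3)); first by rewrite subr_eq0.
  transitivity ((b + c * (w1 + w2)) - (b + c * (w1 + w3))); first by ring.
  by rewrite e12 e13 subrr mul0r.
by move: e12; rewrite def_x c0 !mul0r addr0 => ->; rewrite mul0r !addr0.
Qed.

(** The inverse is the product of the two other conjugates divided by the norm. The norm is fixed by
    phi and so lies in M. *)
Lemma cspanV x : cspan x -> cspan x^-1.
Proof.
move=> sx; have [->|nz_x] := eqVneq x 0.
  by rewrite invr0; apply: cspan_M; apply: adjoin0.
have sx1 := cspan_phi sx; have sx2 := cspan_phi sx1.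
have MN : M (x * phi x * phi (phi x)).
  apply: cspan_fixed; first by do 2?apply: cspanM.
  by rewrite !rmorphM cspan_phi3 //; ring.
have -> : x^-1 = phi x * phi (phi x) / (x * phi x * phi (phi x)).
  by field; rewrite nz_x !fmorph_eq0 nz_x.
by apply: cspanM; [apply: cspanM | apply/cspan_M/adjoinV].
Qed.

Lemma cubic_descent x : adjoin iota t x -> phi x = x -> M x.
Proof.
move=> tx; apply: cspan_fixed; elim: tx => {x} [c|y /span_gen|y z _ sy _ sz|y z _ sy _ sz] //.
- by apply: cspan_M; apply: adjoin_base.
- exact: cspanB.
- exact/cspanM/cspanV.
Qed.

End CubicDescent.

(** * Invariants of the Klein four-group *)

(** Numerator and denominator are multiplied by the same character of the Klein four-group of double
    transpositions of a, b, c, d. *)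
Definition yf (F : fieldType) (a b c d : F) : F := (a + b - c - d) / (a * b - c * d).

Section Yf.
Variable F : fieldType.
Implicit Types a b c d : F.

Lemma yfC a b c d : yf b a c d = yf a b c d.
Proof. by rewrite /yf (addrC b) (mulrC b). Qed.

Lemma yfCr a b c d : yf a b d c = yf a b c d.
Proof. by rewrite /yf (mulrC d) addrAC. Qed.

Lemma yf_swap a b c d : yf c d a b = yf a b c d.
Proof.
rewrite /yf -[c + d - a - b]opprK -[c * d - a * b]opprK invrN mulrNN.
by congr (_ / _); ring.
Qed.

Lemma rmorph_yf (phi : {rmorphism F -> F}) a b c d :
  phi (yf a b c d) = yf (phi a) (phi b) (phi c) (phi d).
Proof. by rewrite fmorph_div !(rmorphB, rmorphD) !rmorphM. Qed.

Lemma yfV a b c d : a * b * c * d = 1 ->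
  a * b - c * d != 0 -> a * c - b * d != 0 -> a * d - b * c != 0 ->
  a + c - b - d != 0 -> a + d - b - c != 0 ->
  yf a^-1 b^-1 c^-1 d^-1 =
    (yf a c b d + yf a d b c - yf a b c d) / (yf a c b d * yf a d b c).
Proof.
move=> abcd1 nzD1 nzD2 nzD3 nzA2 nzA3.
have : a * b * c * d != 0 by rewrite abcd1 oner_eq0.
rewrite !mulf_eq0 !negb_or -!andbA => /and4P[nza nzb nzc nzd].
(* Each inverse is the product of the three other variables; what remains afterwards is an identity
   of rational functions in a, b, c, d. *)
have -> : yf a^-1 b^-1 c^-1 d^-1 = (a * b * (c + d) - c * d * (a + b)) / (a * b - c * d).
  have -> : a^-1 = b * c * d by apply: (mulfI nza); rewrite mulfV // -abcd1; ring.
  have -> : b^-1 = a * c * d by apply: (mulfI nzb); rewrite mulfV // -abcd1; ring.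
  have -> : c^-1 = a * b * d by apply: (mulfI nzc); rewrite mulfV // -abcd1; ring.
  have -> : d^-1 = a * b * c by apply: (mulfI nzd); rewrite mulfV // -abcd1; ring.
  rewrite /yf -[RHS](_ : - (a * b * (c + d) - c * d * (a + b)) / - (a * b - c * d) = _); last by rewrite invrN mulrNN.
  congr (_ / _); first by ring.
  transitivity ((a * b * c * d) * (c * d - a * b)); first by ring.
  by rewrite abcd1; ring.
rewrite /yf; field.
by rewrite nzD1 nzD2 nzD3 nzA2 nzA3.
Qed.

End Yf.

Section KleinDescent.
Variables (K F : fieldType) (iota : {rmorphism K -> F}).
Variables x1 x2 x3 x4 : F.
Hypothesis nz2 : 2 != 0 :> K.
Hypothesis x1234 : x1 * x2 * x3 * x4 = 1.
Hypothesis free : alg_indep iota [tuple x1; x2; x3].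
Hypothesis gen : forall f, adjoin iota [:: x1; x2; x3] f.

Let A1 := x1 + x2 - x3 - x4.
Let A2 := x1 + x3 - x2 - x4.
Let A3 := x1 + x4 - x2 - x3.
Let D1 := x1 * x2 - x3 * x4.
Let D2 := x1 * x3 - x2 * x4.
Let D3 := x1 * x4 - x2 * x3.
Let S := x1 + x2 + x3 + x4.
Let y1 := yf x1 x2 x3 x4.
Let y2 := yf x1 x3 x2 x4.
Let y3 := yf x1 x4 x2 x3.

Lemma nz2F : 2 != 0 :> F.
Proof. by rewrite -(rmorph_nat iota) fmorph_eq0. Qed.

(** The nonvanishing test needs polynomials in the independent x1, x2, x3; multiplying by a monomial
    p eliminates x4 through [x1234]. *)
Let nz_of (t p q : F) : t * p = q -> q != 0 -> t != 0.
Proof. by move=> def_q; apply: contraNneq => t0; rewrite -def_q t0 mul0r. Qed.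

Lemma A1_neq0 : A1 != 0.
Proof.
apply: (@nz_of _ (x1 * x2 * x3) ((x1 + x2 - x3) * (x1 * x2 * x3) - 1)).
  by rewrite -x1234 /A1; ring.
by neq0_by nz2 free x1 x2 x3 1%N 10%N 50%N.
Qed.

Lemma A2_neq0 : A2 != 0.
Proof.
apply: (@nz_of _ (x1 * x2 * x3) ((x1 + x3 - x2) * (x1 * x2 * x3) - 1)).
  by rewrite -x1234 /A2; ring.
by neq0_by nz2 free x1 x2 x3 1%N 10%N 50%N.
Qed.

Lemma A3_neq0 : A3 != 0.
Proof.
apply: (@nz_of _ (x1 * x2 * x3) ((x1 - x2 - x3) * (x1 * x2 * x3) + 1)).
  by rewrite -x1234 /A3; ring.
by neq0_by nz2 free x1 x2 x3 1%N 10%N 50%N.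
Qed.

Lemma D1_neq0 : D1 != 0.
Proof.
apply: (@nz_of _ (x1 * x2) ((x1 * x2) ^+ 2 - 1)); first by rewrite -x1234 /D1; ring.
by neq0_by nz2 free x1 x2 x3 1%N 10%N 50%N.
Qed.

Lemma D2_neq0 : D2 != 0.
Proof.
apply: (@nz_of _ (x1 * x3) ((x1 * x3) ^+ 2 - 1)); first by rewrite -x1234 /D2; ring.
by neq0_by nz2 free x1 x2 x3 1%N 10%N 50%N.
Qed.

Lemma D3_neq0 : D3 != 0.
Proof.
apply: (@nz_of _ (x2 * x3) (1 - (x2 * x3) ^+ 2)); first by rewrite -x1234 /D3; ring.
by neq0_by nz2 free x1 x2 x3 1%N 10%N 50%N.
Qed.

Let nzA1 := A1_neq0.
Let nzA2 := A2_neq0.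
Let nzA3 := A3_neq0.
Let nzD1 := D1_neq0.
Let nzD2 := D2_neq0.
Let nzD3 := D3_neq0.

Let nzy1 : y1 != 0. Proof. by rewrite mulf_neq0 ?invr_eq0. Qed.
Let nzy2 : y2 != 0. Proof. by rewrite mulf_neq0 ?invr_eq0. Qed.
Let nzy3 : y3 != 0. Proof. by rewrite mulf_neq0 ?invr_eq0. Qed.

Let nz4 : 4 != 0 :> F.
Proof. by rewrite (natrM _ 2 2) mulf_neq0 ?nz2F. Qed.

(** One has A2 A3 = S A1 - 4 D1 and D1 = A1 / y1. Since S, A1, A2, A3 are eigenvectors of the Klein
    group, such relations put the squares of the A_i into K(S, y1, y2, y3). *)
Let A23 : A2 * A3 = (S - 4 / y1) * A1.
Proof.
have -> : 4 / y1 = 4 * D1 / A1 by rewrite /y1 /yf -/A1 -/D1 invf_div mulrA.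
by rewrite [RHS]mulrBl divfK // /A1 /A2 /A3 /D1 /S; ring.
Qed.

Let A13 : A1 * A3 = (S - 4 / y2) * A2.
Proof.
have -> : 4 / y2 = 4 * D2 / A2 by rewrite /y2 /yf -/A2 -/D2 invf_div mulrA.
by rewrite [RHS]mulrBl divfK // /A1 /A2 /A3 /D2 /S; ring.
Qed.

Let A12 : A1 * A2 = (S - 4 / y3) * A3.
Proof.
have -> : 4 / y3 = 4 * D3 / A3 by rewrite /y3 /yf -/A3 -/D3 invf_div mulrA.
by rewrite [RHS]mulrBl divfK // /A1 /A2 /A3 /D3 /S; ring.
Qed.

Let A11 : A1 ^+ 2 = (S - 4 / y2) * (S - 4 / y3).
Proof.
apply: (mulIf (mulf_neq0 nzA2 nzA3)).
transitivity ((A1 * A3) * (A1 * A2)); first by ring.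
by rewrite A13 A12; ring.
Qed.

Let A22 : A2 ^+ 2 = (S - 4 / y1) * (S - 4 / y3).
Proof.
apply: (mulIf (mulf_neq0 nzA1 nzA3)).
transitivity ((A2 * A3) * (A1 * A2)); first by ring.
by rewrite A23 A12; ring.
Qed.

Let A33 : A3 ^+ 2 = (S - 4 / y1) * (S - 4 / y2).
Proof.
apply: (mulIf (mulf_neq0 nzA1 nzA2)).
transitivity ((A2 * A3) * (A1 * A3)); first by ring.
by rewrite A23 A13; ring.
Qed.

(* Expanding 256 x1 x2 x3 x4 = 256 in terms of S, A1, A2, A3 gives an equation
   that is linear in S over k(y1, y2, y3). *)
Let def_S : S = y1 * y2 * y3 + (4 * y2 * y3 - (y1 - y2 - y3) ^+ 2) / (y1 * y2 * y3).
Proof.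
have nz256 : 256 != 0 :> F by rewrite (natrX _ 2 8) expf_neq0 ?nz2F.
(* The first square is that of 8 (x1 x2 + x3 x4), and (4 / y1) A1 is 4 (x1 x2 - x3 x4), so the
   difference is 256 x1 x2 x3 x4. *)
have e256 : 256 = (S ^+ 2 + A1 ^+ 2 - A2 ^+ 2 - A3 ^+ 2) ^+ 2 - 4 * ((4 / y1) * A1) ^+ 2.
  have -> : 4 / y1 * A1 = S * A1 - A2 * A3 by rewrite A23; ring.
  transitivity (256 * (x1 * x2 * x3 * x4)); first by rewrite x1234 mulr1.
  by rewrite /S /A1 /A2 /A3; ring.
rewrite exprMn A11 A22 A33 in e256.
have eS : 4 * (4 / y1) * (4 / y2) * (4 / y3) * S =
    256 - ((4 / y2) * (4 / y3) - (4 / y1) * (4 / y3) - (4 / y1) * (4 / y2)) ^+ 2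
    + 4 * (4 / y1) ^+ 2 * (4 / y2) * (4 / y3) by rewrite e256; ring.
have -> : S = 4 * (4 / y1) * (4 / y2) * (4 / y3) * S * (y1 * y2 * y3) / 256.
  by field; rewrite nz256 nzy1 nzy2 nzy3.
rewrite eS.
by field; rewrite nz256 nzy1 nzy2 nzy3.
Qed.

Let s3 := [:: y1; y2; y3].

Let S_in t : (forall y, y \in s3 -> adjoin iota t y) -> adjoin iota t S.
Proof.
move=> ty; have ty1 : adjoin iota t y1 by apply: ty; rewrite !inE eqxx ?orbT.
have ty2 : adjoin iota t y2 by apply: ty; rewrite !inE eqxx ?orbT.
have ty3 : adjoin iota t y3 by apply: ty; rewrite !inE eqxx ?orbT.
by rewrite def_S; in_adj.
Qed.

Let nzS3 : S - 4 / y3 != 0.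
Proof. by have := mulf_neq0 nzA1 nzA2; rewrite A12 mulf_eq0 => /norP[]. Qed.

Let def_A3 : A3 = A1 / (S - 4 / y3) * A2.
Proof. by apply: (mulfI nzS3); rewrite -A12 [A1 / _]mulrC !mulrA mulfV // mul1r. Qed.

Let x_in_A t : adjoin iota t S -> adjoin iota t A1 -> adjoin iota t A2 ->
  adjoin iota t A3 -> forall f, adjoin iota t f.
Proof.
move=> tS tA1 tA2 tA3 f; apply: (adjoin_trans _ (gen f)) => x.
rewrite !inE => /or3P[]/eqP->.
- have -> : x1 = (S + A1 + A2 + A3) / 4.
    by apply: (mulIf nz4); rewrite divfK // /S /A1 /A2 /A3; ring.
  by in_adj.
- have -> : x2 = (S + A1 - A2 - A3) / 4.
    by apply: (mulIf nz4); rewrite divfK // /S /A1 /A2 /A3; ring.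
  by in_adj.
- have -> : x3 = (S - A1 + A2 - A3) / 4.
    by apply: (mulIf nz4); rewrite divfK // /S /A1 /A2 /A3; ring.
  by in_adj.
Qed.

Lemma y_alg f : alg iota s3 f.
Proof.
have sS : alg iota s3 S by apply/alg_adjoin/S_in => y; apply: adjoin_gen.
have sy y : y \in s3 -> alg iota s3 (4 / y).
  by move=> /alg_mem-/(_ _ iota); apply: alg_div; apply: alg_nat.
have sA1 : alg iota s3 A1.
  by apply: alg_sqrt; rewrite A11; apply: algM; apply: algB => //; apply: sy; rewrite !inE eqxx ?orbT.
have sA2 : alg iota s3 A2.
  by apply: alg_sqrt; rewrite A22; apply: algM; apply: algB => //; apply: sy; rewrite !inE eqxx ?orbT.
have sA3 : alg iota s3 A3.
  by apply: alg_sqrt; rewrite A33; apply: algM; apply: algB => //; apply: sy; rewrite !inE eqxx ?orbT.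
apply: (@alg_trans _ _ _ [:: S; A1; A2; A3]) => [x|].
  by rewrite !inE => /or4P[]/eqP->.
by apply/alg_adjoin/x_in_A; in_adj.
Qed.

Lemma y_free : alg_indep iota [tuple y1; y2; y3].
Proof. by apply: alg_indep_span free _ => x _; apply: y_alg. Qed.

Section Action.
Variables tau lam : {rmorphism F -> F}.
Hypotheses (tauK : forall c, tau (iota c) = iota c) (lamK : forall c, lam (iota c) = iota c).
Hypotheses (tau1 : tau x1 = x2) (tau2 : tau x2 = x1) (tau3 : tau x3 = x4) (tau4 : tau x4 = x3).
Hypotheses (lam1 : lam x1 = x3) (lam2 : lam x2 = x4) (lam3 : lam x3 = x1) (lam4 : lam x4 = x2).

Lemma tau_y : [/\ tau y1 = y1, tau y2 = y2 & tau y3 = y3].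
Proof.
rewrite /y1 /y2 /y3 !rmorph_yf tau1 tau2 tau3 tau4; split.
- by rewrite yfC yfCr.
- by rewrite yf_swap.
- by rewrite yf_swap yfC yfCr.
Qed.

Lemma lam_y : [/\ lam y1 = y1, lam y2 = y2 & lam y3 = y3].
Proof.
rewrite /y1 /y2 /y3 !rmorph_yf lam1 lam2 lam3 lam4; split.
- by rewrite yf_swap.
- by rewrite yfC yfCr.
- by rewrite yf_swap yfC yfCr.
Qed.

(** Two quadratic steps: tau negates A2 over K(y1, y2, y3, A1), then lam negates A1 over K(y1, y2,
    y3). By [def_A3], A3 adds nothing to the first step. *)
Lemma klein_descent f : tau f = f -> lam f = f -> adjoin iota s3 f.
Proof.
have [ty1 ty2 ty3] := tau_y; have [ly1 ly2 ly3] := lam_y.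
pose s4 := [:: y1; y2; y3; A1].
have s4y y : y \in s3 -> adjoin iota s4 y.
  by rewrite !inE => /or3P[]/eqP->; in_adj.
have s4S : adjoin iota s4 S := S_in s4y.
have s3S : adjoin iota s3 S by apply: S_in => y; apply: adjoin_gen.
have tA1 : tau A1 = A1 by rewrite /A1 !(rmorphB, rmorphD) tau1 tau2 tau3 tau4; ring.
have tA2 : tau A2 = - A2 by rewrite /A2 !(rmorphB, rmorphD) tau1 tau2 tau3 tau4; ring.
have lA1 : lam A1 = - A1 by rewrite /A1 !(rmorphB, rmorphD) lam1 lam2 lam3 lam4; ring.
have tau_fix x : adjoin iota s4 x -> tau x = x.
  by apply: adjoin_fixed => // y; rewrite !inE => /or4P[]/eqP->.
have lam_fix x : adjoin iota s3 x -> lam x = x.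
  by apply: adjoin_fixed => // y; rewrite !inE => /or3P[]/eqP->.
move=> tf lf; have s4f : adjoin iota s4 f.
  have sA2 : adjoin iota s4 (A2 ^+ 2) by rewrite A22; in_adj.
  apply: (@quad_descent _ _ _ iota iota s4 [:: S; A1; A2; A3] tau A2) => //.
  - exact: nz2F.
  - by move=> c; exists (iota c), 0; split; in_adj; rewrite ?mul0r ?addr0 //; apply: adjoin_base.
  - move=> x; rewrite !inE => /or4P[]/eqP->.
    + by exists S, 0; split; in_adj; rewrite mul0r addr0.
    + by exists A1, 0; split; in_adj; rewrite mul0r addr0.
    + by exists 0, 1; split; in_adj; rewrite mul1r add0r.
    + by exists 0, (A1 / (S - 4 / y3)); split; in_adj; rewrite add0r.
  by apply: x_in_A; in_adj.
apply: (@quad_descent _ _ _ iota iota s3 s4 lam A1) => //.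
- exact: nz2F.
- by rewrite A11; in_adj.
- by move=> c; exists (iota c), 0; split; in_adj; rewrite ?mul0r ?addr0 //; apply: adjoin_base.
- move=> x; rewrite !inE => /or4P[]/eqP->.
  + by exists y1, 0; split; in_adj; rewrite mul0r addr0.
  + by exists y2, 0; split; in_adj; rewrite mul0r addr0.
  + by exists y3, 0; split; in_adj; rewrite mul0r addr0.
  + by exists 0, 1; split; in_adj; rewrite mul1r add0r.
Qed.

End Action.
End KleinDescent.

(** * Invariants of the cyclic group of order 3 *)

Section CyclicFunctions.
Variable F : fieldType.
Implicit Types a b c : F.

(** Masuda's invariant of the cyclic group of order 3; exchanging two arguments gives the other one,
    v. *)
Definition uf a b c : F :=
  (a * b ^+ 2 + b * c ^+ 2 + c * a ^+ 2 - 3 * (a * b * c))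
  / ((a + b + c) ^+ 2 - 3 * (a * b + b * c + c * a)).

(** This symmetric function is e3 n0 / n2, in the notation of [CyclicDescent]. Inversion of the
    arguments exchanges it, up to a common factor, with u^2 - u v + v^2 = n2 / n0. *)
Definition gf a b c : F :=
  a * b * c * ((a + b + c) ^+ 2 - 3 * (a * b + b * c + c * a))
  / ((a * b + b * c + c * a) ^+ 2 - 3 * (a + b + c) * (a * b * c)).

Lemma uf_cycle a b c : uf b c a = uf a b c.
Proof. by rewrite /uf; congr (_ / _); ring. Qed.

Lemma gf_cycle a b c : gf b c a = gf a b c.
Proof. by rewrite /gf; congr (_ / _); ring. Qed.

Lemma gf_swap a b c : gf a c b = gf a b c.
Proof. by rewrite /gf; congr (_ / _); ring. Qed.

Lemma rmorph_uf (phi : {rmorphism F -> F}) a b c : phi (uf a b c) = uf (phi a) (phi b) (phi c).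
Proof. by rewrite fmorph_div; congr (_ / _); ring. Qed.

Lemma rmorph_gf (phi : {rmorphism F -> F}) a b c : phi (gf a b c) = gf (phi a) (phi b) (phi c).
Proof. by rewrite fmorph_div; congr (_ / _); ring. Qed.

Section Inversion.
Variables a b c P : F.
Hypothesis nz2 : 2 != 0 :> F.
Hypothesis nzabc : a * b * c != 0.
Hypothesis nzn0 : (a + b + c) ^+ 2 - 3 * (a * b + b * c + c * a) != 0.
Hypothesis nzn2 : (a * b + b * c + c * a) ^+ 2 - 3 * (a + b + c) * (a * b * c) != 0.
Hypothesis nzP : P != 0.

Let nz4 : 4 != 0 :> F.
Proof. by rewrite (natrM _ 2 2) mulf_neq0. Qed.

(** Replacing a, b, c by b c, c a, a b turns e1^2 - 3 e2 into e2^2 - 3 e1 e3, and the cyclic sum a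
    b^2 + b c^2 + c a^2 into e3 times the opposite one. The factor 2 / P comes out by
    homogeneity. *)
Lemma uf_inv : uf (2 * b * c / P) (2 * c * a / P) (2 * a * b / P) = 2 * gf a b c * uf a c b / P.
Proof.
have aux (e m n0 n2 : F) : n0 != 0 -> n2 != 0 ->
    8 / P ^+ 3 * e * m / (4 / P ^+ 2 * n2) = 2 * (e * n0 / n2) * (m / n0) / P.
  by move=> nz0 nz2'; field; rewrite nz4 nzP nz0 nz2'.
rewrite /uf /gf.
have -> : (a + c + b) ^+ 2 - 3 * (a * c + c * b + b * a) =
          (a + b + c) ^+ 2 - 3 * (a * b + b * c + c * a) by ring.
rewrite -aux //; congr (_ / _); by field.
Qed.

Lemma gf_inv : gf (2 * b * c / P) (2 * c * a / P) (2 * a * b / P) =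
  2 * (uf a b c ^+ 2 - uf a b c * uf a c b + uf a c b ^+ 2) / P.
Proof.
have aux (e n0 n2 : F) : e != 0 -> n0 != 0 -> n2 != 0 ->
    8 / P ^+ 3 * e ^+ 2 * (4 / P ^+ 2 * n2) / (16 / P ^+ 4 * e ^+ 2 * n0) = 2 * (n2 / n0) / P.
  have nz16 : 16 != 0 :> F by rewrite (natrM _ 4 4) mulf_neq0.
  by move=> nze nz0 nz2'; field; rewrite nz16 nzP nz0 nze.
have -> : uf a b c ^+ 2 - uf a b c * uf a c b + uf a c b ^+ 2 =
   ((a * b + b * c + c * a) ^+ 2 - 3 * (a + b + c) * (a * b * c)) /
   ((a + b + c) ^+ 2 - 3 * (a * b + b * c + c * a)).
  have aux2 (p q n0 n2 : F) : n0 != 0 -> p ^+ 2 - p * q + q ^+ 2 = n0 * n2 ->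
      (p / n0) ^+ 2 - (p / n0) * (q / n0) + (q / n0) ^+ 2 = n2 / n0.
    move=> nz0 pq; transitivity ((p ^+ 2 - p * q + q ^+ 2) / n0 ^+ 2); first by field.
    by rewrite pq; field.
  rewrite /uf.
  have -> : (a + c + b) ^+ 2 - 3 * (a * c + c * b + b * a) =
            (a + b + c) ^+ 2 - 3 * (a * b + b * c + c * a) by ring.
  by apply: aux2 => //; ring.
rewrite -(aux (a * b * c)) // /gf; congr (_ / _); by field.
Qed.

End Inversion.
End CyclicFunctions.

Section CyclicDescent.
Variables (K F : fieldType) (iota : {rmorphism K -> F}).
Variables a1 a2 a3 : F.
Hypothesis nz2 : 2 != 0 :> K.
Hypothesis free : alg_indep iota [tuple a1; a2; a3].

Let nz2F : 2 != 0 :> F.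
Proof. by rewrite -(rmorph_nat iota) fmorph_eq0. Qed.

Let e1 := a1 + a2 + a3.
Let e2 := a1 * a2 + a2 * a3 + a3 * a1.
Let e3 := a1 * a2 * a3.
Let m1 := a1 * a2 ^+ 2 + a2 * a3 ^+ 2 + a3 * a1 ^+ 2.
Let m2 := a1 * a3 ^+ 2 + a3 * a2 ^+ 2 + a2 * a1 ^+ 2.
Let n0 := e1 ^+ 2 - 3 * e2.
Let n2 := e2 ^+ 2 - 3 * e1 * e3.
Let u := uf a1 a2 a3.
Let v := uf a1 a3 a2.
Let g := gf a1 a2 a3.
Let s3 := [:: u; v; g].

Lemma n0_neq0 : n0 != 0.
Proof. by rewrite /n0 /e1 /e2; neq0_by nz2 free a1 a2 a3 1%N 10%N 50%N. Qed.

Lemma n2_neq0 : n2 != 0.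
Proof. by rewrite /n2 /e1 /e2 /e3; neq0_by nz2 free a1 a2 a3 1%N 10%N 50%N. Qed.

Let nzn0 := n0_neq0.
Let nzn2 := n2_neq0.

Let nzp : m1 - 3 * e3 != 0.
Proof. by rewrite /m1 /e3; neq0_by nz2 free a1 a2 a3 1%N 10%N 50%N. Qed.

Let nzq : m2 - 3 * e3 != 0.
Proof. by rewrite /m2 /e3; neq0_by nz2 free a1 a2 a3 1%N 10%N 50%N. Qed.

Let uE : u = (m1 - 3 * e3) / n0. Proof. by []. Qed.

Let vE : v = (m2 - 3 * e3) / n0.
Proof. by rewrite /v /uf /m2 /n0 /e3 /e1 /e2; congr (_ / _); ring. Qed.

Let gE : g = e3 * n0 / n2. Proof. by []. Qed.

Lemma uvg_Q : u ^+ 2 - u * v + v ^+ 2 = n2 / n0.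
Proof.
have -> : u ^+ 2 - u * v + v ^+ 2 = ((m1 - 3 * e3) ^+ 2 - (m1 - 3 * e3) * (m2 - 3 * e3) + (m2 - 3 * e3) ^+ 2) / n0 ^+ 2.
  by rewrite uE vE; move: (m1 - _) (m2 - _) n0 nzn0 => p q n nzn; field.
have -> : (m1 - 3 * e3) ^+ 2 - (m1 - 3 * e3) * (m2 - 3 * e3) + (m2 - 3 * e3) ^+ 2 = n0 * n2.
  by rewrite /m1 /m2 /n0 /n2 /e1 /e2 /e3; ring.
by move: n0 n2 nzn0 => p q nzn; field.
Qed.

Lemma uvg_e3 : e3 = g * (u ^+ 2 - u * v + v ^+ 2).
Proof.
by rewrite uvg_Q gE; move: e3 n0 n2 nzn0 nzn2 => p q r nzq' nzr; field; rewrite nzq' nzr.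
Qed.

Let nzu : u != 0. Proof. by rewrite uE mulf_neq0 ?invr_eq0. Qed.
Let nzv : v != 0. Proof. by rewrite vE mulf_neq0 ?invr_eq0. Qed.
Lemma uvg_e1 : e1 = (u ^+ 2 - u * v + v ^+ 2) * (g + u + v) / (u * v).
Proof.
rewrite uvg_Q; apply: (mulIf (mulf_neq0 nzu nzv)).
rewrite (divfK (mulf_neq0 nzu nzv)).
(* Divided by n0^2 this polynomial identity reads e1 u v = (n2 / n0) (g + u + v). *)
have e_pq : e1 * (m1 - 3 * e3) * (m2 - 3 * e3) = n0 * e3 * n0 + n2 * (m1 - 3 * e3 + (m2 - 3 * e3)).
  by rewrite /m1 /m2 /n0 /n2 /e1 /e2 /e3; ring.
have -> : e1 * (u * v) = e1 * (m1 - 3 * e3) * (m2 - 3 * e3) / n0 ^+ 2.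
  by rewrite uE vE; move: (m1 - _) (m2 - _) e1 n0 nzn0 => p q r n nzn; field.
rewrite e_pq uE vE gE.
move: (m1 - _) (m2 - _) => p q; move: e3 n0 n2 nzn0 nzn2 => r n n' nzn nzn'.
by field; rewrite nzn nzn'.
Qed.

Lemma uvg_e2 : e2 = e1 * (u + v) - 3 * (u ^+ 2 - u * v + v ^+ 2).
Proof.
rewrite uvg_Q uE vE; have en : e2 * n0 = e1 * (m1 - 3 * e3 + (m2 - 3 * e3)) - 3 * n2.
  by rewrite /m1 /m2 /n0 /n2 /e1 /e2 /e3; ring.
have -> : e2 = e2 * n0 / n0 by rewrite mulfK.
rewrite en.
by move: (m1 - _) (m2 - _) e1 n0 n2 nzn0 => p q r n n' nzn; field.
Qed.

Lemma e_in_uvg : [/\ adjoin iota s3 e1, adjoin iota s3 e2 & adjoin iota s3 e3].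
Proof.
have su : adjoin iota s3 u by in_adj.
have sv : adjoin iota s3 v by in_adj.
have sg : adjoin iota s3 g by in_adj.
have se1 : adjoin iota s3 e1 by rewrite uvg_e1; in_adj.
by split; rewrite // ?uvg_e2 ?uvg_e3; in_adj.
Qed.

(** The square root of the discriminant thus lies in K(u, v, g), so adjoining the single root a1 of
    the cubic already gives a2 and a3. *)
Lemma delta_uvg : (a1 - a2) * (a2 - a3) * (a3 - a1) = (u - v) * n0.
Proof.
transitivity (m1 - 3 * e3 - (m2 - 3 * e3)); first by rewrite /m1 /m2 /e3; ring.
by rewrite uE vE; move: (m1 - _) (m2 - _) n0 nzn0 => p q n nzn; field.
Qed.

Let cubic1 : a1 ^+ 3 = e1 * a1 ^+ 2 + - e2 * a1 + e3.
Proof. by rewrite /e1 /e2 /e3; ring. Qed.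

Lemma uvg_alg f : alg iota [:: a1; a2; a3] f -> alg iota s3 f.
Proof.
have [se1 se2 se3] := e_in_uvg.
have cub x : x ^+ 3 = e1 * x ^+ 2 + - e2 * x + e3 -> alg iota s3 x.
  by move=> ex; apply: (alg_cubic ex); apply: alg_adjoin => //; apply: adjoinN.
apply: alg_trans => x; rewrite !inE => /or3P[]/eqP->; apply: cub => //.
  by rewrite /e1 /e2 /e3; ring.
by rewrite /e1 /e2 /e3; ring.
Qed.

Lemma uvg_free : alg_indep iota [tuple u; v; g].
Proof. by apply: alg_indep_span free _ => x sx; apply/uvg_alg/alg_mem. Qed.

Lemma delta_neq0 : (a1 - a2) * (a2 - a3) * (a3 - a1) != 0.
Proof. by neq0_by nz2 free a1 a2 a3 1%N 10%N 50%N. Qed.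

Section Action.
Variable sigma : {rmorphism F -> F}.
Hypothesis sigmaK : forall c, sigma (iota c) = iota c.
Hypotheses (sigma1 : sigma a1 = a3) (sigma3 : sigma a3 = a2) (sigma2 : sigma a2 = a1).

Lemma sigma_uvg : [/\ sigma u = u, sigma v = v & sigma g = g].
Proof.
rewrite /u /v /g !rmorph_uf rmorph_gf sigma1 sigma2 sigma3; split.
- by rewrite -uf_cycle.
- by rewrite -uf_cycle -uf_cycle.
- by rewrite -gf_cycle.
Qed.

Lemma cyclic_descent f : adjoin iota [:: a1; a2; a3] f -> sigma f = f -> adjoin iota s3 f.
Proof.
have [su sv sg] := sigma_uvg; have [se1 se2 se3] := e_in_uvg.
set d := (a1 - a2) * (a2 - a3) * (a3 - a1).
have nzd : d != 0 := delta_neq0.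
have [nd1 nd2 nd3] : [/\ a1 - a2 != 0, a2 - a3 != 0 & a3 - a1 != 0].
  by move: nzd; rewrite /d !mulf_eq0 => /norP[/norP[]].
have sd : adjoin iota s3 d by rewrite /d delta_uvg /n0; in_adj.
have fixs x : adjoin iota s3 x -> sigma x = x.
  by apply: adjoin_fixed => // y; rewrite !inE => /or3P[]/eqP->.
pose sp := cspan iota s3 a1.
have spM x : adjoin iota s3 x -> sp x by apply: cspan_M.
have sp1 : sp a1 by apply: cspan_w1.
have spB x y : sp x -> sp y -> sp (x - y).
  exact: (cspanB se1 (adjoinN se2) se3 cubic1).
have spD x y : sp x -> sp y -> sp (x + y) by apply: cspanD.
have spMM x y : sp x -> sp y -> sp (x * y).
  exact: (cspanM se1 (adjoinN se2) se3 cubic1).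
(* The first factor is the derivative of the cubic at a1, that is (a1 - a2) (a1 - a3), and the
   second is the discriminant (a2 - a3)^2 of the cofactor. *)
have def_d : a2 - a3 = - (3 * a1 * a1 - 2 * e1 * a1 + e2) * ((e1 - a1) * (e1 - a1) - 4 * (e2 - a1 * e1 + a1 * a1)) * d^-1.
  by apply: (mulIf nzd); rewrite divfK // /d /e1 /e2; ring.
have sp_n n : sp n%:R by apply/spM/adjoin_nat.
have spN x : sp x -> sp (- x) by move=> sx; rewrite -sub0r; apply/spB/sx/(sp_n 0%N).
have sp23 : sp (a2 - a3).
  rewrite def_d; apply: (spMM); last by apply/spM/adjoinV.
  apply: (spMM); first apply: (spN).
    apply: (spD); last exact: spM.
    apply: (spB); first by apply: (spMM) => //; apply: (spMM).
    by apply: (spMM) => //; apply: (spM); in_adj.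
  apply: (spB); first by apply: (spMM); apply: (spB) => //; apply: (spM).
  apply: (spMM) => //; apply: (spD); last exact: spMM.
  by apply: (spB); [apply: (spM) | apply: (spMM) => //; apply: (spM)].
have sp3 : sp a3.
  have -> : a3 = (e1 - a1 - (a2 - a3)) * 2^-1.
    by apply: (mulIf nz2F); rewrite divfK // /e1; ring.
  by apply: (spMM); [apply: (spB) => //; apply: (spB) => //; apply: (spM) | apply/spM/adjoinV/adjoin_nat].
apply: (@cubic_descent _ _ _ _ _ sigma a1 a3 a2 e1 (- e2) e3) => //.
- by rewrite -subr_eq0 -opprB oppr_eq0.
- by rewrite -subr_eq0.
- by rewrite -subr_eq0 -opprB oppr_eq0.
- exact: adjoinN.
move=> x; rewrite !inE => /or3P[]/eqP-> //.
have -> : a2 = e1 - a1 - a3 by rewrite /e1; ring.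
by apply: (spB) => //; apply: (spB) => //; apply: (spM).
Qed.

End Action.
End CyclicDescent.

(** * The involutions on the invariants of H *)

Ltac neq0s nz2 free x y z d0 d1 d2 :=
  repeat (apply/andP; split); first [assumption | neq0_by nz2 free x y z d0 d1 d2].

Section Quadric.
Variables (K F : fieldType) (iota : {rmorphism K -> F}) (u v g : F).
Hypothesis nz2 : 2 != 0 :> K.
Hypothesis free : alg_indep iota [tuple u; v; g].

Definition qf : F := u ^+ 2 - u * v + v ^+ 2.

(** Defined so that qf rf / (u v)^2 is e1 e2 - e3, the product of the pairwise sums of a1, a2, a3,
    which is the denominator P of the involutions. *)
Definition rf : F := qf * (g + u + v) ^+ 2 * (u + v)
  - 3 * qf * (g + u + v) * (u * v) - g * (u * v) ^+ 2.

(** With p = (2 qf + g (u + v)) / (g (u - v)) and q = (2 g + u + v) / (u - v), in the notation of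
    [SexticModels], - ths = N1 / D1 and th = N2 / D2. Both have degree 0 in u, v, g, while psi has
    degree 1. *)
Definition th : F := (u + v - 2 * (u * v) / (g + u + v)) / (u - v).
Definition ths : F := - ((u + v - 2 * (u * v) * g / (qf + g * (u + v))) / (u - v)).
Definition psi : F := rf / (u * v * (g + u + v) * (u - v)).

Let nz2F : 2 != 0 :> F.
Proof. by rewrite -(rmorph_nat iota) fmorph_eq0. Qed.

Let s3 := [:: th; ths; psi].

(** For a = - ths and b = th this is the ratio occurring in [cr_p] and [cr_q]; accordingly [qE] and
    [pE] recover the ratios q and p from th and ths. *)
Let tt : F := (ths ^+ 2 + 2 * ths * th + 1) / (th ^+ 2 + 2 * ths * th + 1).

Let ttE : tt = (g + u + v) * g / (qf + g * (u + v)).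
Proof.
rewrite /tt /ths /th /qf; field.
neq0s nz2 free u v g 1%N 20%N 200%N.
Qed.

Let qE : - ths + 2 * th * tt = (2 * g + u + v) / (u - v).
Proof.
rewrite ttE /ths /th /qf; field.
neq0s nz2 free u v g 1%N 20%N 200%N.
Qed.

Let pE : th - 2 * ths / tt = (2 * qf + g * (u + v)) / (g * (u - v)).
Proof.
rewrite ttE /ths /th /qf; field.
neq0s nz2 free u v g 1%N 20%N 200%N.
Qed.

Lemma uvg_in_th : forall x, x \in [:: u; v; g] -> adjoin iota s3 x.
Proof.
have sth : adjoin iota s3 th by in_adj.
have sths : adjoin iota s3 ths by in_adj.
have spsi : adjoin iota s3 psi by in_adj.
have stt : adjoin iota s3 tt by rewrite /tt; in_adj.
have sq : adjoin iota s3 ((2 * g + u + v) / (u - v)) by rewrite -qE; in_adj.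
have sp : adjoin iota s3 ((2 * qf + g * (u + v)) / (g * (u - v))) by rewrite -pE; in_adj.
have ss : adjoin iota s3 ((u + v) / (u - v)).
  (* The right-hand side is (p q - 3) / (p + q). *)
  have -> : (u + v) / (u - v) =
    ((2 * qf + g * (u + v)) / (g * (u - v)) * ((2 * g + u + v) / (u - v)) - 3) /
    ((2 * qf + g * (u + v)) / (g * (u - v)) + (2 * g + u + v) / (u - v)).
    by rewrite /qf; field; neq0s nz2 free u v g 1%N 20%N 200%N.
  by in_adj.
have sg : adjoin iota s3 (g / (u - v)).
  have -> : g / (u - v) = ((2 * g + u + v) / (u - v) - (u + v) / (u - v)) / 2.
    by field; neq0s nz2 free u v g 1%N 20%N 200%N.
  by in_adj.
have su : adjoin iota s3 (u / (u - v)).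
  have -> : u / (u - v) = ((u + v) / (u - v) + 1) / 2.
    by field; neq0s nz2 free u v g 1%N 20%N 200%N.
  by in_adj.
have sv : adjoin iota s3 (v / (u - v)).
  have -> : v / (u - v) = ((u + v) / (u - v) - 1) / 2.
    by field; neq0s nz2 free u v g 1%N 20%N 200%N.
  by in_adj.
have nzd : u - v != 0 by neq0_by nz2 free u v g 1%N 20%N 200%N.
have nzr : rf != 0 by rewrite /rf /qf; neq0_by nz2 free u v g 1%N 20%N 200%N.
(* As rf is homogeneous of degree 5, this is a function of the ratios already found; psi, of degree
   1, then fixes the scale u - v. *)
have sr : adjoin iota s3 (rf / (u - v) ^+ 5).
  have -> : rf / (u - v) ^+ 5 =
    ((u / (u - v)) ^+ 2 - u / (u - v) * (v / (u - v)) + (v / (u - v)) ^+ 2)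
    * (g / (u - v) + (u + v) / (u - v)) ^+ 2 * ((u + v) / (u - v))
    - 3 * ((u / (u - v)) ^+ 2 - u / (u - v) * (v / (u - v)) + (v / (u - v)) ^+ 2)
    * (g / (u - v) + (u + v) / (u - v)) * (u / (u - v) * (v / (u - v)))
    - (g / (u - v)) * (u / (u - v) * (v / (u - v))) ^+ 2.
    by rewrite /rf /qf; field.
  by in_adj.
have sd : adjoin iota s3 (u - v).
  have -> : u - v = psi * (u / (u - v)) * (v / (u - v)) * (g / (u - v) + (u + v) / (u - v))
              / (rf / (u - v) ^+ 5).
    rewrite /psi; move: rf nzr => r nzr; field.
    by neq0s nz2 free u v g 1%N 20%N 200%N.
  by in_adj.
have mulK w : adjoin iota s3 (w / (u - v)) -> adjoin iota s3 w.
  by move=> sw; rewrite -(divfK nzd w); apply: adjoinM.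
by move=> x; rewrite !inE => /or3P[]/eqP->; apply: mulK.
Qed.

Section Action.
Variables (phi : {rmorphism F -> F}) (P : F).
Hypothesis defP : P = qf * rf / (u * v) ^+ 2.

Let nzP : P != 0.
Proof.
rewrite defP mulf_neq0 ?invr_eq0 //; first apply: mulf_neq0.
- by rewrite /qf; neq0_by nz2 free u v g 1%N 20%N 200%N.
- by rewrite /rf /qf; neq0_by nz2 free u v g 1%N 20%N 200%N.
- by neq0_by nz2 free u v g 1%N 20%N 200%N.
Qed.

Lemma rmorph_th : phi th = (phi u + phi v - 2 * (phi u * phi v) / (phi g + phi u + phi v)) / (phi u - phi v).
Proof. by rewrite fmorph_div !(rmorphB, rmorphD) fmorph_div; congr ((_ - _ / _) / _); ring. Qed.

Lemma rmorph_psi : phi psi =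
  let q := phi u ^+ 2 - phi u * phi v + phi v ^+ 2 in
  (q * (phi g + phi u + phi v) ^+ 2 * (phi u + phi v)
  - 3 * q * (phi g + phi u + phi v) * (phi u * phi v) - phi g * (phi u * phi v) ^+ 2)
  / (phi u * phi v * (phi g + phi u + phi v) * (phi u - phi v)).
Proof. by rewrite fmorph_div /rf /qf; congr (_ / _); ring. Qed.

Lemma iota_th : phi u = 2 * g * v / P -> phi v = 2 * g * u / P -> phi g = 2 * qf / P ->
  phi th = ths.
Proof.
move=> phiu phiv phig; rewrite rmorph_th phiu phiv phig /ths /qf; move: P nzP => p nzp.
by field; neq0s nz2 free u v g 1%N 20%N 200%N.
Qed.

Let r1 : F := (u + v) * (qf + g * (u + v)) ^+ 2
  - 3 * g * (u * v) * (qf + g * (u + v)) - g * (u * v) ^+ 2.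

(** The second factor is the image of psi up to sign. Its 1 / P cancels the numerator rf of psi,
    which is the reason for that numerator. *)
Let psi_phi : psi * (2 / P * qf * r1 / (u * v * (qf + g * (u + v)) * (u - v))) =
  2 * r1 / ((qf + g * (u + v)) * (g + u + v) * (u - v) ^+ 2).
Proof.
have nzr : rf != 0 by rewrite /rf /qf; neq0_by nz2 free u v g 1%N 20%N 200%N.
have nzq : qf != 0 by rewrite /qf; neq0_by nz2 free u v g 1%N 20%N 200%N.
have nzqg : qf + g * (u + v) != 0 by rewrite /qf; neq0_by nz2 free u v g 1%N 20%N 200%N.
rewrite /psi defP; move: rf r1 qf nzr nzq nzqg => r r' q nzr nzq nzqg; field.
neq0s nz2 free u v g 1%N 20%N 200%N.
Qed.

Let th_ths : th * ths - 1 = - (2 * r1 / ((qf + g * (u + v)) * (g + u + v) * (u - v) ^+ 2)).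
Proof.
rewrite /r1 /th /ths /qf; field.
by neq0s nz2 free u v g 1%N 20%N 200%N.
Qed.

Lemma iota_psi : phi u = 2 * g * v / P -> phi v = 2 * g * u / P -> phi g = 2 * qf / P ->
  psi * phi psi = th * ths - 1.
Proof.
move=> phiu phiv phig; rewrite th_ths -psi_phi -mulrN; congr (_ * _).
rewrite rmorph_psi phiu phiv phig /r1 /qf; move: P nzP => p nzp; field.
by neq0s nz2 free u v g 1%N 20%N 200%N.
Qed.

Lemma gamma_th : phi u = 2 * g * u / P -> phi v = 2 * g * v / P -> phi g = 2 * qf / P ->
  phi th = - ths.
Proof.
move=> phiu phiv phig; rewrite rmorph_th phiu phiv phig /ths /qf; move: P nzP => p nzp.
by field; neq0s nz2 free u v g 1%N 20%N 200%N.
Qed.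

Lemma gamma_psi : phi u = 2 * g * u / P -> phi v = 2 * g * v / P -> phi g = 2 * qf / P ->
  psi * phi psi = 1 - th * ths.
Proof.
move=> phiu phiv phig; rewrite -[RHS]opprB th_ths opprK -psi_phi; congr (_ * _).
rewrite rmorph_psi phiu phiv phig /r1 /qf; move: P nzP => p nzp; field.
by neq0s nz2 free u v g 1%N 20%N 200%N.
Qed.

Lemma beta_th : phi u = v -> phi v = u -> phi g = g -> phi th = - th.
Proof.
move=> phiu phiv phig; rewrite rmorph_th phiu phiv phig /th.
by field; neq0s nz2 free u v g 1%N 20%N 200%N.
Qed.

Lemma beta_ths : phi u = v -> phi v = u -> phi g = g -> phi ths = - ths.
Proof.
move=> phiu phiv phig.
have -> : phi ths = - ((phi u + phi v - 2 * (phi u * phi v) * phi g /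
  (phi u ^+ 2 - phi u * phi v + phi v ^+ 2 + phi g * (phi u + phi v))) / (phi u - phi v)).
  rewrite rmorphN fmorph_div rmorphB fmorph_div rmorphD !rmorphB.
  by congr (- ((_ - _ / _) / _)); rewrite /qf; ring.
rewrite phiu phiv phig /ths /qf.
by field; neq0s nz2 free u v g 1%N 20%N 200%N.
Qed.

Lemma beta_psi : phi u = v -> phi v = u -> phi g = g -> phi psi = - psi.
Proof.
move=> phiu phiv phig; rewrite rmorph_psi phiu phiv phig /psi /rf /qf.
by field; neq0s nz2 free u v g 1%N 20%N 200%N.
Qed.

End Action.

Lemma th_in_uvg : forall x, x \in s3 -> adjoin iota [:: u; v; g] x.
Proof.
have su : adjoin iota [:: u; v; g] u by in_adj.
have sv : adjoin iota [:: u; v; g] v by in_adj.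
have sg : adjoin iota [:: u; v; g] g by in_adj.
by move=> x; rewrite !inE => /or3P[]/eqP->; rewrite /th /ths /psi /rf /qf; in_adj.
Qed.

End Quadric.

(* The two sides of x^2 - X^2 = y^2 - Y^2 + 1 factor, with x = (t + t')/2,
   y = (t - t')/2, X = (p + p')/2, Y = (p - p')/2. *)
Definition linA (F : fieldType) (t t' p p' : F) := (t + t' - p - p') / 2.
Definition linB (F : fieldType) (t t' p p' : F) := (t - t' - p + p') / 2.
Definition linC (F : fieldType) (t t' p p' : F) := (t - t' + p - p') / 2.

Section Linear.
Variables (K F : fieldType) (iota : {rmorphism K -> F}) (t t' p p' : F).
Hypothesis nz2 : 2 != 0 :> F.
Hypothesis def_p' : p * p' = t * t' - 1.
Let A := linA t t' p p'.
Let B := linB t t' p p'.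
Let C := linC t t' p p'.

Lemma lin_mem s x : (forall y, y \in [:: t; t'; p; p'] -> adjoin iota s y) ->
  x \in [:: A; B; C] -> adjoin iota s x.
Proof.
move=> sP.
have st : adjoin iota s t by apply: sP; rewrite !inE eqxx ?orbT.
have st' : adjoin iota s t' by apply: sP; rewrite !inE eqxx ?orbT.
have sp : adjoin iota s p by apply: sP; rewrite !inE eqxx ?orbT.
have sp' : adjoin iota s p' by apply: sP; rewrite !inE eqxx ?orbT.
by rewrite !inE => /or3P[]/eqP->; rewrite /A /B /C /linA /linB /linC; in_adj.
Qed.

Lemma mem_lin x : A != 0 -> x \in [:: t; t'; p; p'] -> adjoin iota [:: A; B; C] x.
Proof.
move=> nzA; have sA : adjoin iota [:: A; B; C] A by in_adj.
have sB : adjoin iota [:: A; B; C] B by in_adj.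
have sC : adjoin iota [:: A; B; C] C by in_adj.
(* The missing linear factor x + X, from (x - X) (x + X) = B C + 1. *)
have defA' : (t + t' + p + p') / 2 = (B * C + 1) / A.
  apply: (mulIf nzA); rewrite divfK //.
  transitivity (B * C + (t * t' - p * p')); last by rewrite def_p'; congr (_ + _); ring.
  by rewrite /A /B /C /linA /linB /linC; field.
have sA' : adjoin iota [:: A; B; C] ((t + t' + p + p') / 2) by rewrite defA'; in_adj.
rewrite !inE => /or4P[]/eqP->.
- have -> : t = ((t + t' + p + p') / 2 + A + B + C) / 2.
    by rewrite /A /B /C /linA /linB /linC; field.
  by in_adj.
- have -> : t' = ((t + t' + p + p') / 2 + A - B - C) / 2.
    by rewrite /A /B /C /linA /linB /linC; field.
  by in_adj.
- have -> : p = ((t + t' + p + p') / 2 - A - B + C) / 2.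
    by rewrite /A /B /C /linA /linB /linC; field.
  by in_adj.
- have -> : p' = ((t + t' + p + p') / 2 - A + B - C) / 2.
    by rewrite /A /B /C /linA /linB /linC; field.
  by in_adj.
Qed.

Variable phi : {rmorphism F -> F}.

Lemma lin_conj : phi t = t' -> phi t' = t -> phi p = p' -> phi p' = p ->
  [/\ phi A = A, phi B = - B & phi C = - C].
Proof.
move=> e1 e2 e3 e4; rewrite /A /B /C /linA /linB /linC !fmorph_div !rmorph_nat -!mulNr.
by split; congr (_ / _); rewrite !(rmorphB, rmorphD) e1 e2 e3 e4; ring.
Qed.

Lemma lin_odd : phi t = - t -> phi t' = - t' -> phi p = - p -> phi p' = - p' ->
  [/\ phi A = - A, phi B = - B & phi C = - C].
Proof.
move=> e1 e2 e3 e4; rewrite /A /B /C /linA /linB /linC !fmorph_div !rmorph_nat -!mulNr.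
by split; congr (_ / _); rewrite !(rmorphB, rmorphD) e1 e2 e3 e4; ring.
Qed.

End Linear.

(* The quadric X^2 - Y^2 = 1 + y^2 - x^2 projected from (X, Y, x, y) =
   (1, 0, 0, 0), with nm_phi = X + Y, nm_t = y + x and nm_t' = y - x. *)
Section NormModel.
Variables (K F : fieldType) (iota : {rmorphism K -> F}) (A B C : F).
Hypothesis nz2 : 2 != 0 :> K.
Hypothesis free : alg_indep iota [tuple A; B; C].

Let nz2F : 2 != 0 :> F.
Proof. by rewrite -(rmorph_nat iota) fmorph_eq0. Qed.

(** The line through the centre has direction (1, A C, A, B), and [nm_c] is the parameter of its
    second point on the quadric. The product A C occurs because Y has to be negated by phi but fixed
    by beta3, which negates A, B and C. *)
Definition nm_c : F := 2 / ((A * C) ^+ 2 + B ^+ 2 - A ^+ 2 - 1).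
Definition nm_t : F := nm_c * (A + B).
Definition nm_t' : F := nm_c * (B - A).
Definition nm_phi : F := 1 + nm_c + nm_c * (A * C).
Definition nm_phi' : F := 1 + nm_c - nm_c * (A * C).

Let nzk : (A * C) ^+ 2 + B ^+ 2 - A ^+ 2 - 1 != 0.
Proof. by neq0_by nz2 free A B C 1%N 20%N 200%N. Qed.

Lemma nm_norm : nm_phi * nm_phi' = 1 + nm_t * nm_t'.
Proof. by rewrite /nm_phi /nm_phi' /nm_t /nm_t' /nm_c; field. Qed.

Let nzphi : nm_phi != 0.
Proof.
have -> : nm_phi = ((A * C) ^+ 2 + B ^+ 2 - A ^+ 2 + 1 + 2 * A * C) / ((A * C) ^+ 2 + B ^+ 2 - A ^+ 2 - 1).
  by rewrite /nm_phi /nm_c; field.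
by rewrite mulf_neq0 ?invr_eq0 //; neq0_by nz2 free A B C 1%N 20%N 200%N.
Qed.

Let s1 := [:: nm_t; nm_t'; nm_phi].

Lemma ABC_in_nm x : x \in [:: A; B; C] -> adjoin iota s1 x.
Proof.
have st : adjoin iota s1 nm_t by in_adj.
have st' : adjoin iota s1 nm_t' by in_adj.
have sp : adjoin iota s1 nm_phi by in_adj.
have nzA : A != 0 by neq0_by nz2 free A B C 1%N 20%N 200%N.
have nzc : nm_c != 0 by rewrite mulf_neq0 ?invr_eq0.
have sp' : adjoin iota s1 nm_phi'.
  by rewrite -(mulKf nzphi nm_phi') nm_norm; in_adj.
have sc : adjoin iota s1 nm_c.
  have -> : nm_c = (nm_phi + nm_phi') / 2 - 1 by rewrite /nm_phi /nm_phi'; field.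
  by in_adj.
have sA : adjoin iota s1 A.
  have -> : A = (nm_t - nm_t') / (2 * nm_c) by rewrite /nm_t /nm_t'; field; rewrite nz2F nzc.
  by in_adj.
rewrite !inE => /or3P[]/eqP-> //.
  have -> : B = (nm_t + nm_t') / (2 * nm_c) by rewrite /nm_t /nm_t'; field; rewrite nz2F nzc.
  by in_adj.
have -> : C = (nm_phi - nm_phi') / (2 * nm_c * A).
  by rewrite /nm_phi /nm_phi'; field; rewrite nz2F nzc nzA.
by in_adj.
Qed.

Lemma nm_in_ABC x : x \in s1 -> adjoin iota [:: A; B; C] x.
Proof.
have sA : adjoin iota [:: A; B; C] A by in_adj.
have sB : adjoin iota [:: A; B; C] B by in_adj.
have sC : adjoin iota [:: A; B; C] C by in_adj.
by rewrite !inE => /or3P[]/eqP->; rewrite /nm_t /nm_t' /nm_phi /nm_c; in_adj.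
Qed.

Lemma nm_rmorph (phi : {rmorphism F -> F}) :
  [/\ phi nm_c = 2 / ((phi A * phi C) ^+ 2 + phi B ^+ 2 - phi A ^+ 2 - 1),
      phi nm_t = phi nm_c * (phi A + phi B), phi nm_t' = phi nm_c * (phi B - phi A)
    & phi nm_phi = 1 + phi nm_c + phi nm_c * (phi A * phi C)].
Proof.
split.
- by rewrite /nm_c fmorph_div rmorph_nat; congr (_ / _); ring.
- by rewrite /nm_t rmorphM rmorphD.
- by rewrite /nm_t' rmorphM rmorphB.
- by rewrite /nm_phi !rmorphD rmorph1 !rmorphM.
Qed.

Lemma nm_iota (phi : {rmorphism F -> F}) :
  phi A = A -> phi B = - B -> phi C = - C ->
  [/\ phi nm_t = - nm_t', phi nm_t' = - nm_t & phi nm_phi = nm_phi'].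
Proof.
move=> e1 e2 e3; have [ec -> -> ->] := nm_rmorph phi.
have {ec} -> : phi nm_c = nm_c by rewrite ec e1 e2 e3 /nm_c mulrN !sqrrN.
by rewrite e1 e2 e3 /nm_t /nm_t' /nm_phi'; split; ring.
Qed.

Lemma nm_beta (phi : {rmorphism F -> F}) :
  phi A = - A -> phi B = - B -> phi C = - C ->
  [/\ phi nm_t = - nm_t, phi nm_t' = - nm_t' & phi nm_phi = nm_phi].
Proof.
move=> e1 e2 e3; have [ec -> -> ->] := nm_rmorph phi.
have {ec} -> : phi nm_c = nm_c by rewrite ec e1 e2 e3 /nm_c mulrNN !sqrrN.
by rewrite e1 e2 e3 /nm_t /nm_t' /nm_phi; split; ring.
Qed.

End NormModel.

(* The inverse of (p, q) |-> (N1/D1, N2/D2) with N1 = q (p^2 + 1) - 2 p,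
   D1 = p^2 + 2 p q - 3 and N2, D2 obtained by exchanging p and q. *)
Section CremonaModel.
Variables (K F : fieldType) (iota : {rmorphism K -> F}) (a b c : F).
Hypothesis nz2 : 2 != 0 :> K.
Hypothesis free : alg_indep iota [tuple a; b; c].

Let r : F := (a ^+ 2 - 2 * a * b + 1) / (b ^+ 2 - 2 * a * b + 1).

Definition cr_p : F := b + 2 * a / ((a ^+ 2 - 2 * a * b + 1) / (b ^+ 2 - 2 * a * b + 1)).
Definition cr_q : F := a + 2 * b * ((a ^+ 2 - 2 * a * b + 1) / (b ^+ 2 - 2 * a * b + 1)).

Lemma cr_a : a = (cr_q * (cr_p ^+ 2 + 1) - 2 * cr_p) / (cr_p ^+ 2 + 2 * cr_p * cr_q - 3).
Proof. rewrite /cr_q /cr_p; field; neq0s nz2 free a b c 1%N 20%N 200%N. Qed.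

Lemma cr_b : b = (cr_p * (cr_q ^+ 2 + 1) - 2 * cr_q) / (cr_q ^+ 2 + 2 * cr_p * cr_q - 3).
Proof. rewrite /cr_q /cr_p; field; neq0s nz2 free a b c 1%N 20%N 200%N. Qed.

Lemma ab_in_cr x : x \in [:: a; b; c] -> adjoin iota [:: cr_p; cr_q; c] x.
Proof.
have sp : adjoin iota [:: cr_p; cr_q; c] cr_p by in_adj.
have sq : adjoin iota [:: cr_p; cr_q; c] cr_q by in_adj.
rewrite !inE => /or3P[]/eqP->; [rewrite cr_a | rewrite cr_b | ]; by in_adj.
Qed.

Lemma cr_in_ab x : x \in [:: cr_p; cr_q; c] -> adjoin iota [:: a; b; c] x.
Proof.
have sa : adjoin iota [:: a; b; c] a by in_adj.
have sb : adjoin iota [:: a; b; c] b by in_adj.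
by rewrite !inE => /or3P[]/eqP->; rewrite /cr_p /cr_q; in_adj.
Qed.

Lemma cr_rmorph (phi : {rmorphism F -> F}) :
  phi cr_p = phi b + 2 * phi a / ((phi a ^+ 2 - 2 * phi a * phi b + 1) / (phi b ^+ 2 - 2 * phi a * phi b + 1))
  /\ phi cr_q = phi a + 2 * phi b * ((phi a ^+ 2 - 2 * phi a * phi b + 1) / (phi b ^+ 2 - 2 * phi a * phi b + 1)).
Proof.
rewrite /cr_p /cr_q !rmorphD [phi (2 * a / _)]fmorph_div [phi (2 * b * _)]rmorphM !fmorph_div.
by split; congr (_ + _); [congr (_ / (_ / _)) | congr (_ * (_ / _))]; ring.
Qed.

Lemma cr_iota (phi : {rmorphism F -> F}) :
  phi a = - b -> phi b = - a -> phi cr_p = - cr_q /\ phi cr_q = - cr_p.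
Proof.
move=> e1 e2; have [-> ->] := cr_rmorph phi; rewrite e1 e2 /cr_p /cr_q.
by split; field; neq0s nz2 free a b c 1%N 20%N 200%N.
Qed.

Lemma cr_beta (phi : {rmorphism F -> F}) :
  phi a = - a -> phi b = - b -> phi cr_p = - cr_p /\ phi cr_q = - cr_q.
Proof.
move=> e1 e2; have [-> ->] := cr_rmorph phi; rewrite e1 e2 /cr_p /cr_q.
by split; field; neq0s nz2 free a b c 1%N 20%N 200%N.
Qed.

End CremonaModel.

(** * Birational models *)

Section SexticModels.
Variables (K F : fieldType) (iota : {rmorphism K -> F}) (p q c : F).
Hypothesis nz2 : 2 != 0 :> K.
Hypothesis free : alg_indep iota [tuple p; q; c].

Let D1 : F := p ^+ 2 + 2 * p * q - 3.
Let D2 : F := q ^+ 2 + 2 * p * q - 3.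
Let N1 : F := q * (p ^+ 2 + 1) - 2 * p.
Let N2 : F := p * (q ^+ 2 + 1) - 2 * q.

Let nz2F : 2 != 0 :> F.
Proof. by rewrite -(rmorph_nat iota) fmorph_eq0. Qed.
Let nzp : p != 0. Proof. by neq0_by nz2 free p q c 1%N 20%N 200%N. Qed.
Let nzq : q != 0. Proof. by neq0_by nz2 free p q c 1%N 20%N 200%N. Qed.
Let nzD1 : D1 != 0. Proof. by rewrite /D1; neq0_by nz2 free p q c 1%N 20%N 200%N. Qed.
Let nzD2 : D2 != 0. Proof. by rewrite /D2; neq0_by nz2 free p q c 1%N 20%N 200%N. Qed.
Let nzp1 : p + 1 != 0. Proof. by neq0_by nz2 free p q c 1%N 20%N 200%N. Qed.
Let nzq1 : q - 1 != 0. Proof. by neq0_by nz2 free p q c 1%N 20%N 200%N. Qed.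

(** For r = 1 / (p + 1) and s = 1 / (q - 1) these are w1 = r - s - 1 and w2 = r + s, and (p, q) ->
    (-q, -p) sends r to -s. The norm D1 D2 + N1 N2 has degree 3 in each of p and q, hence the cube
    in w3. It vanishes at (-1, 1), so that in w1, w2 it has degree 5 instead of 6. *)
Definition w1_of : F := - ((p * q + 1) / ((p + 1) * (q - 1))).
Definition w2_of : F := (p + q) / ((p + 1) * (q - 1)).
Definition w3_of : F := c * (p ^+ 2 + 2 * p * q - 3) / (q - 1) ^+ 3.

(** The same construction with 1 / p and 1 / q, which beta3 negates. The value 9 of D1 D2 + N1 N2 at
    the origin becomes the coefficient of (p1^2 - p2^2)^3. *)
Definition p1_of : F := (p^-1 - q^-1) / 2.
Definition p2_of : F := (p^-1 + q^-1) / 2.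
Definition p3_of : F := c * (p ^+ 2 + 2 * p * q - 3) / q ^+ 3.

Let sw := [:: w1_of; w2_of; w3_of].
Let sp := [:: p1_of; p2_of; p3_of].

Lemma w_in_pq x : x \in sw -> adjoin iota [:: p; q; c] x.
Proof.
have s_p : adjoin iota [:: p; q; c] p by in_adj.
have s_q : adjoin iota [:: p; q; c] q by in_adj.
have sc : adjoin iota [:: p; q; c] c by in_adj.
by rewrite !inE => /or3P[]/eqP->; rewrite /w1_of /w2_of /w3_of; in_adj.
Qed.

Lemma pq_in_w x : x \in [:: p; q; c] -> adjoin iota sw x.
Proof.
have s1 : adjoin iota sw w1_of by in_adj.
have s2 : adjoin iota sw w2_of by in_adj.
have s3 : adjoin iota sw w3_of by in_adj.
(* Here rho = (q - p) / 2 - 1 and lam rho = (p + q) / 2. *)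
pose lam := w2_of / (1 + w1_of).
have slam : adjoin iota sw lam by rewrite /lam; in_adj.
pose rho := 2 / ((1 + w1_of) * (lam ^+ 2 - 1)).
have srho : adjoin iota sw rho by rewrite /rho; in_adj.
have def_p : p = lam * rho - (rho + 1).
  by rewrite /rho /lam /w1_of /w2_of; field; neq0s nz2 free p q c 1%N 20%N 200%N.
have def_q : q = lam * rho + (rho + 1).
  by rewrite /rho /lam /w1_of /w2_of; field; neq0s nz2 free p q c 1%N 20%N 200%N.
have s_p : adjoin iota sw p by rewrite def_p; in_adj.
have s_q : adjoin iota sw q by rewrite def_q; in_adj.
rewrite !inE => /or3P[]/eqP-> //.
have -> : c = w3_of * (q - 1) ^+ 3 / (p ^+ 2 + 2 * p * q - 3).
  by rewrite /w3_of; field; neq0s nz2 free p q c 1%N 20%N 200%N.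
by in_adj.
Qed.

Lemma p_in_pq x : x \in sp -> adjoin iota [:: p; q; c] x.
Proof.
have s_p : adjoin iota [:: p; q; c] p by in_adj.
have s_q : adjoin iota [:: p; q; c] q by in_adj.
have sc : adjoin iota [:: p; q; c] c by in_adj.
by rewrite !inE => /or3P[]/eqP->; rewrite /p1_of /p2_of /p3_of; in_adj.
Qed.

Lemma pq_in_p x : x \in [:: p; q; c] -> adjoin iota sp x.
Proof.
have s1 : adjoin iota sp p1_of by in_adj.
have s2 : adjoin iota sp p2_of by in_adj.
have s3 : adjoin iota sp p3_of by in_adj.
have s_p : adjoin iota sp p.
  have -> : p = (p1_of + p2_of)^-1.
    by rewrite /p1_of /p2_of; field; neq0s nz2 free p q c 1%N 20%N 200%N.
  by in_adj.
have s_q : adjoin iota sp q.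
  have -> : q = (p2_of - p1_of)^-1.
    by rewrite /p1_of /p2_of; field; neq0s nz2 free p q c 1%N 20%N 200%N.
  by in_adj.
rewrite !inE => /or3P[]/eqP-> //.
have -> : c = p3_of * q ^+ 3 / (p ^+ 2 + 2 * p * q - 3).
  by rewrite /p3_of; field; neq0s nz2 free p q c 1%N 20%N 200%N.
by in_adj.
Qed.

Section Action.
Variable phi : {rmorphism F -> F}.

Section Iota.
Hypotheses (phip : phi p = - q) (phiq : phi q = - p).
Hypothesis phic : c * phi c = 1 + N1 / D1 * (N2 / D2).

Let norm_cD : c * D1 * phi (c * D1) = D1 * D2 + N1 * N2.
Proof.
have -> : phi (c * D1) = phi c * D2.
  rewrite rmorphM; congr (_ * _); transitivity (phi p ^+ 2 + 2 * phi p * phi q - 3).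
    by rewrite /D1; ring.
  by rewrite phip phiq /D2; ring.
transitivity ((c * phi c) * (D1 * D2)); first by ring.
by rewrite phic; move: D1 D2 nzD1 nzD2 => d1 d2 nzd1 nzd2; field; rewrite nzd1 nzd2.
Qed.

Let nzcD : c * D1 != 0.
Proof. by rewrite /D1; neq0_by nz2 free p q c 1%N 20%N 200%N. Qed.

Lemma w_iota : [/\ phi w1_of = w1_of, phi w2_of = - w2_of
  & phi w3_of = (w1_of * (1 + w1_of + w1_of ^+ 2) ^+ 2
     - (2 + 3 * w1_of + 4 * w1_of ^+ 2 + 2 * w1_of ^+ 3) * w2_of ^+ 2
     + (w1_of + 2) * w2_of ^+ 4) / w3_of].
Proof.
have phi_den : phi ((p + 1) * (q - 1)) = (p + 1) * (q - 1).
  by transitivity ((phi p + 1) * (phi q - 1)); [ring | rewrite phip phiq; ring].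
split.
- rewrite /w1_of rmorphN fmorph_div phi_den; congr (- (_ / _)).
  by transitivity (phi p * phi q + 1); [ring | rewrite phip phiq; ring].
- rewrite /w2_of fmorph_div phi_den -mulNr; congr (_ / _).
  by rewrite rmorphD phip phiq; ring.
have -> : phi w3_of = phi (c * D1) / (- p - 1) ^+ 3.
  rewrite /w3_of fmorph_div -/D1; congr (_ / _).
  by rewrite rmorphXn rmorphB rmorph1 phiq.
rewrite -[phi (c * D1)](mulKf nzcD) norm_cD /w1_of /w2_of /w3_of /D1 /D2 /N1 /N2.
by field; neq0s nz2 free p q c 1%N 20%N 200%N.
Qed.

Lemma p_iota : [/\ phi p1_of = p1_of, phi p2_of = - p2_of
  & phi p3_of = (- 1 - 5 * p1_of ^+ 2 - 7 * p2_of ^+ 2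
     - (p1_of ^+ 2 - p2_of ^+ 2) * (3 * p1_of ^+ 2 + 17 * p2_of ^+ 2)
     + 9 * (p1_of ^+ 2 - p2_of ^+ 2) ^+ 3) / p3_of].
Proof.
split.
- by rewrite /p1_of fmorph_div rmorphB !fmorphV phip phiq rmorph_nat !invrN; congr (_ / _); ring.
- rewrite /p2_of fmorph_div rmorphD !fmorphV phip phiq rmorph_nat !invrN -mulNr.
  by congr (_ / _); ring.
have -> : phi p3_of = phi (c * D1) / (- p) ^+ 3.
  by rewrite /p3_of fmorph_div -/D1 rmorphXn phiq.
rewrite -[phi (c * D1)](mulKf nzcD) norm_cD /p1_of /p2_of /p3_of /D1 /D2 /N1 /N2.
by field; neq0s nz2 free p q c 1%N 20%N 200%N.
Qed.

End Iota.

Lemma p_beta : phi p = - p -> phi q = - q -> phi c = c ->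
  [/\ phi p1_of = - p1_of, phi p2_of = - p2_of & phi p3_of = - p3_of].
Proof.
move=> phip phiq phic; split.
- by rewrite /p1_of fmorph_div rmorphB !fmorphV phip phiq rmorph_nat !invrN -mulNr; congr (_ / _); ring.
- by rewrite /p2_of fmorph_div rmorphD !fmorphV phip phiq rmorph_nat !invrN -mulNr; congr (_ / _); ring.
have -> : phi p3_of = phi c * phi D1 / (- q) ^+ 3.
  by rewrite /p3_of fmorph_div -/D1 rmorphXn phiq rmorphM.
have -> : phi D1 = D1.
  by transitivity (phi p ^+ 2 + 2 * phi p * phi q - 3); [rewrite /D1; ring | rewrite phip phiq /D1; ring].
by rewrite phic /p3_of /D1; field; neq0s nz2 free p q c 1%N 20%N 200%N.
Qed.

End Action.
End SexticModels.

(* X^2 - Y^2 = 2 (5 s^2 + 4 s + 1) - 2 T^2 projected from (X, s, Y, T) =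
   (2, -1, 0, 0), where u2 = T / s, u1 = 2 + s (5 - u2^2) and
   u3 = (5 - u2^2) (X + Y). *)
Section UModel.
Variables (K F : fieldType) (iota : {rmorphism K -> F}) (a b c : F).
Hypothesis nz2 : 2 != 0 :> K.
Hypothesis free : alg_indep iota [tuple a; b; c].

Let nz2F : 2 != 0 :> F.
Proof. by rewrite -(rmorph_nat iota) fmorph_eq0. Qed.

Definition um_x : F := - (4 * (1 + 3 * a)) / (1 - b ^+ 2 - 10 * a ^+ 2 + 2 * c ^+ 2).
Definition um_s : F := a * um_x - 1.
Definition u2_of : F := c * um_x / um_s.
Definition um_m : F := 5 - u2_of ^+ 2.
Definition u1_of : F := 2 + um_s * um_m.
Definition u3_of : F := um_m * (2 + um_x + b * um_x).

Let u3' : F := um_m * (2 + um_x - b * um_x).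
Let su := [:: u1_of; u2_of; u3_of].

Let nz_den : 1 - b ^+ 2 - 10 * a ^+ 2 + 2 * c ^+ 2 != 0.
Proof. by neq0_by nz2 free a b c 1%N 20%N 200%N. Qed.

Let nzx : um_x != 0.
Proof.
rewrite mulf_neq0 ?invr_eq0 //; neq0_by nz2 free a b c 1%N 20%N 200%N.
Qed.

Let nzs : um_s != 0.
Proof.
have -> : um_s = (- (4 * (1 + 3 * a)) * a - (1 - b ^+ 2 - 10 * a ^+ 2 + 2 * c ^+ 2))
                 / (1 - b ^+ 2 - 10 * a ^+ 2 + 2 * c ^+ 2).
  by rewrite /um_s /um_x; field.
by rewrite mulf_neq0 ?invr_eq0 //; neq0_by nz2 free a b c 1%N 20%N 200%N.
Qed.

Let nzm : um_m != 0.
Proof.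
have -> : um_m = (5 * (- (4 * (1 + 3 * a)) * a - (1 - b ^+ 2 - 10 * a ^+ 2 + 2 * c ^+ 2)) ^+ 2
    - (c * (4 * (1 + 3 * a))) ^+ 2) /
    (- (4 * (1 + 3 * a)) * a - (1 - b ^+ 2 - 10 * a ^+ 2 + 2 * c ^+ 2)) ^+ 2.
  by rewrite /um_m /u2_of /um_s /um_x; field; neq0s nz2 free a b c 1%N 20%N 200%N.
rewrite mulf_neq0 ?invr_eq0 ?expf_neq0 //; neq0_by nz2 free a b c 1%N 20%N 200%N.
Qed.

Let nzu3 : u3_of != 0.
Proof.
rewrite mulf_neq0 //.
have -> : 2 + um_x + b * um_x = (2 * (1 - b ^+ 2 - 10 * a ^+ 2 + 2 * c ^+ 2)
   - (1 + b) * (4 * (1 + 3 * a))) / (1 - b ^+ 2 - 10 * a ^+ 2 + 2 * c ^+ 2).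
  by rewrite /um_x; field.
rewrite mulf_neq0 ?invr_eq0 //; neq0_by nz2 free a b c 1%N 20%N 200%N.
Qed.

(** Modulo 5 - u2^2 one has u1 = 2, so u1^2 - u2^2 + 1 is divisible by 5 - u2^2, with quotient 5 s^2
    + 4 s + 1 - T^2. *)
Let u3_norm : u3_of * u3' = 2 * (5 - u2_of ^+ 2) * (u1_of ^+ 2 - u2_of ^+ 2 + 1).
Proof.
have e : (2 + um_x) ^+ 2 - (b * um_x) ^+ 2 = 2 * (5 * um_s ^+ 2 + 4 * um_s + 1) - 2 * (c * um_x) ^+ 2.
  by rewrite /um_s /um_x; field.
have e2 : c * um_x = u2_of * um_s by rewrite /u2_of divfK.
rewrite e2 in e; rewrite /u3_of /u3' /u1_of.
transitivity (um_m ^+ 2 * ((2 + um_x) ^+ 2 - (b * um_x) ^+ 2)); first by ring.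
by rewrite e /um_m; ring.
Qed.

Lemma abc_in_u x : x \in [:: a; b; c] -> adjoin iota su x.
Proof.
have s1 : adjoin iota su u1_of by in_adj.
have s2 : adjoin iota su u2_of by in_adj.
have s3 : adjoin iota su u3_of by in_adj.
have sm : adjoin iota su um_m by rewrite /um_m; in_adj.
have ss : adjoin iota su um_s.
  by rewrite -(mulfK nzm um_s) -[um_s * um_m](addKr 2) -/u1_of; in_adj.
have s3' : adjoin iota su u3' by rewrite -(mulKf nzu3 u3') u3_norm; in_adj.
have sx : adjoin iota su um_x.
  have -> : um_x = (u3_of + u3') / (2 * um_m) - 2.
    by rewrite /u3_of /u3'; move: um_m um_x nzm => m x' nzm'; field; rewrite nzm' nz2F.
  by in_adj.
rewrite !inE => /or3P[]/eqP->.
- by rewrite -(mulfK nzx a) -[a * um_x](subrK 1) -/um_s; in_adj.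
- have -> : b = (u3_of - u3') / (2 * um_m * um_x).
    by rewrite /u3_of /u3'; move: um_m um_x nzm nzx => m x' nzm' nzx'; field; rewrite nzm' nz2F nzx'.
  by in_adj.
- by rewrite -(mulfK nzx c) -(divfK nzs (c * um_x)) -/u2_of; in_adj.
Qed.

Lemma u_in_abc x : x \in su -> adjoin iota [:: a; b; c] x.
Proof.
have sa : adjoin iota [:: a; b; c] a by in_adj.
have sb : adjoin iota [:: a; b; c] b by in_adj.
have sc : adjoin iota [:: a; b; c] c by in_adj.
have sx : adjoin iota [:: a; b; c] um_x by rewrite /um_x; in_adj.
have ss : adjoin iota [:: a; b; c] um_s by rewrite /um_s; in_adj.
have s2 : adjoin iota [:: a; b; c] u2_of by rewrite /u2_of; in_adj.
have sm : adjoin iota [:: a; b; c] um_m by rewrite /um_m; in_adj.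
by rewrite !inE => /or3P[]/eqP-> //; rewrite /u1_of /u3_of; in_adj.
Qed.

Lemma u_gamma (phi : {rmorphism F -> F}) : phi a = a -> phi b = - b -> phi c = - c ->
  [/\ phi u1_of = u1_of, phi u2_of = - u2_of
    & phi u3_of = 2 * (5 - u2_of ^+ 2) * (u1_of ^+ 2 - u2_of ^+ 2 + 1) / u3_of].
Proof.
move=> e1 e2 e3; have ex : phi um_x = um_x.
  rewrite /um_x fmorph_div; congr (_ / _).
    by transitivity (- (4 * (1 + 3 * phi a))); [ring | rewrite e1].
  transitivity (1 - phi b ^+ 2 - 10 * phi a ^+ 2 + 2 * phi c ^+ 2); first by ring.
  by rewrite e1 e2 e3 !sqrrN.
have es : phi um_s = um_s by rewrite /um_s rmorphB rmorphM rmorph1 e1 ex.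
have eu2 : phi u2_of = - u2_of by rewrite /u2_of fmorph_div rmorphM e3 ex es !mulNr.
have em : phi um_m = um_m by rewrite /um_m rmorphB rmorph_nat rmorphXn eu2 sqrrN.
split=> //; first by rewrite /u1_of rmorphD rmorph_nat rmorphM es em.
rewrite -u3_norm mulrAC mulfV // mul1r /u3_of /u3' rmorphM em; congr (_ * _).
by rewrite 2!rmorphD rmorph_nat rmorphM e2 ex mulNr.
Qed.

End UModel.

(* With zeta^2 = -3 the point t2 = zeta of the conic t1^2 - t2^2 + 1 = t1^2 + 4
   gives t2 = zeta + s (t1^2 + 4), which turns the norm equation into
   X^2 + y^2 - 1/4 = Y^2 - T^2 with T = s t1 and y = 2 s + zeta / 2. *)
Section TModel.
Variables (K F : fieldType) (iota : {rmorphism K -> F}) (a b c : F) (z : K).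
Hypothesis nz2 : 2 != 0 :> K.
Hypothesis free : alg_indep iota [tuple a; b; c].
Hypothesis z2 : z ^+ 2 = - 3.
Let zeta := iota z.

Let nz2F : 2 != 0 :> F.
Proof. by rewrite -(rmorph_nat iota) fmorph_eq0. Qed.

Let zeta2 : zeta ^+ 2 = - 3.
Proof. by rewrite -rmorphXn z2 rmorphN rmorph_nat. Qed.

Let nz4F : 4 != 0 :> F.
Proof. by rewrite (natrM _ 2 2) mulf_neq0. Qed.

Let nz8F : 8 != 0 :> F.
Proof. by rewrite (natrM _ 2 4) mulf_neq0. Qed.

(** The nonvanishing test handles integer coefficients only; expressions containing zeta are tested
    through the norm x^2 + 3 y^2 = (x - zeta y) (x + zeta y). *)
Let neq_zeta (x y : F) : x ^+ 2 + 3 * y ^+ 2 != 0 -> x != zeta * y.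
Proof.
apply: contraNneq => ->.
by rewrite exprMn zeta2; apply/eqP; ring.
Qed.

Let nzb : b != 0. Proof. by neq0_by nz2 free a b c 1%N 20%N 200%N. Qed.

(** The split quadric is solved by X = a, Y - T = b, y = b c, and [tm_d] is Y + T. As b and c are
    odd for phi, this makes Y and T odd and y even. *)
Definition tm_d : F := (a ^+ 2 + (b * c) ^+ 2 - 1 / 4) / b.
Definition tm_Y : F := (b + tm_d) / 2.
Definition tm_T : F := (tm_d - b) / 2.
Definition tm_s : F := (b * c - iota z / 2) / 2.
Definition t1_of : F := tm_T / tm_s.
Definition tm_m : F := t1_of ^+ 2 + 4.
Definition t2_of : F := iota z + tm_s * tm_m.
Definition t3_of : F := tm_m * (a + tm_Y).

Let t3' : F := tm_m * (a - tm_Y).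
Let st := [:: t1_of; t2_of; t3_of].

Let nzs : tm_s != 0.
Proof.
rewrite mulf_neq0 ?invr_eq0 // subr_eq0; apply: neq_zeta.
have -> : (b * c) ^+ 2 + 3 * 2^-1 ^+ 2 = (4 * (b * c) ^+ 2 + 3) / 4 by field; rewrite ?nz4F ?nz2F.
by rewrite mulf_neq0 ?invr_eq0 //; neq0_by nz2 free a b c 1%N 20%N 200%N.
Qed.

Let TE : tm_T = (4 * a ^+ 2 + 4 * (b * c) ^+ 2 - 1 - 4 * b ^+ 2) / (8 * b).
Proof. by rewrite /tm_T /tm_d; field; rewrite nzb nz8F nz4F nz2F. Qed.

Let YE : tm_Y = (4 * a ^+ 2 + 4 * (b * c) ^+ 2 - 1 + 4 * b ^+ 2) / (8 * b).
Proof. by rewrite /tm_Y /tm_d; field; rewrite nzb nz8F nz4F nz2F. Qed.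

Let nzm : tm_m != 0.
Proof.
have -> : tm_m = (tm_T ^+ 2 + 4 * tm_s ^+ 2) / tm_s ^+ 2.
  by rewrite /tm_m /t1_of; move: tm_T tm_s nzs => T s nzs'; field.
rewrite mulf_neq0 ?invr_eq0 ?expf_neq0 //.
have -> : tm_T ^+ 2 + 4 * tm_s ^+ 2 = (tm_T ^+ 2 + (b * c) ^+ 2 - 3 / 4) - zeta * (b * c).
  transitivity (tm_T ^+ 2 + (b * c) ^+ 2 + zeta ^+ 2 / 4 - zeta * (b * c)); last by rewrite zeta2; field.
  by rewrite /tm_s -/zeta; field; rewrite nz4F nz2F.
rewrite subr_eq0; apply: neq_zeta; rewrite TE.
have -> : (((4 * a ^+ 2 + 4 * (b * c) ^+ 2 - 1 - 4 * b ^+ 2) / (8 * b)) ^+ 2 + (b * c) ^+ 2 - 3 / 4) ^+ 2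
    + 3 * (b * c) ^+ 2
  = (((4 * a ^+ 2 + 4 * (b * c) ^+ 2 - 1 - 4 * b ^+ 2) ^+ 2 + (8 * b) ^+ 2 * (b * c) ^+ 2 - 48 * b ^+ 2) ^+ 2
    + 3 * (8 * b) ^+ 4 * (b * c) ^+ 2) / (8 * b) ^+ 4.
  by field; rewrite nzb nz8F nz4F.
rewrite mulf_neq0 ?invr_eq0 ?expf_neq0 ?mulf_neq0 //; neq0_by nz2 free a b c 1%N 20%N 200%N.
Qed.

Let nzt3 : t3_of != 0.
Proof.
rewrite mulf_neq0 // YE.
have -> : a + (4 * a ^+ 2 + 4 * (b * c) ^+ 2 - 1 + 4 * b ^+ 2) / (8 * b) =
  (8 * a * b + 4 * a ^+ 2 + 4 * (b * c) ^+ 2 - 1 + 4 * b ^+ 2) / (8 * b) by field; rewrite nzb nz8F.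
by rewrite mulf_neq0 ?invr_eq0 ?mulf_neq0 //; neq0_by nz2 free a b c 1%N 20%N 200%N.
Qed.

Let t3_norm : t3_of * t3' = (t1_of ^+ 2 + 4) * (t1_of ^+ 2 - t2_of ^+ 2 + 1).
Proof.
have e1 : a ^+ 2 - tm_Y ^+ 2 = 1 / 4 - (b * c) ^+ 2 - tm_T ^+ 2.
  by rewrite YE TE; field; rewrite nz4F nz8F nzb.
have e2 : (b * c) ^+ 2 = 4 * tm_s ^+ 2 + 2 * zeta * tm_s - 3 / 4.
  transitivity (4 * tm_s ^+ 2 + 2 * zeta * tm_s + zeta ^+ 2 / 4); last by rewrite zeta2; field.
  by rewrite /tm_s -/zeta; field; rewrite nz4F nz2F.
have e3 : tm_T = t1_of * tm_s by rewrite /t1_of divfK.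
have e4 : t2_of ^+ 2 = - 3 + 2 * zeta * tm_s * tm_m + tm_s ^+ 2 * tm_m ^+ 2.
  by rewrite -zeta2 /t2_of -/zeta; ring.
rewrite -/tm_m e4 /t3_of /t3'.
transitivity (tm_m ^+ 2 * (a ^+ 2 - tm_Y ^+ 2)); first by ring.
by rewrite e1 e2 e3 /tm_m; field.
Qed.

Lemma abc_in_t x : x \in [:: a; b; c] -> adjoin iota st x.
Proof.
have s1 : adjoin iota st t1_of by in_adj.
have s2 : adjoin iota st t2_of by in_adj.
have s3 : adjoin iota st t3_of by in_adj.
have sz : adjoin iota st zeta by apply: adjoin_base.
have sm : adjoin iota st tm_m by rewrite /tm_m; in_adj.
have ss : adjoin iota st tm_s.
  by rewrite -(mulfK nzm tm_s) -[tm_s * tm_m](addKr zeta) -/t2_of; in_adj.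
have sT : adjoin iota st tm_T by rewrite -(divfK nzs tm_T) -/t1_of; in_adj.
have s3' : adjoin iota st t3' by rewrite -(mulKf nzt3 t3') t3_norm; in_adj.
have sY : adjoin iota st tm_Y.
  have -> : tm_Y = (t3_of - t3') / (2 * tm_m).
    by rewrite /t3_of /t3'; move: tm_m tm_Y nzm => m Y nzm'; field; rewrite nzm' nz2F.
  by in_adj.
have sb : adjoin iota st b.
  have -> : b = tm_Y - tm_T by rewrite /tm_Y /tm_T; field.
  by in_adj.
rewrite !inE => /or3P[]/eqP-> //.
- have -> : a = (t3_of + t3') / (2 * tm_m).
    by rewrite /t3_of /t3'; move: tm_m tm_Y nzm => m Y nzm'; field; rewrite nzm' nz2F.
  by in_adj.
- have -> : c = (2 * tm_s + zeta / 2) / b by rewrite /tm_s -/zeta; field; rewrite nz2F nzb.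
  by in_adj.
Qed.

Lemma t_in_abc x : x \in st -> adjoin iota [:: a; b; c] x.
Proof.
have sa : adjoin iota [:: a; b; c] a by in_adj.
have sb : adjoin iota [:: a; b; c] b by in_adj.
have sc : adjoin iota [:: a; b; c] c by in_adj.
have sz : adjoin iota [:: a; b; c] (iota z) by apply: adjoin_base.
have sd : adjoin iota [:: a; b; c] tm_d by rewrite /tm_d; in_adj.
have ss : adjoin iota [:: a; b; c] tm_s by rewrite /tm_s; in_adj.
have s1 : adjoin iota [:: a; b; c] t1_of by rewrite /t1_of /tm_T; in_adj.
have sm : adjoin iota [:: a; b; c] tm_m by rewrite /tm_m; in_adj.
by rewrite !inE => /or3P[]/eqP-> //; rewrite /t2_of /t3_of /tm_Y; in_adj.
Qed.

Lemma t_iota (phi : {rmorphism F -> F}) : phi zeta = zeta ->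
  phi a = a -> phi b = - b -> phi c = - c ->
  [/\ phi t1_of = - t1_of, phi t2_of = t2_of
    & phi t3_of = (t1_of ^+ 2 + 4) * (t1_of ^+ 2 - t2_of ^+ 2 + 1) / t3_of].
Proof.
move=> ez e1 e2 e3; have ed : phi tm_d = - tm_d.
  rewrite /tm_d fmorph_div e2 invrN mulrN; congr (- (_ / _)).
  rewrite rmorphB rmorphD !rmorphXn rmorphM e1 e2 e3 mulrNN.
  by rewrite fmorph_div rmorph1 rmorph_nat.
have eY : phi tm_Y = - tm_Y by rewrite /tm_Y fmorph_div rmorphD ed e2 rmorph_nat -opprD mulNr.
have eT : phi tm_T = - tm_T by rewrite /tm_T fmorph_div rmorphB ed e2 rmorph_nat -opprD mulNr.
have es : phi tm_s = tm_s.
  by rewrite /tm_s fmorph_div rmorphB rmorphM e2 e3 mulrNN fmorph_div ez !rmorph_nat.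
have et1 : phi t1_of = - t1_of by rewrite /t1_of fmorph_div eT es mulNr.
have em : phi tm_m = tm_m by rewrite /tm_m rmorphD rmorph_nat rmorphXn et1 sqrrN.
split=> //; first by rewrite /t2_of rmorphD rmorphM es em -/zeta ez.
by rewrite -t3_norm mulrAC mulfV // mul1r /t3_of /t3' rmorphM em rmorphD e1 eY.
Qed.

End TModel.

(** * H is isomorphic to A_4 *)

Section AlternatingGroup.

Local Notation wd := (widen_ord (leqnSn 3)).
Local Notation m4 := (ord_max : 'I_4).

(* The action of S_4 on Z^4 / (1, 1, 1, 1), in the basis of the first three
   unit vectors. *)
Definition perm_mat (u : {perm 'I_4}) : 'M[int]_3 :=
  \matrix_(i, j) ((u^-1%g (wd j) == wd i)%:R - (u^-1%g (wd j) == m4)%:R).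

Lemma ord4P (x : 'I_4) : x = m4 \/ exists j : 'I_3, x = wd j.
Proof.
have [->|ne_x] := eqVneq x m4; [by left | right].
have lt_x : (x < 3)%N.
  by have := ltn_ord x; rewrite ltnS leq_eqVlt => /predU1P[e|//]; case/eqP: ne_x; apply: val_inj.
by exists (Ordinal lt_x); apply: val_inj.
Qed.

Lemma wd_eq (i j : 'I_3) : (wd i == wd j) = (i == j).
Proof. by rewrite -!val_eqE. Qed.

Lemma wd_m4 (i : 'I_3) : (wd i == m4) = false.
Proof. by rewrite -val_eqE /= ltn_eqF. Qed.

Lemma sum_perm_eq (s : {perm 'I_4}) (c : 'I_4) : \sum_x (s x == c)%:R = 1 :> int.
Proof.
rewrite (bigD1 (s^-1%g c)) //= permKV eqxx big1 ?addr0 // => x ne_x.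
by rewrite (can2_eq (permK s) (permKV s)) (negPf ne_x).
Qed.

(** Products of permutations act from left to right, which the inverse in [perm_mat] compensates. If
    v^-1 sends j to the last index, column j of the second matrix is constantly -1, and the sum over
    all four indices being zero gives the missing entry. *)
Lemma perm_matM u v : perm_mat (u * v)%g = perm_mat u *m perm_mat v.
Proof.
apply/matrixP=> i j; rewrite !mxE invMg permM.
set s := (u^-1)%g; case: (ord4P (v^-1%g (wd j))) => [def_y|[y0 def_y]]; last first.
  rewrite (bigD1 y0) //= big1 ?addr0 => [|l ne_l]; rewrite !mxE def_y.
    by rewrite eqxx wd_m4 subr0 mulr1.
  by rewrite wd_eq wd_m4 [y0 == l]eq_sym (negPf ne_l) subr0 mulr0.
have e0 : \sum_(x : 'I_4) ((s x == wd i)%:R - (s x == m4)%:R) = 0 :> int.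
  by rewrite sumrB !sum_perm_eq subrr.
move: e0; rewrite big_ord_recr /= => /eqP; rewrite addrC addr_eq0 => /eqP e0.
rewrite def_y e0 -sumrN; apply: eq_bigr => l _; rewrite !mxE def_y.
by rewrite [m4 == _]eq_sym wd_m4 eqxx sub0r mulrN1.
Qed.

Lemma perm_mat1 : perm_mat 1 = 1%:M.
Proof. by apply/matrixP=> i j; rewrite !mxE invg1 perm1 wd_eq wd_m4 subr0 eq_sym. Qed.

Lemma perm_matV u : invmx (perm_mat u) = perm_mat u^-1.
Proof.
have uV : perm_mat u *m perm_mat u^-1 = 1%:M by rewrite -perm_matM mulgV perm_mat1.
have [Uu _] := mulmx1_unit uV.
by rewrite -[RHS](mulKmx Uu) uV mulmx1.
Qed.

Lemma perm_mat_inj : injective perm_mat.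
Proof.
move=> u v /matrixP eq_uv; apply: invg_inj.
have eq_wd j : u^-1%g (wd j) = v^-1%g (wd j).
  have [eu|[i eu]] := ord4P (u^-1%g (wd j)); have [ev|[i' ev]] := ord4P (v^-1%g (wd j)).
  - by rewrite eu ev.
  - by have /eqP := eq_uv i' j; rewrite !mxE eu ev !eqxx ![m4 == _]eq_sym !wd_m4.
  - by have /eqP := eq_uv i j; rewrite !mxE eu ev !eqxx ![m4 == _]eq_sym !wd_m4.
  - have := eq_uv i j; rewrite !mxE eu ev eqxx !wd_m4 wd_eq.
    by case: eqP => // ->.
apply/permP=> x; have [->|[j ->]] := ord4P x; last exact: eq_wd.
have [e|[j e]] := ord4P (v (u^-1%g m4)).
  by rewrite -{2}e permK.
have := permK v (u^-1%g m4); rewrite e -eq_wd => /perm_inj/eqP.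
by rewrite wd_m4.
Qed.

Let x0 : 'I_4 := @Ordinal 4 0 isT.
Let x1 : 'I_4 := @Ordinal 4 1 isT.
Let x2 : 'I_4 := @Ordinal 4 2 isT.
Let x3 : 'I_4 := @Ordinal 4 3 isT.

Let tau : {perm 'I_4} := (tperm x0 x1 * tperm x2 x3)%g.
Let lam : {perm 'I_4} := (tperm x0 x2 * tperm x1 x3)%g.
Let sig : {perm 'I_4} := (tperm x1 x2 * tperm x0 x2)%g.

Lemma perm_mat_tau : perm_mat tau = tau3.
Proof.
apply/matrixP=> i j; rewrite !mxE invMg !tpermV permM.
by case: i => [[|[|[|i]]] lti] //; case: j => [[|[|[|j]]] ltj] //; rewrite !permE.
Qed.

Lemma perm_mat_lam : perm_mat lam = lambda3.
Proof.
apply/matrixP=> i j; rewrite !mxE invMg !tpermV permM.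
by case: i => [[|[|[|i]]] lti] //; case: j => [[|[|[|j]]] ltj] //; rewrite !permE.
Qed.

Lemma perm_mat_sig : perm_mat sig = sigma3B.
Proof.
apply/matrixP=> i j; rewrite !mxE invMg !tpermV permM.
by case: i => [[|[|[|i]]] lti] //; case: j => [[|[|[|j]]] ltj] //; rewrite !permE.
Qed.

Let even_gen u : u \in [:: tau; lam; sig] -> u \in ('Alt_('I_4))%g.
Proof. by rewrite Alt_even !inE => /or3P[]/eqP->; rewrite odd_permM !odd_tperm. Qed.

Let H3_gen u : u \in [:: tau; lam; sig] -> H3 (perm_mat u).
Proof.
rewrite !inE => /or3P[]/eqP->; rewrite ?perm_mat_tau ?perm_mat_lam ?perm_mat_sig;
  by apply: mxgen_gen; rewrite !inE eqxx ?orbT.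
Qed.

Let ord4E (x : 'I_4) : x \in [:: x0; x1; x2; x3].
Proof. by case: x => [[|[|[|[|x]]]] ltx]. Qed.

Let ord4_eq (x : 'I_4) : x != x0 -> x != x3 -> x = x1 \/ x = x2.
Proof.
by have := ord4E x; rewrite !inE => /or4P[]/eqP->; rewrite ?eqxx //; [left | right].
Qed.

(** Besides the identity only a transposition fixes these two points, and it is odd. *)
Let H3_fix2 u : u \in ('Alt_('I_4))%g -> u x3 = x3 -> u x0 = x0 -> H3 (perm_mat u).
Proof.
move=> Au u3 u0; suff -> : u = 1%g by rewrite perm_mat1; apply: mxgen1.
have u_ne x y : x != y -> u x != u y by rewrite (inj_eq perm_inj).
have u12 x : x != x0 -> x != x3 -> u x = x1 \/ u x = x2.
  by move=> /u_ne; rewrite u0 => ne0 /u_ne; rewrite u3; apply: ord4_eq.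
have [u1|u1] := u12 x1 isT isT.
  have [u2|u2] := u12 x2 isT isT; first by have := u_ne x1 x2 isT; rewrite u1 u2.
  by apply/permP=> x; rewrite perm1; have := ord4E x; rewrite !inE => /or4P[]/eqP->.
have [u2|u2] := u12 x2 isT isT; last by have := u_ne x1 x2 isT; rewrite u1 u2.
have def_u : u = tperm x1 x2.
  by apply/permP=> x; have := ord4E x; rewrite !inE => /or4P[]/eqP->; rewrite permE.
by move: Au; rewrite Alt_even def_u odd_tperm.
Qed.

(* H3 (perm_mat u) only has to be proved for some u v with v in the group
   generated by tau, lam, sig. *)
Let H3_step u v : v \in [:: tau; lam; sig] -> u \in ('Alt_('I_4))%g ->
  ((u * v)%g \in ('Alt_('I_4))%g -> H3 (perm_mat (u * v)%g)) -> H3 (perm_mat u).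
Proof.
move=> sv Au Huv; rewrite -(mulgK v u) perm_matM -perm_matV.
by apply: mxgenM; [apply/Huv/groupM/even_gen | apply/mxgenV/H3_gen].
Qed.

Let tauI : tau \in [:: tau; lam; sig]. Proof. by rewrite !inE eqxx. Qed.
Let lamI : lam \in [:: tau; lam; sig]. Proof. by rewrite !inE eqxx orbT. Qed.
Let sigI : sig \in [:: tau; lam; sig]. Proof. by rewrite !inE eqxx !orbT. Qed.

Let sigE : (sig x0 = x2) * (sig x2 = x1) * (sig x1 = x0) * (sig x3 = x3).
Proof. by rewrite /sig !permM !permE. Qed.
Let tauE : (tau x0 = x1) * (tau x1 = x0) * (tau x2 = x3) * (tau x3 = x2).
Proof. by rewrite /tau !permM !permE. Qed.
Let lamE : (lam x0 = x2) * (lam x2 = x0) * (lam x1 = x3) * (lam x3 = x1).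
Proof. by rewrite /lam !permM !permE. Qed.

Let H3_fix1 u : u \in ('Alt_('I_4))%g -> u x3 = x3 -> H3 (perm_mat u).
Proof.
have H1 w : w \in ('Alt_('I_4))%g -> w x3 = x3 -> w x0 = x1 -> H3 (perm_mat w).
  move=> Aw w3 w0; apply: H3_step sigI Aw _ => Aws; apply: H3_fix2 => //.
    by rewrite permM w3 ?sigE.
  by rewrite permM w0 ?sigE.
move=> Au u3; have := ord4E (u x0); rewrite !inE => /or4P[]/eqP u0.
- exact: H3_fix2.
- exact: H1.
- apply: H3_step sigI Au _ => Aus; apply: H1 => //.
    by rewrite permM u3 ?sigE.
  by rewrite permM u0 ?sigE.
- by have /perm_inj : u x0 = u x3 by rewrite u0 u3.
Qed.

(** The group generated by tau and lam is transitive and brings u x3 back to x3; then sig, which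
    permutes the other three points cyclically, brings the image of x0 back. *)
Lemma Alt4_H3 u : u \in ('Alt_('I_4))%g -> H3 (perm_mat u).
Proof.
move=> Au; have := ord4E (u x3); rewrite !inE => /or4P[]/eqP u3.
- apply: H3_step tauI Au _ => Aut; apply: H3_step lamI Aut _ => Autl; apply: H3_fix1 => //.
  by rewrite permM (permM u tau) u3 tauE lamE.
- apply: H3_step lamI Au _ => Aul; apply: H3_fix1 => //.
  by rewrite permM u3 ?tauE ?lamE.
- apply: H3_step tauI Au _ => Aut; apply: H3_fix1 => //.
  by rewrite permM u3 ?tauE ?lamE.
- exact: H3_fix1.
Qed.

Lemma H3_Alt4 M : H3 M -> exists2 u, u \in ('Alt_('I_4))%g & perm_mat u = M.
Proof.
elim=> [|N|N N' _ [u Au <-] _ [v Av <-]|N _ [u Au <-]].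
- by exists 1%g; rewrite ?group1 ?perm_mat1.
- rewrite !inE => /or3P[]/eqP->; [exists tau | exists lam | exists sig];
    by rewrite ?perm_mat_tau ?perm_mat_lam ?perm_mat_sig ?even_gen.
- by exists (u * v)%g; rewrite ?groupM ?perm_matM.
- by exists (u^-1)%g; rewrite ?groupV ?perm_matV.
Qed.

End AlternatingGroup.

Lemma H3_isog_Alt4 : isog_Alt4 H3.
Proof.
exists perm_mat; split=> [u v _ _ | u v _ _ | M]; first exact: perm_mat_inj.
  exact: perm_matM.
by split=> [/H3_Alt4 // | [u Au <-]]; apply: Alt4_H3.
Qed.

(** * The invariants of H *)

Lemma fracE (R : idomainType) (f : {fraction R}) :
  exists a b : R, b != 0 /\ f = tofrac a / tofrac b.
Proof.
pose x : {ratio R} := generic_quotient.repr f; exists \n_x, \d_x; split; first exact: denom_ratioP.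
have nzd : tofrac \d_x != 0 by rewrite tofrac_eq0 denom_ratioP.
apply: (mulIf nzd); rewrite divfK // -[f](generic_quotient.reprK) -/x; unlock FracField.tofrac.
rewrite -[LHS]FracField.pi_mul; apply/generic_quotient.eqmodP; rewrite /= FracField.equivfE /FracField.mulf.
by rewrite !numden_Ratio ?(oner_neq0, mulf_neq0, denom_ratioP, mulr1) // mulrC.
Qed.

HB.instance Definition _ (K : fieldType) n :=
  GRing.RMorphism.copy (@cst K n) (@FracField.tofrac {mpoly K[n]} \o @mpolyC n K).

HB.instance Definition _ (k : fieldType) (K : fieldExtType k) n :=
  GRing.RMorphism.copy (@bcst k K n) (@cst K n \o in_alg K).

Section RationalFunctions.
Variables (K : fieldType) (n : nat).

Lemma mmap_var (p : {mpoly K[n]}) : mmap (@cst K n) (@var K n) p = tofrac p.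
Proof.
pose f : {rmorphism {mpoly K[n]} -> ratfun K n} := mmap (@cst K n) (@var K n).
apply: (@mpoly_rmorph_eq _ _ _ f (@FracField.tofrac _)) => [c|i]; rewrite /f /=.
  by rewrite mmapC.
by rewrite mmapX mmap1U.
Qed.

Lemma ratfun_gen f : adjoin (@cst K n) (codom (@var K n)) f.
Proof.
have [a [b [_ ->]]] := fracE f; rewrite -!mmap_var.
by apply: adjoinM; [| apply: adjoinV]; apply: adjoin_mmap.
Qed.

Lemma var_aindep : aindep (@cst K n) (@var K n).
Proof. by move=> p; rewrite mmap_var => /eqP; rewrite tofrac_eq0 => /eqP. Qed.

End RationalFunctions.

Lemma alg_cst (k : fieldType) (K : fieldExtType k) (F : fieldType)
    (iota : {rmorphism K -> F}) c : alg (iota \o in_alg K) [::] (iota c).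
Proof.
have [/polyOver1P[p Dp] mon_p] := (minPolyOver 1 c, monic_minPoly 1 c).
pose q := map_poly (iota \o in_alg K) p.
have def_q : q = map_poly iota (minPoly 1 c) by rewrite Dp -map_poly_comp.
apply: (@alg_root _ _ _ _ q).
- by rewrite def_q map_poly_eq0 monic_neq0.
- by move=> i; rewrite coef_map; apply: alg_adjoin; apply: adjoin_base.
- by rewrite def_q /root horner_map (rootP (root_minPoly 1 c)) rmorph0.
Qed.

Lemma codom3 (T : Type) (f : 'I_3 -> T) (i0 i1 i2 : 'I_3) :
  val i0 = 0%N -> val i1 = 1%N -> val i2 = 2%N -> codom f = [:: f i0; f i1; f i2].
Proof.
move=> e0 e1 e2; rewrite /codom /image_mem !enum_ordSl enum_ord0 /=.
by do !congr cons; congr f; apply: val_inj; rewrite /= ?e0 ?e1 ?e2.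
Qed.

Lemma big_ord3 (R : pzSemiRingType) (E : 'I_3 -> R) : \prod_(i < 3) E i =
  E (@Ordinal 3 0 isT) * E (@Ordinal 3 1 isT) * E (@Ordinal 3 2 isT).
Proof.
rewrite !big_ord_recl big_ord0 mulr1 mulrA.
by congr (E _ * E _ * E _); apply: val_inj.
Qed.

Definition mon3 (F : fieldType) (x1 x2 x3 : F) (A : 'M[int]_3) (j : 'I_3) : F :=
  x1 ^ (A (@Ordinal 3 0 isT) j) * x2 ^ (A (@Ordinal 3 1 isT) j) * x3 ^ (A (@Ordinal 3 2 isT) j).

(* [setting act G] with K(x1, x2, x3) replaced by an abstract field F, so that
   fractions of polynomials are never unfolded. *)
Record monomial_setting (k : fieldType) (K : fieldExtType k) (F : fieldType)
    (iota : {rmorphism K -> F}) (x1 x2 x3 : F) (G : 'M[int]_3 -> Prop)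
    (act : 'M[int]_3 -> {rmorphism F -> F}) : Prop := MonomialSetting {
  ms_gen : forall f, adjoin iota [:: x1; x2; x3] f;
  ms_free : alg_indep iota [tuple x1; x2; x3];
  ms_G1 : G 1%:M;
  ms_GM : forall A B, G A -> G B -> G (A *m B);
  ms_GV : forall A, G A -> A \in unitmx /\ G (invmx A);
  ms_act1 : forall f, act 1%:M f = f;
  ms_actM : forall A B f, G A -> G B -> act (A *m B) f = act A (act B f);
  ms_bcst : forall A (c : k), G A -> act A (iota c%:A) = iota c%:A;
  ms_cst : forall A c, G A -> exists c', act A (iota c) = iota c';
  ms_fixed : forall c, (forall A, G A -> act A (iota c) = iota c) -> exists c' : k, c = c'%:A;
  ms_ker : forall A, G A /\ (forall c, act A (iota c) = iota c) <-> H3 A;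
  ms_x1 : forall A, G A -> act A x1 = mon3 x1 x2 x3 A (@Ordinal 3 0 isT);
  ms_x2 : forall A, G A -> act A x2 = mon3 x1 x2 x3 A (@Ordinal 3 1 isT);
  ms_x3 : forall A, G A -> act A x3 = mon3 x1 x2 x3 A (@Ordinal 3 2 isT)
}.

Lemma setting_monomial (k : fieldType) (K : fieldExtType k)
    (act : 'M[int]_3 -> {rmorphism ratfun K 3 -> ratfun K 3}) (G : 'M[int]_3 -> Prop) :
  setting act G -> monomial_setting (@cst K 3) (@var K 3 (@Ordinal 3 0 isT))
    (@var K 3 (@Ordinal 3 1 isT)) (@var K 3 (@Ordinal 3 2 isT)) G act.
Proof.
move=> [pqm kerH]; destruct pqm as ([G1 GM GV _] & a1 & aM & ab & ac & fc & av).
have codom_var := @codom3 _ (@var K 3) (@Ordinal 3 0 isT) (@Ordinal 3 1 isT) (@Ordinal 3 2 isT)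
  erefl erefl erefl.
have act_var s j : G s -> act s (var K j) = mon3 (var K (@Ordinal 3 0 isT))
   (var K (@Ordinal 3 1 isT)) (var K (@Ordinal 3 2 isT)) s j.
  by move=> Gs; exact (etrans (av s j Gs) (big_ord3 (fun i => var K i ^ (s i j)))).
split; try assumption.
- by move=> f; rewrite -codom_var; exact: ratfun_gen.
- apply/alg_indepP; rewrite [X in algfree _ (rev X)](esym codom_var).
  exact/aindepP/var_aindep.
- by move=> A GA; exact: act_var.
- by move=> A GA; exact: act_var.
- by move=> A GA; exact: act_var.
Qed.

Lemma eq_adjoin (k F : fieldType) (iota : {rmorphism k -> F}) s t :
  (forall x, x \in s -> adjoin iota t x) -> (forall x, x \in t -> adjoin iota s x) ->
  forall f, adjoin iota s f <-> adjoin iota t f.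
Proof. by move=> st ts f; split; apply: adjoin_trans. Qed.

(* L is the rational function field iota(K)(a, b, c), over which F is algebraic. *)
Definition rational_gens (K F : fieldType) (iota : {rmorphism K -> F}) (L : F -> Prop) a b c :=
  [/\ alg_indep iota [tuple a; b; c], forall f, L f <-> adjoin iota [:: a; b; c] f
    & forall f, alg iota [:: a; b; c] f].

Lemma mulmx_beta3 : beta3 *m beta3 = 1%:M.
Proof.
apply/matrixP => i j; rewrite !mxE !big_ord_recl big_ord0 !mxE /=.
by case: i j => [[|[|[|]]]] //= ? [[|[|[|]]]] //= ?; rewrite !mxE.
Qed.

Section Generators.
Variables (k : fieldType) (K : fieldExtType k) (F : fieldType) (iota : {rmorphism K -> F}).
Variables (x1 x2 x3 : F) (G : 'M[int]_3 -> Prop) (act : 'M[int]_3 -> {rmorphism F -> F}).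
Hypothesis ms : monomial_setting iota x1 x2 x3 G act.
Hypothesis nz2 : 2 != 0 :> K.

Let free := ms_free ms.
Let x4 : F := (x1 * x2 * x3)^-1.
Let y1 := yf x1 x2 x3 x4.
Let y2 := yf x1 x3 x2 x4.
Let y3 := yf x1 x4 x2 x3.
(** By [yfV], inverting the x_i sends y1 to (y2 + y3 - y1) / (y2 y3). With these half-sums y1 = a2 +
    a3, and -I3 becomes a1 -> 2 a2 a3 / P for P = y1 y2 y3: inversion of the a_i up to a common
    factor. *)
Let a1 : F := (y2 + y3 - y1) / 2.
Let a2 : F := (y1 + y3 - y2) / 2.
Let a3 : F := (y1 + y2 - y3) / 2.
Let u := uf a1 a2 a3.
Let v := uf a1 a3 a2.
Let g := gf a1 a2 a3.

Let nz2F : 2 != 0 :> F.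
Proof. by rewrite -(rmorph_nat iota) fmorph_eq0. Qed.
Let nzx1 : x1 != 0. Proof. by neq0_by nz2 free x1 x2 x3 1%N 10%N 50%N. Qed.
Let nzx2 : x2 != 0. Proof. by neq0_by nz2 free x1 x2 x3 1%N 10%N 50%N. Qed.
Let nzx3 : x3 != 0. Proof. by neq0_by nz2 free x1 x2 x3 1%N 10%N 50%N. Qed.

Let x1234 : x1 * x2 * x3 * x4 = 1.
Proof. exact: (mulfV (mulf_neq0 (mulf_neq0 nzx1 nzx2) nzx3)). Qed.

Let actI A f : G A -> A *m A = 1%:M -> act A (act A f) = f.
Proof. by move=> GA AA; rewrite -(ms_actM ms) // AA (ms_act1 ms). Qed.

Lemma fixed_mxgen s f : (forall A, A \in s -> G A) -> (forall A, A \in s -> act A f = f) ->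
  forall A, mxgen s A -> act A f = f.
Proof.
move=> sG sf A sA; suff [] : G A /\ act A f = f by [].
elim: sA => {A} [|A sA|A B _ [GA fA] _ [GB fB]|A _ [GA fA]].
- by split; [apply: (ms_G1 ms) | apply: (ms_act1 ms)].
- by split; [apply: sG | apply: sf].
- by split; [apply: (ms_GM ms) | rewrite (ms_actM ms) // fB].
have [UA GiA] := ms_GV ms GA; split=> //.
by rewrite -{1}fA -(ms_actM ms) // mulVmx // (ms_act1 ms).
Qed.

Lemma H_in_G A : H3 A -> G A.
Proof. by move/(ms_ker ms) => []. Qed.

Lemma H_cst A c : H3 A -> act A (iota c) = iota c.
Proof. by move/(ms_ker ms) => []. Qed.

Let Htau : H3 tau3. Proof. by apply: mxgen_gen; rewrite !inE eqxx. Qed.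
Let Hlam : H3 lambda3. Proof. by apply: mxgen_gen; rewrite !inE eqxx orbT. Qed.
Let Hsig : H3 sigma3B. Proof. by apply: mxgen_gen; rewrite !inE eqxx !orbT. Qed.

Let inv3 : x1^-1 * x2^-1 * x3^-1 = x4.
Proof. by rewrite /x4 !invfM. Qed.

Ltac act_entries := rewrite /mon3 !mxE /= ?(expr0z, expr1z, exprN1) ?(mul1r, mulr1) ?inv3 //.

Let rmorph_x4 (phi : {rmorphism F -> F}) : phi x4 = (phi x1 * phi x2 * phi x3)^-1.
Proof. by rewrite fmorphV !rmorphM. Qed.

Let tau_x : [/\ act tau3 x1 = x2, act tau3 x2 = x1, act tau3 x3 = x4 & act tau3 x4 = x3].
Proof.
have Gt := H_in_G Htau.
have e1 : act tau3 x1 = x2 by rewrite (ms_x1 ms Gt); act_entries.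
have e2 : act tau3 x2 = x1 by rewrite (ms_x2 ms Gt); act_entries.
have e3 : act tau3 x3 = x4 by rewrite (ms_x3 ms Gt); act_entries.
split=> //; rewrite rmorph_x4 e1 e2 e3 /x4.
by field; rewrite nzx1 nzx2 nzx3 ?oner_neq0.
Qed.

Let lam_x : [/\ act lambda3 x1 = x3, act lambda3 x2 = x4, act lambda3 x3 = x1 & act lambda3 x4 = x2].
Proof.
have Gt := H_in_G Hlam.
have e1 : act lambda3 x1 = x3 by rewrite (ms_x1 ms Gt); act_entries.
have e2 : act lambda3 x2 = x4 by rewrite (ms_x2 ms Gt); act_entries.
have e3 : act lambda3 x3 = x1 by rewrite (ms_x3 ms Gt); act_entries.
split=> //; rewrite rmorph_x4 e1 e2 e3 /x4.
by field; rewrite nzx1 nzx2 nzx3 ?oner_neq0.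
Qed.

Let sig_x : [/\ act sigma3B x1 = x2, act sigma3B x2 = x3, act sigma3B x3 = x1 & act sigma3B x4 = x4].
Proof.
have Gt := H_in_G Hsig.
have e1 : act sigma3B x1 = x2 by rewrite (ms_x1 ms Gt); act_entries.
have e2 : act sigma3B x2 = x3 by rewrite (ms_x2 ms Gt); act_entries.
have e3 : act sigma3B x3 = x1 by rewrite (ms_x3 ms Gt); act_entries.
split=> //; rewrite rmorph_x4 e1 e2 e3.
by congr (_^-1); ring.
Qed.

Let iota_x : G (- I3) -> [/\ act (- I3) x1 = x1^-1, act (- I3) x2 = x2^-1,
  act (- I3) x3 = x3^-1 & act (- I3) x4 = x4^-1].
Proof.
move=> GI.
have e1 : act (- I3) x1 = x1^-1 by rewrite (ms_x1 ms GI); act_entries.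
have e2 : act (- I3) x2 = x2^-1 by rewrite (ms_x2 ms GI); act_entries.
have e3 : act (- I3) x3 = x3^-1 by rewrite (ms_x3 ms GI); act_entries.
by split=> //; rewrite rmorph_x4 e1 e2 e3 /x4 !invfM.
Qed.

Let beta_x : G beta3 -> [/\ act beta3 x1 = x1, act beta3 x2 = x2, act beta3 x3 = x4 & act beta3 x4 = x3].
Proof.
move=> GB.
have e1 : act beta3 x1 = x1 by rewrite (ms_x1 ms GB); act_entries.
have e2 : act beta3 x2 = x2 by rewrite (ms_x2 ms GB); act_entries.
have e3 : act beta3 x3 = x4 by rewrite (ms_x3 ms GB); act_entries.
split=> //; rewrite rmorph_x4 e1 e2 e3 /x4.
by field; rewrite nzx1 nzx2 nzx3 ?oner_neq0.
Qed.

Let gamma_x : G (- beta3) -> [/\ act (- beta3) x1 = x1^-1, act (- beta3) x2 = x2^-1,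
  act (- beta3) x3 = x4^-1 & act (- beta3) x4 = x3^-1].
Proof.
move=> GB.
have e1 : act (- beta3) x1 = x1^-1 by rewrite (ms_x1 ms GB); act_entries.
have e2 : act (- beta3) x2 = x2^-1 by rewrite (ms_x2 ms GB); act_entries.
have e3 : act (- beta3) x3 = x4^-1 by rewrite (ms_x3 ms GB) /x4 invrK; act_entries.
split=> //; rewrite rmorph_x4 e1 e2 e3 /x4.
by field; rewrite nzx1 nzx2 nzx3 ?oner_neq0.
Qed.

Let sig_y : [/\ act sigma3B y1 = y3, act sigma3B y3 = y2 & act sigma3B y2 = y1].
Proof.
have [e1 e2 e3 e4] := sig_x.
rewrite /y1 /y2 /y3 !rmorph_yf e1 e2 e3 e4; split.
- by rewrite yf_swap yfC yfCr.
- by rewrite yf_swap yfC yfCr yf_swap yf_swap.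
- by rewrite yfC.
Qed.


Let sig_a : [/\ act sigma3B a1 = a3, act sigma3B a3 = a2 & act sigma3B a2 = a1].
Proof.
have [e1 e3 e2] := sig_y; rewrite /a1 /a2 /a3 !fmorph_div !(rmorphB, rmorphD) e1 e2 e3 rmorph1.
by split; congr (_ / _); ring.
Qed.

Let y1E : y1 = a2 + a3. Proof. by rewrite /a2 /a3; field. Qed.
Let y2E : y2 = a1 + a3. Proof. by rewrite /a1 /a3; field. Qed.
Let y3E : y3 = a1 + a2. Proof. by rewrite /a1 /a2; field. Qed.

Let y_in_a x : x \in [:: y1; y2; y3] -> adjoin iota [:: a1; a2; a3] x.
Proof.
have s1 : adjoin iota [:: a1; a2; a3] a1 by in_adj.
have s2 : adjoin iota [:: a1; a2; a3] a2 by in_adj.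
have s3 : adjoin iota [:: a1; a2; a3] a3 by in_adj.
by rewrite !inE => /or3P[]/eqP->; rewrite ?y1E ?y2E ?y3E; apply: adjoinD.
Qed.

Let a_alg f : alg iota [:: a1; a2; a3] f.
Proof.
apply: (@alg_trans _ _ _ [:: y1; y2; y3]); last exact: (y_alg nz2 x1234 free (ms_gen ms)).
by move=> x /y_in_a; apply: alg_adjoin.
Qed.

Let a_free : alg_indep iota [tuple a1; a2; a3].
Proof. by apply: (alg_indep_span free) => x _; apply: a_alg. Qed.

Let uvg_alg_all f : alg iota [:: u; v; g] f.
Proof. exact: (uvg_alg nz2 a_free (a_alg f)). Qed.

Let uvgF : alg_indep iota [tuple u; v; g] := uvg_free nz2 a_free.

Let uvg_fixed f : (forall A, H3 A -> act A f = f) <-> adjoin iota [:: u; v; g] f.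
Proof.
have [t1 t2 t3 t4] := tau_x; have [l1 l2 l3 l4] := lam_x; have [s1 s3 s2] := sig_a.
split=> [Hf | ].
  apply: (cyclic_descent nz2 a_free (fun c => H_cst c Hsig) s1 s3 s2); last exact: Hf.
  apply: adjoin_trans y_in_a _ _.
  by apply: (klein_descent nz2 x1234 free (ms_gen ms) (fun c => H_cst c Htau)
    (fun c => H_cst c Hlam)) => //; apply: Hf.
have [ty1 ty2 ty3] := tau_y t1 t2 t3 t4; have [ly1 ly2 ly3] := lam_y l1 l2 l3 l4.
have fix_a (A : 'M[int]_3) : act A y1 = y1 -> act A y2 = y2 -> act A y3 = y3 ->
    [/\ act A u = u, act A v = v & act A g = g].
  move=> e1 e2 e3; rewrite /u /v /g !rmorph_uf rmorph_gf /a1 /a2 /a3.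
  by rewrite !fmorph_div !(rmorphB, rmorphD) e1 e2 e3 rmorph1.
have [tu tv tg] := fix_a _ ty1 ty2 ty3; have [lu lv lg] := fix_a _ ly1 ly2 ly3.
have [su sv sg] := sigma_uvg s1 s3 s2.
move=> sf A HA; move: f sf; apply: adjoin_fixed => [c|f sf]; first exact: H_cst.
move: A HA; apply: fixed_mxgen => A; rewrite !inE => /or3P[]/eqP-> //;
  by [apply: H_in_G | move: sf; rewrite !inE => /or3P[]/eqP->].
Qed.

Let P : F := y1 * y2 * y3.

Let y_freeF : alg_indep iota [tuple y1; y2; y3].
Proof. exact: (y_free nz2 x1234 free (ms_gen ms)). Qed.

Let nzy1 : y1 != 0. Proof. by neq0_by nz2 y_freeF y1 y2 y3 1%N 10%N 50%N. Qed.
Let nzy2 : y2 != 0. Proof. by neq0_by nz2 y_freeF y1 y2 y3 1%N 10%N 50%N. Qed.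
Let nzy3 : y3 != 0. Proof. by neq0_by nz2 y_freeF y1 y2 y3 1%N 10%N 50%N. Qed.

Let nzP : P != 0.
Proof. exact: (mulf_neq0 (mulf_neq0 nzy1 nzy2) nzy3). Qed.

Let defP : P = qf u v * rf u v g / (u * v) ^+ 2.
Proof.
have nzu : u != 0 by neq0_by nz2 uvgF u v g 1%N 10%N 50%N.
have nzv : v != 0 by neq0_by nz2 uvgF u v g 1%N 10%N 50%N.
have := uvg_e3 nz2 a_free; have := uvg_e2 nz2 a_free; have := uvg_e1 nz2 a_free.
rewrite -/u -/v -/g => E1 E2 E3.
have -> : P = (a1 + a2 + a3) * (a1 * a2 + a2 * a3 + a3 * a1) - a1 * a2 * a3.
  by rewrite /P y1E y2E y3E; ring.
rewrite E3 E2 E1 /rf /qf; move: u v g nzu nzv => u' v' g' nzu nzv.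
by field; rewrite nzu nzv.
Qed.

Let inv_y : [/\ yf x1^-1 x2^-1 x3^-1 x4^-1 = 2 * a1 / (y2 * y3),
  yf x1^-1 x3^-1 x2^-1 x4^-1 = 2 * a2 / (y1 * y3)
  & yf x1^-1 x4^-1 x2^-1 x3^-1 = 2 * a3 / (y1 * y2)].
Proof.
have nA1 := A1_neq0 nz2 x1234 free; have nA2 := A2_neq0 nz2 x1234 free.
have nA3 := A3_neq0 nz2 x1234 free; have nD1 := D1_neq0 nz2 x1234 free.
have nD2 := D2_neq0 nz2 x1234 free; have nD3 := D3_neq0 nz2 x1234 free.
have half (a b : F) : a / b = 2 * (a / 2) / b by rewrite [2 * _]mulrC divfK.
split; rewrite yfV //.
- by rewrite [yf x1 x4 x3 x2]yfCr; apply: half.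
- by rewrite -x1234; ring.
- by rewrite [x3 * x2]mulrC.
- by rewrite [x1 + x4 - x3 - x2]addrAC.
- by rewrite [yf x1 x2 x4 x3]yfCr [yf x1 x3 x4 x2]yfCr; apply: half.
- by rewrite -x1234; ring.
- by rewrite [x4 * x3]mulrC.
- by rewrite [x4 * x2]mulrC.
- by rewrite [x1 + x2 - x4 - x3]addrAC.
- by rewrite [x1 + x3 - x4 - x2]addrAC.
Qed.

Let inv_a : [/\ (2 * a2 / (y1 * y3) + 2 * a3 / (y1 * y2) - 2 * a1 / (y2 * y3)) / 2 = 2 * a2 * a3 / P,
  (2 * a1 / (y2 * y3) + 2 * a3 / (y1 * y2) - 2 * a2 / (y1 * y3)) / 2 = 2 * a3 * a1 / P
  & (2 * a1 / (y2 * y3) + 2 * a2 / (y1 * y3) - 2 * a3 / (y1 * y2)) / 2 = 2 * a1 * a2 / P].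
Proof.
move: nzy1 nzy2 nzy3; rewrite /P y1E y2E y3E => n1 n2 n3.
by split; field; rewrite nz2F n1 n2 n3.
Qed.

Let inv_uvg : [/\ uf (2 * a2 * a3 / P) (2 * a3 * a1 / P) (2 * a1 * a2 / P) = 2 * g * v / P,
  uf (2 * a2 * a3 / P) (2 * a1 * a2 / P) (2 * a3 * a1 / P) = 2 * g * u / P &
  gf (2 * a2 * a3 / P) (2 * a3 * a1 / P) (2 * a1 * a2 / P) = 2 * qf u v / P].
Proof.
have nza : a1 * a2 * a3 != 0 by neq0_by nz2 a_free a1 a2 a3 1%N 10%N 50%N.
have nzn0 := n0_neq0 nz2 a_free; have nzn2 := n2_neq0 nz2 a_free.
split; [exact: uf_inv | | exact: gf_inv].
(* The second formula is [uf_inv] for a1, a3, a2: this odd permutation exchanges u and v and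
   preserves g. *)
rewrite [X in uf X](_ : _ = 2 * a3 * a2 / P); last by congr (_ / _); ring.
rewrite [2 * a1 * a2](_ : _ = 2 * a2 * a1); last by ring.
rewrite [2 * a3 * a1](_ : _ = 2 * a1 * a3); last by ring.
have nza' : a1 * a3 * a2 != 0 by rewrite mulrAC.
have nzn0' : (a1 + a3 + a2) ^+ 2 - 3 * (a1 * a3 + a3 * a2 + a2 * a1) != 0.
  by apply: contraNneq nzn0 => <-; apply/eqP; ring.
have nzn2' : (a1 * a3 + a3 * a2 + a2 * a1) ^+ 2 - 3 * (a1 + a3 + a2) * (a1 * a3 * a2) != 0.
  by apply: contraNneq nzn2 => <-; apply/eqP; ring.
by rewrite (uf_inv nz2F nzn0' nzn2' nzP) gf_swap.
Qed.

Let iota_uvg : G (- I3) -> [/\ act (- I3) u = 2 * g * v / P, act (- I3) v = 2 * g * u / P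
  & act (- I3) g = 2 * qf u v / P].
Proof.
move=> GI; have [e1 e2 e3 e4] := iota_x GI; have [i1 i2 i3] := inv_y; have [j1 j2 j3] := inv_a.
have [f1 f2 f3] : [/\ act (- I3) a1 = 2 * a2 * a3 / P, act (- I3) a2 = 2 * a3 * a1 / P
  & act (- I3) a3 = 2 * a1 * a2 / P].
  rewrite -j1 -j2 -j3 {1}/a1 {1}/a2 {1}/a3 !fmorph_div !(rmorphB, rmorphD) /y1 /y2 /y3 !rmorph_yf.
  by rewrite e1 e2 e3 e4 i1 i2 i3 rmorph1.
by rewrite {1}/u {1}/v {1}/g !rmorph_uf rmorph_gf f1 f2 f3; exact: inv_uvg.
Qed.

Let beta_uvg : G beta3 -> [/\ act beta3 u = v, act beta3 v = u & act beta3 g = g].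
Proof.
move=> GB; have [e1 e2 e3 e4] := beta_x GB.
have [f1 f2 f3] : [/\ act beta3 a1 = a1, act beta3 a2 = a3 & act beta3 a3 = a2].
  rewrite /a1 /a2 /a3 !fmorph_div !(rmorphB, rmorphD) /y1 /y2 /y3 !rmorph_yf.
  rewrite e1 e2 e3 e4 rmorph1 [yf x1 x2 x4 x3]yfCr.
  by split; congr (_ / _); ring.
by rewrite /u /v /g !rmorph_uf rmorph_gf f1 f2 f3 gf_swap.
Qed.

(** The exchange of u and v by beta3 undoes the one in [iota_uvg]. As beta3 and -I3 need not lie in
    G, the formulas are computed directly rather than by composition. *)
Let gamma_uvg : G (- beta3) -> [/\ act (- beta3) u = 2 * g * u / P, act (- beta3) v = 2 * g * v / P
  & act (- beta3) g = 2 * qf u v / P].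
Proof.
move=> GB; have [e1 e2 e3 e4] := gamma_x GB; have [i1 i2 i3] := inv_y; have [j1 j2 j3] := inv_a.
have [f1 f2 f3] : [/\ act (- beta3) a1 = 2 * a2 * a3 / P, act (- beta3) a2 = 2 * a1 * a2 / P
  & act (- beta3) a3 = 2 * a3 * a1 / P].
  rewrite -j1 -j2 -j3 {1}/a1 {1}/a2 {1}/a3 !fmorph_div !(rmorphB, rmorphD) /y1 /y2 /y3 !rmorph_yf.
  rewrite e1 e2 e3 e4 [yf x1^-1 x2^-1 x4^-1 x3^-1]yfCr i1 i2 i3 rmorph1.
  by split=> //; congr ((_ - _) / _); rewrite addrC.
have [h1 h2 h3] := inv_uvg.
by rewrite {1}/u {1}/v {1}/g !rmorph_uf rmorph_gf f1 f2 f3 h2 h1 [gf (_ / P) _ _]gf_swap h3.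
Qed.

Let t : F := th u v g.
Let t' : F := ths u v g.
Let p : F := psi u v g.

Let t_alg f : alg iota [:: t; t'; p] f.
Proof.
apply: (@alg_trans _ _ _ [:: u; v; g]) (uvg_alg_all f) => x xs.
exact/alg_adjoin/(uvg_in_th nz2 uvgF).
Qed.

Let t_free : alg_indep iota [tuple t; t'; p].
Proof. by apply: (alg_indep_span free) => x _; apply: t_alg. Qed.

Let t_fixed f : (forall A, H3 A -> act A f = f) <-> adjoin iota [:: t; t'; p] f.
Proof.
apply: (iff_trans (uvg_fixed f)); apply: eq_adjoin; first exact: (uvg_in_th nz2 uvgF).
exact: th_in_uvg.
Qed.

Let nzt : t != 0. Proof. by neq0_by nz2 t_free t t' p 1%N 10%N 50%N. Qed.
Let nzp : p != 0. Proof. by neq0_by nz2 t_free t t' p 1%N 10%N 50%N. Qed.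

Definition linear_gens (phi : {rmorphism F -> F}) A B C :=
  rational_gens iota (fun f => forall M, H3 M -> act M f = f) A B C /\
  [/\ phi A = A, phi B = - B & phi C = - C].

Let linear_of (phi : {rmorphism F -> F}) s s' r r' :
  r * r' = s * s' - 1 -> phi s = s' -> phi s' = s -> phi r = r' -> phi r' = r ->
  (forall x, x \in [:: s; s'; r; r'] -> adjoin iota [:: t; t'; p] x) ->
  (forall x, x \in [:: t; t'; p] -> adjoin iota [:: s; s'; r; r'] x) ->
  linA s s' r r' != 0 ->
  linear_gens phi (linA s s' r r') (linB s s' r r') (linC s s' r r').
Proof.
move=> rr' e1 e2 e3 e4 st ts nzA; set A := linA _ _ _ _; set B := linB _ _ _ _; set C := linC _ _ _ _.
have AtP : forall f, adjoin iota [:: A; B; C] f <-> adjoin iota [:: t; t'; p] f.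
  apply: eq_adjoin => x; first exact: (lin_mem st).
  move/ts; apply: adjoin_trans => y ys. exact: (mem_lin iota nz2F rr' nzA ys).

have Aalg f : alg iota [:: A; B; C] f.
  apply: (@alg_trans _ _ _ [:: t; t'; p]) (t_alg f) => x xs.
  by apply/alg_adjoin/AtP/adjoin_gen.
split; last exact: lin_conj.
split=> //; first by apply: (alg_indep_span free) => x _; apply: Aalg.
by move=> f; apply: (iff_trans (t_fixed f)); apply: iff_sym; apply: AtP.
Qed.

Lemma linear_iota : G (- I3) -> exists A B C, linear_gens (act (- I3)) A B C
  /\ (G beta3 -> [/\ act beta3 A = - A, act beta3 B = - B & act beta3 C = - C]).
Proof.
move=> GI; have [e1 e2 e3] := iota_uvg GI.
have II : - I3 *m - I3 = 1%:M by rewrite mulNmx mulmxN opprK mulmx1.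
have et : act (- I3) t = t' := iota_th nz2 uvgF defP e1 e2 e3.
have et' : act (- I3) t' = t by rewrite -et actI.
have ep : p * act (- I3) p = t * t' - 1 := iota_psi nz2 uvgF defP e1 e2 e3.
have ep' : act (- I3) (act (- I3) p) = p by rewrite actI.
have [p' def_p'] : exists p', act (- I3) p = p' by exists (act (- I3) p).
rewrite def_p' in ep ep'.
exists (linA t t' p p'), (linB t t' p p'), (linC t t' p p'); split.
  have p'E : p' = (t * t' - 1) / p by rewrite -ep mulrC mulKf.
  have st : adjoin iota [:: t; t'; p] t by in_adj.
  have st' : adjoin iota [:: t; t'; p] t' by in_adj.
  have sp : adjoin iota [:: t; t'; p] p by in_adj.
  apply: linear_of => //.
  - by move=> x; rewrite !inE => /or4P[]/eqP-> //; rewrite p'E; in_adj.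
  - by move=> x xs; apply: adjoin_gen; move: xs; rewrite !inE => /or3P[]->; rewrite ?orbT.
  have -> : linA t t' p p' = (p * t + p * t' - p ^+ 2 - t * t' + 1) / (2 * p).
    by rewrite /linA p'E; move: nzp => nzp'; field; rewrite nzp' nz2F.
  apply: mulf_neq0; last by rewrite invr_eq0; apply: mulf_neq0.
  by neq0_by nz2 t_free t t' p 1%N 10%N 50%N.
move=> GB; have [b1 b2 b3] := beta_uvg GB.
have bp : act beta3 p = - p := beta_psi nz2 uvgF b1 b2 b3.
apply: lin_odd => //.
- exact: (beta_th nz2 uvgF b1 b2 b3).
- exact: (beta_ths nz2 uvgF b1 b2 b3).
(* p' is the image of p under -I3, which commutes with beta3. *)
rewrite -def_p' -(ms_actM ms) // mulmxN mulmx1.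
have -> : - beta3 = - I3 *m beta3 by rewrite mulNmx mul1mx.
by rewrite (ms_actM ms) // bp rmorphN.
Qed.

Lemma linear_gamma : G (- beta3) -> exists A B C, linear_gens (act (- beta3)) A B C.
Proof.
move=> GB; have [e1 e2 e3] := gamma_uvg GB.
have BB : - beta3 *m - beta3 = 1%:M by rewrite mulNmx mulmxN opprK mulmx_beta3.
have et : act (- beta3) t = - t' := gamma_th nz2 uvgF defP e1 e2 e3.
have et' : act (- beta3) (- t') = t by rewrite -et actI.
have ep : p * act (- beta3) p = 1 - t * t' := gamma_psi nz2 uvgF defP e1 e2 e3.
have ep' : act (- beta3) (act (- beta3) p) = p by rewrite actI.
have [p' def_p'] : exists p', act (- beta3) p = p' by exists (act (- beta3) p).
rewrite def_p' in ep ep'.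
(* Here t is sent to - t' and p p' = 1 - t t', so the two pairs change roles: t (- t') = p p' - 1 is
   the relation required by [linear_of]. *)
exists (linA p p' t (- t')), (linB p p' t (- t')), (linC p p' t (- t')).
have p'E : p' = (1 - t * t') / p by rewrite -ep mulrC mulKf.
have st : adjoin iota [:: t; t'; p] t by in_adj.
have st' : adjoin iota [:: t; t'; p] t' by in_adj.
have sp : adjoin iota [:: t; t'; p] p by in_adj.
apply: linear_of => //.
- by rewrite ep; ring.
- by move=> x; rewrite !inE => /or4P[]/eqP-> //; rewrite ?p'E; in_adj.
- move=> x; rewrite !inE => /or3P[]/eqP->; first by in_adj.
    by rewrite -[X in adjoin _ _ X]opprK; apply: adjoinN; apply: adjoin_gen; rewrite !inE eqxx !orbT.
  by in_adj.
have -> : linA p p' t (- t') = (p ^+ 2 + 1 - t * t' - p * t + p * t') / (2 * p).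
  by rewrite /linA p'E; move: nzp => nzp'; field; rewrite nzp' nz2F.
apply: mulf_neq0; last by rewrite invr_eq0; apply: mulf_neq0.
by neq0_by nz2 t_free t t' p 1%N 10%N 50%N.
Qed.

End Generators.

Section Models.
Variables (K F : fieldType) (iota : {rmorphism K -> F}) (L : F -> Prop).
Hypothesis nz2 : 2 != 0 :> K.

Lemma rational_gens_eq a b c a' b' c' : rational_gens iota L a b c ->
  (forall x, x \in [:: a; b; c] -> adjoin iota [:: a'; b'; c'] x) ->
  (forall x, x \in [:: a'; b'; c'] -> adjoin iota [:: a; b; c] x) ->
  rational_gens iota L a' b' c'.
Proof.
case=> free defL algF st ts.
have algF' f : alg iota [:: a'; b'; c'] f.
  by apply: alg_trans (algF f) => x /st; apply: alg_adjoin.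
split=> // [|f]; first by apply: (alg_indep_span free) => x _; apply: algF'.
by apply: (iff_trans (defL f)); apply: eq_adjoin.
Qed.

Section Sextic.
Variables A B C : F.
Hypothesis gensA : rational_gens iota L A B C.
Let free : alg_indep iota [tuple A; B; C]. Proof. by case: gensA. Qed.
Let a := nm_t A B C.
Let b := nm_t' A B C.
Let c := nm_phi A B C.
Let p := cr_p a b.
Let q := cr_q a b.

Let gens_nm : rational_gens iota L a b c.
Proof.
apply: (rational_gens_eq gensA) => x; first exact: (ABC_in_nm nz2 free).
exact: (nm_in_ABC iota).
Qed.

Let free_nm : alg_indep iota [tuple a; b; c]. Proof. by case: gens_nm. Qed.

Let gens_cr : rational_gens iota L p q c.
Proof.
apply: (rational_gens_eq gens_nm) => x; first exact: (ab_in_cr nz2 free_nm).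
exact: (cr_in_ab iota).
Qed.

Let free_cr : alg_indep iota [tuple p; q; c]. Proof. by case: gens_cr. Qed.

Let norm_c (phi : {rmorphism F -> F}) : phi A = A -> phi B = - B -> phi C = - C ->
  [/\ phi p = - q, phi q = - p & c * phi c = 1 +
     (q * (p ^+ 2 + 1) - 2 * p) / (p ^+ 2 + 2 * p * q - 3) *
     ((p * (q ^+ 2 + 1) - 2 * q) / (q ^+ 2 + 2 * p * q - 3))].
Proof.
move=> e1 e2 e3; have [ea eb ec] := nm_iota e1 e2 e3.
have [ep eq] := cr_iota nz2 free_nm ea eb; split=> //.
by rewrite -(cr_a nz2 free_nm) -(cr_b nz2 free_nm) ec (nm_norm nz2 free).
Qed.

Lemma w_model (phi : {rmorphism F -> F}) : phi A = A -> phi B = - B -> phi C = - C ->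
  exists w1 w2 w3, rational_gens iota L w1 w2 w3 /\
    [/\ phi w1 = w1, phi w2 = - w2
      & phi w3 = (w1 * (1 + w1 + w1 ^+ 2) ^+ 2
           - (2 + 3 * w1 + 4 * w1 ^+ 2 + 2 * w1 ^+ 3) * w2 ^+ 2
           + (w1 + 2) * w2 ^+ 4) / w3].
Proof.
move=> e1 e2 e3; have [ep eq ec] := norm_c e1 e2 e3.
exists (w1_of p q), (w2_of p q), (w3_of p q c); split; last exact: (w_iota nz2 free_cr).
apply: (rational_gens_eq gens_cr) => x; first exact: (pq_in_w nz2 free_cr).
exact: (w_in_pq iota).
Qed.

Lemma p_model (phi phi' : {rmorphism F -> F}) : phi A = A -> phi B = - B -> phi C = - C ->
  phi' A = - A -> phi' B = - B -> phi' C = - C ->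
  exists p1 p2 p3, [/\ rational_gens iota L p1 p2 p3,
    [/\ phi' p1 = - p1, phi' p2 = - p2 & phi' p3 = - p3]
  & [/\ phi p1 = p1, phi p2 = - p2
      & phi p3 = (- 1 - 5 * p1 ^+ 2 - 7 * p2 ^+ 2
           - (p1 ^+ 2 - p2 ^+ 2) * (3 * p1 ^+ 2 + 17 * p2 ^+ 2)
           + 9 * (p1 ^+ 2 - p2 ^+ 2) ^+ 3) / p3]].
Proof.
move=> e1 e2 e3 e4 e5 e6; have [ep eq ec] := norm_c e1 e2 e3.
have [ea eb ec'] := nm_beta e4 e5 e6.
have [ep' eq'] := cr_beta nz2 free_nm ea eb.
exists (p1_of p q), (p2_of p q), (p3_of p q c); split; last exact: (p_iota nz2 free_cr).
  apply: (rational_gens_eq gens_cr) => x; first exact: (pq_in_p nz2 free_cr).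
  exact: (p_in_pq iota).
exact: (p_beta nz2 free_cr).
Qed.

Lemma u_model (phi : {rmorphism F -> F}) : phi A = A -> phi B = - B -> phi C = - C ->
  exists u1 u2 u3, rational_gens iota L u1 u2 u3 /\
    [/\ phi u1 = u1, phi u2 = - u2
      & phi u3 = 2 * (5 - u2 ^+ 2) * (u1 ^+ 2 - u2 ^+ 2 + 1) / u3].
Proof.
move=> e1 e2 e3; exists (u1_of A B C), (u2_of A B C), (u3_of A B C).
split; last exact: (u_gamma nz2 free).
apply: (rational_gens_eq gensA) => x; first exact: (abc_in_u nz2 free).
exact: (u_in_abc iota).
Qed.

Lemma t_model (phi : {rmorphism F -> F}) z : z ^+ 2 = - 3 -> phi (iota z) = iota z ->
  phi A = A -> phi B = - B -> phi C = - C ->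
  exists t1 t2 t3, rational_gens iota L t1 t2 t3 /\
    [/\ phi t1 = - t1, phi t2 = t2
      & phi t3 = (t1 ^+ 2 + 4) * (t1 ^+ 2 - t2 ^+ 2 + 1) / t3].
Proof.
move=> z2 ez e1 e2 e3.
exists (t1_of iota A B C z), (t2_of iota A B C z), (t3_of iota A B C z).
split; last exact: (t_iota nz2 free z2).
apply: (rational_gens_eq gensA) => x; first exact: (abc_in_t nz2 free z2).
exact: t_in_abc.
Qed.

End Sextic.
End Models.

(** * Descent from K to k *)

Section EvenOdd.
Variables (F : fieldType) (phi : {rmorphism F -> F}) (theta : F).
Hypothesis nz2 : 2 != 0 :> F.

Definition even_part x := (x + phi x) / 2.
Definition odd_part x := (x - phi x) / (2 * theta).

Lemma even_odd x : theta != 0 -> x = even_part x + odd_part x * theta.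
Proof. by move=> nzt; rewrite /even_part /odd_part; field; rewrite nzt nz2. Qed.

Lemma even_part_fixed x : phi (phi x) = x -> phi (even_part x) = even_part x.
Proof. by move=> e; rewrite fmorph_div rmorphD rmorph_nat e addrC. Qed.

Lemma odd_part_fixed x : phi theta = - theta -> phi (phi x) = x -> phi (odd_part x) = odd_part x.
Proof.
move=> et e; rewrite fmorph_div rmorphB rmorphM rmorph_nat et e mulrN invrN mulrN -mulNr.
by rewrite opprB.
Qed.

Lemma even_odd_norm x : theta != 0 ->
  even_part x ^+ 2 - theta ^+ 2 * odd_part x ^+ 2 = x * phi x.
Proof.
by move=> nzt; rewrite /even_part /odd_part; field; rewrite nzt nz2.
Qed.

End EvenOdd.

Section GroupDescent.
Variables (k : fieldType) (K : fieldExtType k) (F : fieldType) (iota : {rmorphism K -> F}).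
Variables (x1 x2 x3 : F) (gens : seq 'M[int]_3) (act : 'M[int]_3 -> {rmorphism F -> F}).
Hypothesis ms : monomial_setting iota x1 x2 x3 (mxgen gens) act.
Hypothesis nz2 : 2 != 0 :> K.

Let base : {rmorphism k -> F} := iota \o in_alg K.
Let Hfix f := forall M, H3 M -> act M f = f.
Let Gfix f := forall M, mxgen gens M -> act M f = f.
Let is_cst x := exists c, x = iota c.

Let nz2F : 2 != 0 :> F.
Proof. by rewrite -(rmorph_nat iota) fmorph_eq0. Qed.

Lemma GfixP f : Gfix f <-> forall M, M \in gens -> act M f = f.
Proof.
split=> [Gf M sM|]; first by apply/Gf/mxgen_gen.
by apply: (fixed_mxgen ms) => M; apply: mxgen_gen.
Qed.

Lemma act_base M c : mxgen gens M -> act M (base c) = base c.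
Proof. exact: (ms_bcst ms). Qed.

Lemma cst_fixed x : is_cst x -> Gfix x -> exists c, x = base c.
Proof. by move=> [c ->] /(ms_fixed ms)[c' ->]; exists c'. Qed.

Lemma cstH x : is_cst x -> Hfix x.
Proof. by move=> [c ->] M HM; apply: (H_cst ms). Qed.

Lemma cst_act M x : mxgen gens M -> is_cst x -> is_cst (act M x).
Proof. by move=> GM [c ->]; apply: (ms_cst ms). Qed.

Lemma cst_div x y : is_cst x -> is_cst y -> is_cst (x / y).
Proof. by move=> [c ->] [d ->]; exists (c / d); rewrite fmorph_div. Qed.

Lemma cstM x y : is_cst x -> is_cst y -> is_cst (x * y).
Proof. by move=> [c ->] [d ->]; exists (c * d); rewrite rmorphM. Qed.

Lemma cstD x y : is_cst x -> is_cst y -> is_cst (x + y).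
Proof. by move=> [c ->] [d ->]; exists (c + d); rewrite rmorphD. Qed.

Lemma cstB x y : is_cst x -> is_cst y -> is_cst (x - y).
Proof. by move=> [c ->] [d ->]; exists (c - d); rewrite rmorphB. Qed.

Lemma cst2 : is_cst 2.
Proof. by exists 2; rewrite rmorph_nat. Qed.

Lemma act_invol M f : mxgen gens M -> M *m M = 1%:M -> act M (act M f) = f.
Proof. by move=> GM MM; rewrite -(ms_actM ms) // MM (ms_act1 ms). Qed.

(** H is the kernel of the action on K and M maps K to itself, so the conjugate M A M of A in H is
    again in H. *)
Lemma Hfix_act M f : mxgen gens M -> M *m M = 1%:M -> Hfix f -> Hfix (act M f).
Proof.
move=> GM MM Hf A HA; have GA := H_in_G ms HA.
have HMAM : H3 (M *m (A *m M)).
  apply/(ms_ker ms); split=> [|c]; first by do 2!apply: (ms_GM ms) => //.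
  rewrite !(ms_actM ms) //; last by apply: (ms_GM ms).
  have [c' ec] := ms_cst ms c GM.
  by rewrite ec (H_cst ms c' HA) -ec act_invol.
have e : act M (act A (act M f)) = f.
  by rewrite -[RHS](Hf _ HMAM) !(ms_actM ms) //; apply: (ms_GM ms).
by rewrite -[LHS](act_invol _ GM MM) e.
Qed.

Lemma alg_all R a b c L : rational_gens iota L a b c ->
  (forall x, x \in [:: a; b; c] -> alg base R x) -> forall f, alg base R f.
Proof.
case=> _ _ algF algR f; apply: (alg_trans algR).
exact: (alg_base_change (alg_cst iota) (algF f)).
Qed.

Lemma alg_const R x : is_cst x -> alg base R x.
Proof. by move=> [c ->]; apply: alg_subset (alg_cst iota c) => y. Qed.

Lemma base_free (v : 3.-tuple F) : (forall f, alg base v f) -> alg_indep base v.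
Proof. by move=> alg_v; apply: (alg_indep_span (alg_indep_base (ms_free ms))) => x _; apply: alg_v. Qed.

(** The norm equation makes Y algebraic over W1, W2, X. These three elements then span, hence are
    independent, and W1, W2 is a part of them. *)
Lemma norm_free X Y W1 W2 b : b != 0 -> (forall f, alg base [:: X; Y; W1; W2] f) ->
  alg base [:: W1; W2] (X ^+ 2 - base b * Y ^+ 2) -> alg_indep base [tuple W1; W2].
Proof.
move=> nzb algF algN; have nzB : base b != 0 by rewrite fmorph_eq0.
have [_] : algfree base [:: X; W2; W1].
  apply/(alg_indepP base [tuple W1; W2; X])/base_free => f; apply: alg_trans (algF f) => x.
  have aX : alg base [tuple W1; W2; X] X by apply: alg_mem; rewrite !inE eqxx !orbT.
  have algW : alg base [tuple W1; W2; X] (X ^+ 2 - base b * Y ^+ 2).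
    by apply: alg_subset algN => y; rewrite !inE => /orP[]->; rewrite ?orbT.
  have algY : alg base [tuple W1; W2; X] Y.
    apply: alg_sqrt; rewrite -(mulKf nzB (Y ^+ 2)) mulrC; apply: alg_div.
      rewrite (_ : _ * _ = X ^+ 2 - (X ^+ 2 - base b * Y ^+ 2)); last by rewrite subKr.
      by apply: algB => //; apply: algX.
    by apply/alg_adjoin/adjoin_base.
  rewrite !inE => /or4P[]/eqP-> //; apply: alg_mem; by rewrite !inE eqxx ?orbT.
by move/(alg_indepP base [tuple W1; W2]).
Qed.

Lemma qspan_alg R theta x : is_cst theta -> qspan base R theta x -> alg base R x.
Proof.
move=> ct [c [d [Rc Rd ->]]]; apply: algD; first exact: alg_adjoin.
by apply: algM; [apply: alg_adjoin | apply: alg_const].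
Qed.

Section Involution.
Variable M : 'M[int]_3.
Hypothesis defG : gens = [:: tau3; lambda3; sigma3B; M].
Hypothesis MM : M *m M = 1%:M.
Let phi := act M.

Let GM : mxgen gens M.
Proof. by apply: mxgen_gen; rewrite defG !inE eqxx !orbT. Qed.

Let phiI f : phi (phi f) = f. Proof. exact: act_invol. Qed.

Lemma Gfix1 f : Gfix f <-> Hfix f /\ phi f = f.
Proof.
split=> [Gf | [Hf phif]].
  by split=> [A HA|]; apply: Gf => //; apply: (H_in_G ms).
apply/GfixP => A; rewrite defG !inE => /or4P[]/eqP-> //; apply: Hf; apply: mxgen_gen;
  by rewrite !inE eqxx ?orbT.
Qed.

Lemma even_Gfix x : Hfix x -> Gfix (even_part phi x).
Proof.
move=> Hx; apply/Gfix1; split; last exact: even_part_fixed.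
by move=> A HA; rewrite fmorph_div rmorphD rmorph_nat (Hx A HA) (Hfix_act GM MM Hx HA).
Qed.

Section Theta.
Variable theta : F.
Hypotheses (ct : is_cst theta) (nzt : theta != 0) (phit : phi theta = - theta).

Lemma odd_Gfix x : Hfix x -> Gfix (odd_part phi theta x).
Proof.
move=> Hx; apply/Gfix1; split; last exact: odd_part_fixed.
move=> A HA; rewrite fmorph_div rmorphB rmorphM rmorph_nat (Hx A HA) (Hfix_act GM MM Hx HA).
by rewrite (cstH ct HA).
Qed.

(** Quadratic descent with change of base: the even part of a constant and the coefficient of theta
    in it are constants fixed by G, hence in k, so K itself lies in the span of 1 and theta. *)
Lemma involution_descent R a b c : rational_gens iota Hfix a b c ->
  (forall x, x \in R -> Gfix x) -> (forall x, x \in [:: a; b; c] -> qspan base R theta x) ->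
  forall f, Gfix f <-> adjoin base R f.
Proof.
move=> [_ defL _] fixR span f; split.
  move=> /Gfix1[/defL Lf phif]; apply: (@quad_descent k K F base iota R [:: a; b; c] phi theta nz2F) => //.
  - by apply: adjoin_fixed => [d|x /fixR/Gfix1[] //]; apply: act_base.
  - have [||d ->] := @cst_fixed (theta ^+ 2); first exact: cstM.
      by apply/Gfix1; split; [apply/cstH/cstM | rewrite rmorphXn phit sqrrN].
    exact: adjoin_base.
  move=> d; have cd : is_cst (iota d) by exists d.
  have [|d1 def1] := cst_fixed _ (even_Gfix (cstH cd)).
    by apply: cst_div cst2; apply: cstD => //; apply: cst_act.
  have [|d2 def2] := cst_fixed _ (odd_Gfix (cstH cd)).
    by apply: cst_div; [apply: cstB => //; apply: cst_act | apply: cstM ct; apply: cst2].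
  exists (even_part phi (iota d)), (odd_part phi theta (iota d)).
  by split; [rewrite def1; apply: adjoin_base | rewrite def2; apply: adjoin_base | apply: even_odd].
move=> Rf A GA; move: f Rf; apply: adjoin_fixed => [d|x /fixR]; first exact: act_base.
by apply.
Qed.

Lemma involution_rational a b c : rational_gens iota Hfix a b c ->
  phi a = a -> phi b = - b -> phi c = - c -> rational base Gfix.
Proof.
move=> gensL ea eb ec; have [_ defL _] := gensL.
pose R := [:: a; b / theta; c / theta].
have span x : x \in [:: a; b; c] -> qspan base R theta x.
  have s1 : adjoin base R a by in_adj.
  have s2 : adjoin base R (b / theta) by apply: adjoin_gen; rewrite !inE eqxx ?orbT.
  have s3 : adjoin base R (c / theta) by apply: adjoin_gen; rewrite !inE eqxx ?orbT.
  rewrite !inE => /or3P[]/eqP->.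
  - by exists a, 0; split; rewrite ?mul0r ?addr0 //; apply: adjoin0.
  - by exists 0, (b / theta); split; rewrite ?divfK ?add0r //; apply: adjoin0.
  - by exists 0, (c / theta); split; rewrite ?divfK ?add0r //; apply: adjoin0.
have algR f : alg base R f.
  by apply: (alg_all gensL) => x /span; apply: qspan_alg.
exists 3, [tuple a; b / theta; c / theta]; split; first exact: base_free.
apply: (involution_descent gensL) => // x xR; apply/Gfix1; split.
  have Hgen y : y \in [:: a; b; c] -> Hfix y by move=> yL; apply/defL/adjoin_gen.
  have Ht : Hfix theta by apply: cstH.
  move=> A HA; move: xR; rewrite !inE => /or3P[]/eqP->;
    by rewrite ?fmorph_div ?(Ht A HA) Hgen // !inE eqxx ?orbT.
move: xR; rewrite !inE => /or3P[]/eqP->; rewrite ?fmorph_div ?phit ?ea ?eb ?ec ?invrN ?mulrNN //.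
Qed.

Lemma involution_norm w1 w2 w3 N b : rational_gens iota Hfix w1 w2 w3 ->
  theta ^+ 2 = base b -> phi w1 = w1 -> phi w2 = - w2 -> phi w3 = N / w3 ->
  adjoin base [:: w1; w2 / theta] N ->
  exists X Y, [/\ forall f, Gfix f <-> adjoin base [:: X; Y; w1; w2 / theta] f,
    alg_indep base [tuple w1; w2 / theta] & X ^+ 2 - base b * Y ^+ 2 = N].
Proof.
move=> gensL theta2 e1 e2 e3 sN; have [free defL _] := gensL.
have nzw3 : w3 != 0 by neq0_by nz2 free w1 w2 w3 1%N 10%N 50%N.
pose X := even_part phi w3; pose Y := odd_part phi theta w3.
have normXY : X ^+ 2 - base b * Y ^+ 2 = N.
  by rewrite -theta2 even_odd_norm // e3 mulrC divfK.
pose R := [:: X; Y; w1; w2 / theta].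
have Hgen y : y \in [:: w1; w2; w3] -> Hfix y by move=> yL; apply/defL/adjoin_gen.
have H1 : Hfix w1 by apply: Hgen; rewrite !inE eqxx.
have H2 : Hfix w2 by apply: Hgen; rewrite !inE eqxx ?orbT.
have H3 : Hfix w3 by apply: Hgen; rewrite !inE eqxx ?orbT.
have sX : adjoin base R X by in_adj.
have sY : adjoin base R Y by in_adj.
have s1 : adjoin base R w1 by in_adj.
have s2 : adjoin base R (w2 / theta) by apply: adjoin_gen; rewrite !inE eqxx ?orbT.
have span x : x \in [:: w1; w2; w3] -> qspan base R theta x.
  rewrite !inE => /or3P[]/eqP->.
  - by exists w1, 0; split; rewrite ?mul0r ?addr0 //; apply: adjoin0.
  - by exists 0, (w2 / theta); split; rewrite ?divfK ?add0r //; apply: adjoin0.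
  - by exists X, Y; split=> //; apply: even_odd.
have nzb : b != 0 by rewrite -(fmorph_eq0 base) -theta2 expf_neq0.
exists X, Y; split=> //.
  apply: (involution_descent gensL) => // x; rewrite !inE => /or4P[]/eqP->.
  - exact: even_Gfix.
  - exact: odd_Gfix.
  - by apply/Gfix1.
  apply/Gfix1; split; last by rewrite fmorph_div e2 phit invrN mulrNN.
  by move=> A HA; rewrite fmorph_div (H2 A HA) (cstH ct HA).
apply: (norm_free nzb (X := X) (Y := Y)); last by rewrite normXY; apply: alg_adjoin.
by apply: (alg_all gensL) => x /span; apply: qspan_alg.
Qed.

End Theta.

Lemma odd_constant y : Hfix y -> phi y = - y -> y != 0 ->
  exists theta, [/\ is_cst theta, theta != 0 & phi theta = - theta].
Proof.
move=> Hy phiy nzy; have [allfix|] := excluded_middle_informative (forall c, phi (iota c) = iota c).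
  have HM : H3 M by apply/(ms_ker ms).
  have /eqP := phiy; rewrite [phi y](Hy M HM) -subr_eq0 opprK -mulr2n -mulr_natr mulf_eq0.
  by rewrite (negPf nzy) (negPf nz2F).
move=> nfix; have [c nc] : exists c, phi (iota c) <> iota c.
  by apply: NNPP => nex; apply: nfix => c; apply: NNPP => nc; apply: nex; exists c.
exists (iota c - phi (iota c)); split.
- by apply: cstB; [exists c | apply: cst_act => //; exists c].
- by rewrite subr_eq0; apply/eqP => e; apply: nc.
- by rewrite rmorphB phiI opprB.
Qed.

End Involution.
Section TwoInvolutions.
Variables M1 M2 : 'M[int]_3.
Hypothesis defG : gens = [:: tau3; lambda3; sigma3B; M1; M2].
Hypotheses (MM1 : M1 *m M1 = 1%:M) (MM2 : M2 *m M2 = 1%:M) (M12 : M1 *m M2 = M2 *m M1).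
Let beta := act M1.
Let phi := act M2.

Let G1 : mxgen gens M1. Proof. by apply: mxgen_gen; rewrite defG !inE eqxx !orbT. Qed.
Let G2 : mxgen gens M2. Proof. by apply: mxgen_gen; rewrite defG !inE eqxx !orbT. Qed.
Let betaI f : beta (beta f) = f. Proof. exact: act_invol. Qed.
Let phiI f : phi (phi f) = f. Proof. exact: act_invol. Qed.
Let beta_phi f : beta (phi f) = phi (beta f).
Proof. by rewrite /beta /phi -!(ms_actM ms) // M12. Qed.

Lemma Gfix2 f : Gfix f <-> [/\ Hfix f, beta f = f & phi f = f].
Proof.
split=> [Gf | [Hf bf pf]].
  by split=> [A HA||]; apply: Gf => //; apply: (H_in_G ms).
apply/GfixP => A; rewrite defG !inE => /or4P[||| /orP[]] /eqP-> //; apply: Hf; apply: mxgen_gen;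
  by rewrite !inE eqxx ?orbT.
Qed.

Section Theta.
Variables ta tb : F.
Hypotheses (cta : is_cst ta) (nzta : ta != 0) (bta : beta ta = - ta) (pta : phi ta = ta).
Hypotheses (ctb : is_cst tb) (nztb : tb != 0) (btb : beta tb = tb) (ptb : phi tb = - tb).

Let sq_base t : is_cst t -> beta t = t \/ beta t = - t -> phi t = t \/ phi t = - t ->
  exists d, t ^+ 2 = base d.
Proof.
move=> ct bt pt; apply: cst_fixed; first exact: cstM.
apply/Gfix2; split; first exact/cstH/cstM.
  by rewrite rmorphXn; case: bt => ->; rewrite ?sqrrN.
by rewrite rmorphXn; case: pt => ->; rewrite ?sqrrN.
Qed.

(** The two coordinates of d in 1, tb for phi inherit invariance under beta, so they are fixed by G
    and lie in k. *)
Let split_b R d : is_cst d -> beta d = d -> adjoin base (tb :: R) d.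
Proof.
move=> cd bd; have cpd : is_cst (phi d) by apply: cst_act.
have bpd : beta (phi d) = phi d by rewrite beta_phi bd.
have [||d1 def1] := @cst_fixed (even_part phi d).
- by apply: cst_div cst2; apply: cstD.
- apply/Gfix2; split; last exact: even_part_fixed.
    by apply: cstH; apply: cst_div cst2; apply: cstD.
  by rewrite fmorph_div rmorphD rmorph_nat bpd bd.
have [||d2 def2] := @cst_fixed (odd_part phi tb d).
- by apply: cst_div; [apply: cstB | apply: cstM => //; apply: cst2].
- apply/Gfix2; split; last exact: odd_part_fixed.
    by apply: cstH; apply: cst_div; [apply: cstB | apply: cstM => //; apply: cst2].
  by rewrite fmorph_div rmorphB rmorphM rmorph_nat bpd bd btb.
rewrite (even_odd phi nz2F d nztb) def1 def2.
by apply: adjoinD; [|apply: adjoinM]; [apply: adjoin_base.. | apply/adjoin_gen/mem_head].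
Qed.

(** Descent through beta with ta leads from K(a, b, c) to k(tb)(R), and descent through phi with tb
    from there to k(R). *)
Lemma two_involutions_descent R a b c : rational_gens iota Hfix a b c ->
  (forall x, x \in R -> Gfix x) ->
  (forall x, x \in [:: a; b; c] -> adjoin base (tb :: R) (x / ta)) ->
  forall f, Gfix f <-> adjoin base R f.
Proof.
move=> [_ defL _] fixR span f; split; last first.
  move=> Rf A GA; move: f Rf; apply: adjoin_fixed => [d|x /fixR]; first exact: act_base.
  by apply.
move=> /Gfix2[/defL Lf bf pf].
have : adjoin base (tb :: R) f.
  move: Lf bf; apply: (@quad_descent k K F base iota (tb :: R) [:: a; b; c] beta ta nz2F) => //.
  - apply: adjoin_fixed => [d|x]; first exact: act_base.
    by rewrite inE => /predU1P[-> // |/fixR/Gfix2[]].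
  - by have [||| d ->] := @sq_base ta; [| right | left | apply: adjoin_base].
  - move=> d; have cd : is_cst (iota d) by exists d.
    have cbd : is_cst (beta (iota d)) by apply: cst_act.
    exists (even_part beta (iota d)), (odd_part beta ta (iota d)); split.
    + by apply: split_b; [apply: cst_div cst2; apply: cstD | apply: even_part_fixed].
    + apply: split_b; last exact: odd_part_fixed.
      by apply: cst_div; [apply: cstB | apply: cstM => //; apply: cst2].
    + exact: even_odd.
  move=> x /span sx; exists 0, (x / ta); split=> //; first exact: adjoin0.
  by rewrite divfK ?add0r.
move=> tf; move: tf pf; apply: (@quad_descent k k F base base R (tb :: R) phi tb nz2F) => //.
- apply: adjoin_fixed => [d|x /fixR/Gfix2[] //]; exact: act_base.
- by have [||| d ->] := @sq_base tb; [| left | right | apply: adjoin_base].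
- move=> d; exists (base d), 0; split; last by rewrite mul0r addr0.
    exact: adjoin_base.
  exact: adjoin0.
move=> x; rewrite inE => /predU1P[->|Rx].
  by exists 0, 1; split; [apply: adjoin0 | apply: adjoin1 | rewrite mul1r add0r].
by exists x, 0; split; [apply: adjoin_gen | apply: adjoin0 | rewrite mul0r addr0].
Qed.

Lemma two_involutions_alg R a b c : rational_gens iota Hfix a b c ->
  (forall x, x \in [:: a; b; c] -> adjoin base (tb :: R) (x / ta)) ->
  forall f, alg base R f.
Proof.
move=> gensL span; apply: (alg_all gensL) => x /span sx.
rewrite -(divfK nzta x); apply: algM; last exact: alg_const.
apply: alg_trans (alg_adjoin sx) => y; rewrite inE => /predU1P[->|Ry]; first exact: alg_const.
exact: alg_mem.
Qed.

Lemma two_involutions_rational a b c : rational_gens iota Hfix a b c ->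
  phi a = a -> phi b = - b -> phi c = - c ->
  beta a = - a -> beta b = - b -> beta c = - c -> rational base Gfix.
Proof.
move=> gensL ea eb ec fa fb fc; have [_ defL _] := gensL.
pose R := [:: a / ta; b / (ta * tb); c / (ta * tb)].
have span x : x \in [:: a; b; c] -> adjoin base (tb :: R) (x / ta).
  have stb : adjoin base (tb :: R) tb by in_adj.
  rewrite !inE => /or3P[]/eqP->.
  - by apply: adjoin_gen; rewrite !inE eqxx ?orbT.
  - rewrite (_ : b / ta = b / (ta * tb) * tb); last by field; rewrite nzta nztb.
    by apply: adjoinM => //; apply: adjoin_gen; rewrite !inE eqxx ?orbT.
  - rewrite (_ : c / ta = c / (ta * tb) * tb); last by field; rewrite nzta nztb.
    by apply: adjoinM => //; apply: adjoin_gen; rewrite !inE eqxx ?orbT.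
exists 3, [tuple a / ta; b / (ta * tb); c / (ta * tb)]; split.
  by apply: base_free; apply: (two_involutions_alg gensL).
apply: (two_involutions_descent gensL) => // x xR.
have Hgen y : y \in [:: a; b; c] -> Hfix y by move=> yL; apply/defL/adjoin_gen.
have Hta := cstH cta; have Htb := cstH ctb.
apply/Gfix2; split.
- move=> A HA; move: xR; rewrite !inE => /or3P[]/eqP->;
    by rewrite fmorph_div ?rmorphM ?(Hta A HA) ?(Htb A HA) Hgen // !inE eqxx ?orbT.
- by move: xR; rewrite !inE => /or3P[]/eqP->;
    rewrite fmorph_div ?rmorphM bta ?btb ?fa ?fb ?fc ?[- ta * tb]mulNr invrN mulrNN.
by move: xR; rewrite !inE => /or3P[]/eqP->;
  rewrite fmorph_div ?rmorphM pta ?ptb ?ea ?eb ?ec ?mulrN ?invrN ?mulrNN.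
Qed.

Lemma two_involutions_norm p1 p2 p3 N b : rational_gens iota Hfix p1 p2 p3 ->
  tb ^+ 2 = base b -> phi p1 = p1 -> phi p2 = - p2 -> phi p3 = N / p3 ->
  beta p1 = - p1 -> beta p2 = - p2 -> beta p3 = - p3 ->
  adjoin base [:: p1 / ta; p2 / (ta * tb)] (N / ta ^+ 2) ->
  exists X Y, [/\ forall f, Gfix f <-> adjoin base [:: X; Y; p1 / ta; p2 / (ta * tb)] f,
    alg_indep base [tuple p1 / ta; p2 / (ta * tb)] & X ^+ 2 - base b * Y ^+ 2 = N / ta ^+ 2].
Proof.
move=> gensL tb2 e1 e2 e3 f1 f2 f3 sN; have [free defL _] := gensL.
have nzp3 : p3 != 0 by neq0_by nz2 free p1 p2 p3 1%N 10%N 50%N.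
pose q := p3 / ta; pose X := even_part phi q; pose Y := odd_part phi tb q.
have phiq : phi q = N / p3 / ta by rewrite fmorph_div e3 pta.
have betaq : beta q = q by rewrite fmorph_div f3 bta invrN mulrNN.
have normXY : X ^+ 2 - base b * Y ^+ 2 = N / ta ^+ 2.
  by rewrite -tb2 even_odd_norm // phiq /q; field; rewrite nzta nzp3.
pose R := [:: X; Y; p1 / ta; p2 / (ta * tb)].
have Hgen y : y \in [:: p1; p2; p3] -> Hfix y by move=> yL; apply/defL/adjoin_gen.
have h1 : Hfix p1 by apply: Hgen; rewrite !inE eqxx.
have h2 : Hfix p2 by apply: Hgen; rewrite !inE eqxx ?orbT.
have h3 : Hfix p3 by apply: Hgen; rewrite !inE eqxx ?orbT.
have Hta := cstH cta; have Htb := cstH ctb.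
have hq : Hfix q by move=> A HA; rewrite fmorph_div (h3 A HA) (Hta A HA).
have hpq : Hfix (phi q) by apply: Hfix_act.
have span x : x \in [:: p1; p2; p3] -> adjoin base (tb :: R) (x / ta).
  have stb : adjoin base (tb :: R) tb by in_adj.
  have sX : adjoin base (tb :: R) X by in_adj.
  have sY : adjoin base (tb :: R) Y by in_adj.
  rewrite !inE => /or3P[]/eqP->.
  - by apply: adjoin_gen; rewrite !inE eqxx ?orbT.
  - rewrite (_ : p2 / ta = p2 / (ta * tb) * tb); last by field; rewrite nzta nztb.
    by apply: adjoinM => //; apply: adjoin_gen; rewrite !inE eqxx ?orbT.
  - rewrite -/q (even_odd phi nz2F q nztb) -/X -/Y; by in_adj.
have nzb : b != 0 by rewrite -(fmorph_eq0 base) -tb2 expf_neq0.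
exists X, Y; split=> //.
  apply: (two_involutions_descent gensL) => // x; rewrite !inE => /or4P[]/eqP->; apply/Gfix2.
  - split; last exact: even_part_fixed.
      by move=> A HA; rewrite fmorph_div rmorphD rmorph_nat (hq A HA) (hpq A HA).
    by rewrite fmorph_div rmorphD rmorph_nat beta_phi betaq.
  - split; last exact: odd_part_fixed.
      by move=> A HA; rewrite fmorph_div rmorphB rmorphM rmorph_nat (hq A HA) (hpq A HA) (Htb A HA).
    by rewrite fmorph_div rmorphB rmorphM rmorph_nat beta_phi betaq btb.
  - split; last by rewrite fmorph_div e1 pta.
      by move=> A HA; rewrite fmorph_div (h1 A HA) (Hta A HA).
    by rewrite fmorph_div f1 bta invrN mulrNN.
  split.
  - by move=> A HA; rewrite fmorph_div rmorphM (h2 A HA) (Hta A HA) (Htb A HA).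
  - by rewrite fmorph_div rmorphM f2 bta btb [- ta * tb]mulNr invrN mulrNN.
  by rewrite fmorph_div rmorphM e2 pta ptb mulrN invrN mulrNN.
apply: (norm_free nzb (X := X) (Y := Y)); last by rewrite normXY; apply: alg_adjoin.
exact: (two_involutions_alg gensL).
Qed.

End Theta.

Definition eigen_cst (s1 s2 : bool) t :=
  [/\ is_cst t, t != 0, beta t = (-1) ^+ s1 * t & phi t = (-1) ^+ s2 * t].

Lemma eigen_cstM s1 s2 r1 r2 t u : eigen_cst s1 s2 t -> eigen_cst r1 r2 u ->
  eigen_cst (s1 (+) r1) (s2 (+) r2) (t * u).
Proof.
move=> [ct nzt bt pt] [cu nzu bu pu]; split; first exact: cstM.
- exact: mulf_neq0.
- by rewrite rmorphM bt bu signr_addb mulrACA.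
by rewrite rmorphM pt pu signr_addb mulrACA.
Qed.

Lemma moved_cst M y : mxgen gens M -> Hfix y -> act M y = - y -> y != 0 ->
  exists c, act M (iota c) != iota c.
Proof.
move=> GM Hy My nzy; apply: NNPP => nex; have HM : H3 M.
  by apply/(ms_ker ms); split=> // c; apply/eqP/negPn/negP => nc; apply: nex; exists c.
have /eqP := My; rewrite (Hy M HM) -subr_eq0 opprK -mulr2n -mulr_natr mulf_eq0.
by rewrite (negPf nzy) (negPf nz2F).
Qed.

(** Each of M1, M2 and M1 M2 negates a or b, so it moves some constant. This yields simultaneous
    eigenvectors in K on which beta, phi and beta phi, respectively, are -1; products of them have
    the wanted signs. *)
Lemma odd_constants a b : Hfix a -> Hfix b -> a != 0 -> b != 0 ->
  phi a = a -> beta a = - a -> phi b = - b ->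
  (exists ta, eigen_cst true false ta) /\ (exists tb, eigen_cst false true tb).
Proof.
move=> Ha Hb nza nzb pa ba pb.
(* Applied to an odd constant and its image under the other involution: the nonzero one of sum and
   difference is an eigenvector of both. *)
have half (x y : F) : x != 0 -> x + y != 0 \/ x - y != 0.
  move=> nzx; have [e|] := eqVneq (x + y) 0; last by left.
  right; rewrite -(addr0_eq e) opprK -mulr2n -mulr_natr; exact: mulf_neq0.
have diff_cst M : mxgen gens M -> forall c, act M (iota c) != iota c ->
    let d := iota c - act M (iota c) in is_cst d /\ d != 0.
  move=> GM c nc; split; last by rewrite subr_eq0 eq_sym.
  by apply: cstB; [exists c | apply: cst_act => //; exists c].
have [t1 [s1 e1]] : exists t s, eigen_cst true s t.
  have [c nc] := moved_cst G1 Ha ba nza; have [cd nzd] := diff_cst _ G1 _ nc.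
  set d := _ - _ in cd nzd; have bd : beta d = - d by rewrite rmorphB betaI opprB.
  clearbody d; have cpd : is_cst (phi d) by apply: cst_act.
  have [nz|nz] := half d (phi d) nzd.
    exists (d + phi d), false; split=> //; first exact: cstD; rewrite ?rmorphD ?beta_phi ?phiI ?bd ?rmorphN /=; ring.
  exists (d - phi d), true; split=> //; first exact: cstB; rewrite ?rmorphB ?beta_phi ?phiI ?bd ?rmorphN /=; ring.
have [t2 [s2 e2]] : exists t s, eigen_cst s true t.
  have [c nc] := moved_cst G2 Hb pb nzb; have [cd nzd] := diff_cst _ G2 _ nc.
  set d := _ - _ in cd nzd; have pd : phi d = - d by rewrite rmorphB phiI opprB.
  clearbody d; have cbd : is_cst (beta d) by apply: cst_act.
  have [nz|nz] := half d (beta d) nzd.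
    exists (d + beta d), false; split=> //; first exact: cstD; rewrite ?rmorphD -?beta_phi ?betaI ?pd ?rmorphN /=; ring.
  exists (d - beta d), true; split=> //; first exact: cstB; rewrite ?rmorphB -?beta_phi ?betaI ?pd ?rmorphN /=; ring.
have [t3 [s3 e3]] : exists t s, eigen_cst s (~~ s) t.
  have G12 : mxgen gens (M1 *m M2) by apply: mxgenM.
  have a12 f : act (M1 *m M2) f = beta (phi f) by rewrite (ms_actM ms).
  have [|c nc] := moved_cst G12 Ha _ nza; first by rewrite a12 pa ba.
  have [cd nzd] := diff_cst _ G12 _ nc; rewrite a12 in cd nzd.
  set d := _ - _ in cd nzd; have bpd : beta (phi d) = - d.
    by rewrite 2!rmorphB -[phi (beta (phi _))]beta_phi phiI betaI opprB.
  have pd : phi d = - beta d by rewrite -(betaI (phi d)) bpd rmorphN.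
  clearbody d; have cbd : is_cst (beta d) by apply: cst_act.
  have [nz|nz] := half d (beta d) nzd.
    exists (d + beta d), false; split=> //; first exact: cstD; rewrite ?rmorphD -?beta_phi ?bpd ?betaI ?pd /=; ring.
  exists (d - beta d), true; split=> //; first exact: cstB; rewrite ?rmorphB -?beta_phi ?bpd ?betaI ?pd /=; ring.
(* t3 already has one of the two sign patterns; the other is that of t1 or t2, multiplied by t3 if
   both of its signs are odd. *)
case: s3 e3 => /= e3.
  split; first by exists t3.
  case: s2 e2 => e2; last by exists t2.
  by exists (t3 * t2); apply: (eigen_cstM e3 e2).
split; last by exists t3.
case: s1 e1 => e1; last by exists t1.
by exists (t3 * t1); apply: (eigen_cstM e3 e1).
Qed.

End TwoInvolutions.
End GroupDescent.

(** * The groups G723, G733 and G753 *)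

Lemma eq_on_Fadjoin (k : fieldType) (K : fieldExtType k) (F : fieldType)
    (f g : {rmorphism K -> F}) (E : {subfield K}) x :
  {in E, f =1 g} -> f x = g x -> {in <<E; x>>%VS, f =1 g}.
Proof.
move=> eqE eqx y /Fadjoin_poly_eq <-; rewrite -!horner_map /= eqx; congr horner.
apply/polyP=> i; rewrite !coef_map; apply: eqE.
exact/polyOverP/Fadjoin_polyOver.
Qed.

Section Parts.
Variables (k : fieldType) (K : fieldExtType k) (F : fieldType) (iota : {rmorphism K -> F}).
Variables (x1 x2 x3 : F) (act : 'M[int]_3 -> {rmorphism F -> F}).
Hypothesis nz2 : 2 != 0 :> K.
Let base : {rmorphism k -> F} := iota \o in_alg K.
Let Hfix f := forall M, H3 M -> act M f = f.

Section Kernel.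
Variables (G : 'M[int]_3 -> Prop) (ms : monomial_setting iota x1 x2 x3 G act).

(* An element acting nontrivially on K(x1, x2, x3)^H acts nontrivially on K. *)
Lemma neq0_adjoined (M : 'M[int]_3) (E : {subfield K}) (s : K) y :
  G M -> Hfix y -> act M y = - y -> y != 0 ->
  {in E, forall c, act M (iota c) = iota c} -> <<E; s>>%VS = fullv ->
  s != 0.
Proof.
move=> GM Hy My nzy fixE genK; apply/eqP => s0; have HM : H3 M.
  apply/(ms_ker ms); split=> // c.
  apply: (@eq_on_Fadjoin _ _ _ (act M \o iota) iota E s) => //=; last by rewrite genK memvf.
  by rewrite s0 !rmorph0.
have /eqP := My; rewrite (Hy M HM) -subr_eq0 opprK -mulr2n -mulr_natr mulf_eq0.
by rewrite (negPf nzy) -(rmorph_nat iota) fmorph_eq0 (negPf nz2).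
Qed.

Lemma fixed_1 M : G M -> {in 1%VS, forall c, act M (iota c) = iota c}.
Proof. by move=> GM c /vlineP[d ->]; apply: (ms_bcst ms). Qed.

End Kernel.

Let gens723 := [:: tau3; lambda3; sigma3B; - I3].
Let gens733 := [:: tau3; lambda3; sigma3B; - beta3].
Let gens753 := [:: tau3; lambda3; sigma3B; beta3; - I3].

Let II : - I3 *m - I3 = 1%:M.
Proof. by rewrite mulNmx mulmxN opprK mulmx1. Qed.
Let gg : - beta3 *m - beta3 = 1%:M.
Proof. by rewrite mulNmx mulmxN opprK mulmx_beta3. Qed.

Let linear_nz phi A B C : linear_gens iota act phi A B C ->
  [/\ Hfix A, Hfix B, A != 0 & B != 0].
Proof.
move=> [[free defL _] _]; split.
- by apply/defL/adjoin_gen; rewrite !inE eqxx.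
- by apply/defL/adjoin_gen; rewrite !inE eqxx orbT.
- by neq0_by nz2 free A B C 1%N 10%N 50%N.
- by neq0_by nz2 free A B C 1%N 10%N 50%N.
Qed.

Section G723.
Hypothesis ms : monomial_setting iota x1 x2 x3 (mxgen gens723) act.

Let GI : mxgen gens723 (- I3).
Proof. by apply: mxgen_gen; rewrite !inE eqxx !orbT. Qed.

Lemma G723_w : exists w1 w2 w3, rational_gens iota Hfix w1 w2 w3 /\
    [/\ act (- I3) w1 = w1, act (- I3) w2 = - w2
      & act (- I3) w3 = (w1 * (1 + w1 + w1 ^+ 2) ^+ 2
           - (2 + 3 * w1 + 4 * w1 ^+ 2 + 2 * w1 ^+ 3) * w2 ^+ 2
           + (w1 + 2) * w2 ^+ 4) / w3].
Proof.
have [A [B [C [[gensA [eA eB eC]] _]]]] := linear_iota ms nz2 GI.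
exact: (w_model nz2 gensA).
Qed.

Lemma G723_t (z : k) : z ^+ 2 = - 3 -> exists t1 t2 t3, rational_gens iota Hfix t1 t2 t3 /\
    [/\ act (- I3) t1 = - t1, act (- I3) t2 = t2
      & act (- I3) t3 = (t1 ^+ 2 + 4) * (t1 ^+ 2 - t2 ^+ 2 + 1) / t3].
Proof.
move=> z2; have [A [B [C [[gensA [eA eB eC]] _]]]] := linear_iota ms nz2 GI.
have z2K : z%:A ^+ 2 = - 3 :> K by rewrite -(rmorphXn (in_alg K)) z2 rmorphN rmorph_nat.
exact: (t_model nz2 gensA z2K (ms_bcst ms _ GI)).
Qed.

Lemma G723_rational : rational base (fun f => forall M, mxgen gens723 M -> act M f = f).
Proof.
have [A [B [C [lin _]]]] := linear_iota ms nz2 GI.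
have [HA HB nzA nzB] := linear_nz lin; have [gensA [eA eB eC]] := lin.
have [t [ct nzt pt]] := odd_constant ms nz2 erefl II HB eB nzB.
exact: (involution_rational ms nz2 erefl II ct nzt pt gensA).
Qed.

Lemma G723_norm (b : k) (s : K) : s ^+ 2 = b%:A -> <<1; s>>%VS = fullv ->
  act (- I3) (iota s) = - iota s ->
  exists X Y W1 W2, [/\ forall f, (forall M, mxgen gens723 M -> act M f = f) <->
      adjoin base [:: X; Y; W1; W2] f, alg_indep base [tuple W1; W2]
    & X ^+ 2 - base b * Y ^+ 2 = W1 * (1 + W1 + W1 ^+ 2) ^+ 2
               - base b * (2 + 3 * W1 + 4 * W1 ^+ 2 + 2 * W1 ^+ 3) * W2 ^+ 2
               + base b ^+ 2 * (W1 + 2) * W2 ^+ 4].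
Proof.
move=> s2 genK ps; have [w1 [w2 [w3 [gensW [e1 e2 e3]]]]] := G723_w.
have [A [B [C [lin _]]]] := linear_iota ms nz2 GI.
have [_ HB _ nzB] := linear_nz lin; have [_ [_ eB _]] := lin.
have nzs : iota s != 0.
  by rewrite fmorph_eq0; apply: (neq0_adjoined ms GI HB eB nzB (fixed_1 ms GI) genK).
have theta2 : iota s ^+ 2 = base b by rewrite -rmorphXn s2.
set N := _ - _ + _ in e3; pose W2 := w2 / iota s.
have NE : N = w1 * (1 + w1 + w1 ^+ 2) ^+ 2
    - base b * (2 + 3 * w1 + 4 * w1 ^+ 2 + 2 * w1 ^+ 3) * W2 ^+ 2
    + base b ^+ 2 * (w1 + 2) * W2 ^+ 4.
  rewrite /N -[w2](divfK nzs) -/W2 -theta2; ring.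
have sN : adjoin base [:: w1; W2] N.
  have s1 : adjoin base [:: w1; W2] w1 by in_adj.
  have sw2 : adjoin base [:: w1; W2] W2 by in_adj.
  have sb : adjoin base [:: w1; W2] (base b) by apply: adjoin_base.
  by rewrite NE; in_adj.
have ct : exists c, iota s = iota c by exists s.
have [X [Y [defG indep eN]]] :=
  involution_norm ms nz2 erefl II ct nzs ps gensW theta2 e1 e2 e3 sN.
by exists X, Y, w1, W2; split=> //; rewrite eN.
Qed.

End G723.

Section G733.
Hypothesis ms : monomial_setting iota x1 x2 x3 (mxgen gens733) act.

Let GB : mxgen gens733 (- beta3).
Proof. by apply: mxgen_gen; rewrite !inE eqxx !orbT. Qed.

Lemma G733_u : exists u1 u2 u3, rational_gens iota Hfix u1 u2 u3 /\
    [/\ act (- beta3) u1 = u1, act (- beta3) u2 = - u2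
      & act (- beta3) u3 = 2 * (5 - u2 ^+ 2) * (u1 ^+ 2 - u2 ^+ 2 + 1) / u3].
Proof.
have [A [B [C [gensA [eA eB eC]]]]] := linear_gamma ms nz2 GB.
exact: (u_model nz2 gensA).
Qed.

Lemma G733_rational : rational base (fun f => forall M, mxgen gens733 M -> act M f = f).
Proof.
have [A [B [C lin]]] := linear_gamma ms nz2 GB.
have [HA HB nzA nzB] := linear_nz lin; have [gensA [eA eB eC]] := lin.
have [t [ct nzt pt]] := odd_constant ms nz2 erefl gg HB eB nzB.
exact: (involution_rational ms nz2 erefl gg ct nzt pt gensA).
Qed.

Lemma G733_norm (d : k) (s : K) : s ^+ 2 = d%:A -> <<1; s>>%VS = fullv ->
  act (- beta3) (iota s) = - iota s ->
  exists X Y U1 U2, [/\ forall f, (forall M, mxgen gens733 M -> act M f = f) <->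
      adjoin base [:: X; Y; U1; U2] f, alg_indep base [tuple U1; U2]
    & X ^+ 2 - base d * Y ^+ 2 = 2 * (5 - base d * U2 ^+ 2) * (U1 ^+ 2 - base d * U2 ^+ 2 + 1)].
Proof.
move=> s2 genK ps; have [u1 [u2 [u3 [gensU [e1 e2 e3]]]]] := G733_u.
have [A [B [C lin]]] := linear_gamma ms nz2 GB.
have [_ HB _ nzB] := linear_nz lin; have [_ [_ eB _]] := lin.
have nzs : iota s != 0.
  by rewrite fmorph_eq0; apply: (neq0_adjoined ms GB HB eB nzB (fixed_1 ms GB) genK).
have theta2 : iota s ^+ 2 = base d by rewrite -rmorphXn s2.
set N := 2 * _ * _ in e3; pose U2 := u2 / iota s.
have NE : N = 2 * (5 - base d * U2 ^+ 2) * (u1 ^+ 2 - base d * U2 ^+ 2 + 1).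
  rewrite /N -[u2](divfK nzs) -/U2 -theta2; ring.
have sN : adjoin base [:: u1; U2] N.
  have s1 : adjoin base [:: u1; U2] u1 by in_adj.
  have su2 : adjoin base [:: u1; U2] U2 by in_adj.
  have sb : adjoin base [:: u1; U2] (base d) by apply: adjoin_base.
  by rewrite NE; in_adj.
have ct : exists c, iota s = iota c by exists s.
have [X [Y [defG indep eN]]] :=
  involution_norm ms nz2 erefl gg ct nzs ps gensU theta2 e1 e2 e3 sN.
by exists X, Y, u1, U2; split=> //; rewrite eN.
Qed.

End G733.

Section G753.
Hypothesis ms : monomial_setting iota x1 x2 x3 (mxgen gens753) act.

Let GI : mxgen gens753 (- I3).
Proof. by apply: mxgen_gen; rewrite !inE eqxx !orbT. Qed.
Let GB : mxgen gens753 beta3.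
Proof. by apply: mxgen_gen; rewrite !inE eqxx !orbT. Qed.
Let BI : beta3 *m - I3 = - I3 *m beta3.
Proof. by rewrite mulmxN mulNmx mulmx1 mul1mx. Qed.

Lemma G753_p : exists p1 p2 p3, [/\ rational_gens iota Hfix p1 p2 p3,
    [/\ act beta3 p1 = - p1, act beta3 p2 = - p2 & act beta3 p3 = - p3]
  & [/\ act (- I3) p1 = p1, act (- I3) p2 = - p2
      & act (- I3) p3 = (- 1 - 5 * p1 ^+ 2 - 7 * p2 ^+ 2
           - (p1 ^+ 2 - p2 ^+ 2) * (3 * p1 ^+ 2 + 17 * p2 ^+ 2)
           + 9 * (p1 ^+ 2 - p2 ^+ 2) ^+ 3) / p3]].
Proof.
have [A [B [C [[gensA [eA eB eC]] /(_ GB)[fA fB fC]]]]] := linear_iota ms nz2 GI.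
exact: (p_model nz2 gensA).
Qed.

Lemma G753_rational : rational base (fun f => forall M, mxgen gens753 M -> act M f = f).
Proof.
have [A [B [C [lin /(_ GB)[fA fB fC]]]]] := linear_iota ms nz2 GI.
have [HA HB nzA nzB] := linear_nz lin; have [gensA [eA eB eC]] := lin.
have [[ta [cta nzta bta pta]] [tb [ctb nztb btb ptb]]] :=
  odd_constants ms nz2 erefl mulmx_beta3 II BI HA HB nzA nzB eA fA eB.
rewrite /= expr0 expr1 ?mul1r ?mulN1r in bta pta btb ptb.
exact: (two_involutions_rational ms nz2 erefl mulmx_beta3 II BI cta nzta bta pta ctb nztb btb ptb gensA).
Qed.

Lemma G753_norm (a b : k) (sa sb : K) : sa ^+ 2 = a%:A -> sb ^+ 2 = b%:A ->
  <<<<1; sa>>; sb>>%VS = fullv ->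
  act beta3 (iota sa) = - iota sa -> act beta3 (iota sb) = iota sb ->
  act (- I3) (iota sa) = iota sa -> act (- I3) (iota sb) = - iota sb ->
  exists X Y P1 P2, [/\ forall f, (forall M, mxgen gens753 M -> act M f = f) <->
      adjoin base [:: X; Y; P1; P2] f, alg_indep base [tuple P1; P2]
    & X ^+ 2 - base b * Y ^+ 2 =
               - (1 / base a) - 5 * P1 ^+ 2 - 7 * base b * P2 ^+ 2
               - base a * (P1 ^+ 2 - base b * P2 ^+ 2)
                   * (3 * P1 ^+ 2 + 17 * base b * P2 ^+ 2)
               + 9 * base a ^+ 2 * (P1 ^+ 2 - base b * P2 ^+ 2) ^+ 3].
Proof.
move=> sa2 sb2 genK ba bb pa pb; have [p1 [p2 [p3 [gensP [f1 f2 f3] [e1 e2 e3]]]]] := G753_p.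
have [A [B [C [lin /(_ GB)[fA fB fC]]]]] := linear_iota ms nz2 GI.
have [HA HB nzA nzB] := linear_nz lin; have [_ [_ eB _]] := lin.
have nzsb : iota sb != 0.
  rewrite fmorph_eq0; apply: (neq0_adjoined ms GI HB eB nzB _ genK).
  exact: (@eq_on_Fadjoin _ _ _ (act (- I3) \o iota) iota 1%AS sa (fixed_1 ms GI) pa).
have nzsa : iota sa != 0.
  rewrite fmorph_eq0; apply: (@neq0_adjoined _ ms beta3 <<1; sb>>%AS _ A) => //.
    exact: (@eq_on_Fadjoin _ _ _ (act beta3 \o iota) iota 1%AS sb (fixed_1 ms GB) bb).
  (* beta3 fixes the square root of b and moves that of a, so for it sb has to be adjoined first. *)
  by rewrite adjoinC.
have ta2 : iota sa ^+ 2 = base a by rewrite -rmorphXn sa2.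
have tb2 : iota sb ^+ 2 = base b by rewrite -rmorphXn sb2.
set N := _ - _ + _ in e3; pose P1 := p1 / iota sa; pose P2 := p2 / (iota sa * iota sb).
have NE : N / iota sa ^+ 2 = - (1 / base a) - 5 * P1 ^+ 2 - 7 * base b * P2 ^+ 2
               - base a * (P1 ^+ 2 - base b * P2 ^+ 2)
                   * (3 * P1 ^+ 2 + 17 * base b * P2 ^+ 2)
               + 9 * base a ^+ 2 * (P1 ^+ 2 - base b * P2 ^+ 2) ^+ 3.
  rewrite /N /P1 /P2 -ta2 -tb2; move: (iota sa) (iota sb) nzsa nzsb => s t nzs nzt.
  by field; rewrite nzs nzt.
have sN : adjoin base [:: P1; P2] (N / iota sa ^+ 2).
  have s1 : adjoin base [:: P1; P2] P1 by in_adj.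
  have s2 : adjoin base [:: P1; P2] P2 by in_adj.
  have s3 : adjoin base [:: P1; P2] (base b) by apply: adjoin_base.
  have s4 : adjoin base [:: P1; P2] (base a) by apply: adjoin_base.
  by rewrite NE; in_adj.
have cta : exists c, iota sa = iota c by exists sa.
have ctb : exists c, iota sb = iota c by exists sb.
have [X [Y [defG indep eN]]] := two_involutions_norm ms nz2 erefl mulmx_beta3 II BI
  cta nzsa ba pa ctb nzsb bb pb gensP tb2 e1 e2 e3 f1 f2 f3 sN.
by exists X, Y, P1, P2; split=> //; rewrite eN.
Qed.

End G753.
End Parts.

Theorem proposition1p17 (k : fieldType) (K : fieldExtType k)
    (act : 'M[int]_3 -> {rmorphism ratfun K 3 -> ratfun K 3})
    (char_k : 2%N \notin [pchar k]) :
  isog_Alt4 H3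
  (* (1) *)
  /\ (setting act G723 ->
      (exists w1 w2 w3 : ratfun K 3,
        [/\ H_fixed_eq act w1 w2 w3,
            act (- I3) w1 = w1,
            act (- I3) w2 = - w2
          & act (- I3) w3 =
              (w1 * (1 + w1 + w1 ^+ 2) ^+ 2
               - (2 + 3 * w1 + 4 * w1 ^+ 2 + 2 * w1 ^+ 3) * w2 ^+ 2
               + (w1 + 2) * w2 ^+ 4) / w3])
      /\ (forall (b : k) (sqrtb : K),
          sqrtb ^+ 2 = b%:A -> <<1; sqrtb>>%VS = fullv ->
          act (- I3) (cst sqrtb) = - cst sqrtb ->
          exists X Y W1 W2 : ratfun K 3,
            G_fixed_eq act G723 X Y W1 W2 /\
            (let b := bcst K b in
             X ^+ 2 - b * Y ^+ 2 =
               W1 * (1 + W1 + W1 ^+ 2) ^+ 2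
               - b * (2 + 3 * W1 + 4 * W1 ^+ 2 + 2 * W1 ^+ 3) * W2 ^+ 2
               + b ^+ 2 * (W1 + 2) * W2 ^+ 4)))
  (* (2) *)
  /\ (setting act G733 ->
      (exists u1 u2 u3 : ratfun K 3,
        [/\ H_fixed_eq act u1 u2 u3,
            act (- beta3) u1 = u1,
            act (- beta3) u2 = - u2
          & act (- beta3) u3 =
              2 * (5 - u2 ^+ 2) * (u1 ^+ 2 - u2 ^+ 2 + 1) / u3])
      /\ (forall (d : k) (sqrtd : K),
          sqrtd ^+ 2 = d%:A -> <<1; sqrtd>>%VS = fullv ->
          act (- beta3) (cst sqrtd) = - cst sqrtd ->
          (exists X Y U1 U2 : ratfun K 3,
            G_fixed_eq act G733 X Y U1 U2 /\
            (let d := bcst K d in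
             X ^+ 2 - d * Y ^+ 2 =
               2 * (5 - d * U2 ^+ 2) * (U1 ^+ 2 - d * U2 ^+ 2 + 1)))
          /\ (has_sqrt (5 : k) ->
              [<-> G_rational act G733;
                   G_unirational act G733;
                   has_nontrivial_zero d]))
      /\ (has_sqrt (5 : k) -> has_sqrt (2 : k) \/ has_sqrt (- 1 : k) ->
          G_rational act G733))
  (* (3) *)
  /\ (setting act G753 ->
      (exists p1 p2 p3 : ratfun K 3,
        [/\ H_fixed_eq act p1 p2 p3,
            [/\ act beta3 p1 = - p1,
                act beta3 p2 = - p2
              & act beta3 p3 = - p3]
          & [/\ act (- I3) p1 = p1,
                act (- I3) p2 = - p2
              & act (- I3) p3 =
                  (- 1 - 5 * p1 ^+ 2 - 7 * p2 ^+ 2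
                   - (p1 ^+ 2 - p2 ^+ 2) * (3 * p1 ^+ 2 + 17 * p2 ^+ 2)
                   + 9 * (p1 ^+ 2 - p2 ^+ 2) ^+ 3) / p3]])
      /\ (forall (a b : k) (sqrta sqrtb : K),
          sqrta ^+ 2 = a%:A -> sqrtb ^+ 2 = b%:A ->
          <<<<1; sqrta>>; sqrtb>>%VS = fullv ->
          act beta3 (cst sqrta) = - cst sqrta ->
          act beta3 (cst sqrtb) = cst sqrtb ->
          act (- I3) (cst sqrta) = cst sqrta ->
          act (- I3) (cst sqrtb) = - cst sqrtb ->
          exists X Y P1 P2 : ratfun K 3,
            G_fixed_eq act G753 X Y P1 P2 /\
            (let a := bcst K a in let b := bcst K b in
             X ^+ 2 - b * Y ^+ 2 =
               - (1 / a) - 5 * P1 ^+ 2 - 7 * b * P2 ^+ 2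
               - a * (P1 ^+ 2 - b * P2 ^+ 2)
                   * (3 * P1 ^+ 2 + 17 * b * P2 ^+ 2)
               + 9 * a ^+ 2 * (P1 ^+ 2 - b * P2 ^+ 2) ^+ 3)))
  (* (4) *)
  /\ (setting act G723 -> has_sqrt (- 3 : k) ->
      (exists t1 t2 t3 : ratfun K 3,
        [/\ H_fixed_eq act t1 t2 t3,
            act (- I3) t1 = - t1,
            act (- I3) t2 = t2
          & act (- I3) t3 =
              (t1 ^+ 2 + 4) * (t1 ^+ 2 - t2 ^+ 2 + 1) / t3])
      /\ (has_sqrt (- 1 : k) -> G_rational act G723))
  (* (5) *)
  /\ (3%N \in [pchar k] ->
      [/\ setting act G723 -> G_rational act G723,
          setting act G733 -> G_rational act G733
        & setting act G753 -> G_rational act G753]).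
Proof.
have nz2 : 2 != 0 :> K.
  by rewrite -(rmorph_nat (in_alg K)) fmorph_eq0; apply: contra char_k => nz; rewrite inE /=.
split; first exact: H3_isog_Alt4.
split; [|split; [|split; [|split]]].
- move=> /setting_monomial ms; split.
    have [w1 [w2 [w3 [[_ defH _] [e1 e2 e3]]]]] := G723_w nz2 ms.
    by exists w1, w2, w3; split.
  move=> b s s2 genK ps; have [X [Y [W1 [W2 [defG indep e]]]]] := G723_norm nz2 ms s2 genK ps.
  by exists X, Y, W1, W2.
- move=> /setting_monomial ms; split; last split.
  + have [u1 [u2 [u3 [[_ defH _] [e1 e2 e3]]]]] := G733_u nz2 ms.
    by exists u1, u2, u3; split.
  + move=> d s s2 genK ps; split.
      have [X [Y [U1 [U2 [defG indep e]]]]] := G733_norm nz2 ms s2 genK ps.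
      by exists X, Y, U1, U2.
    have rat : G_rational act G733 := G733_rational nz2 ms.
    move=> _; tfae=> _; [exact: rational_unirational | | exact: rat].
    by exists 2, 0, 1, 1, 0; rewrite oner_eq0 !orbT; split; last by ring.
  by move=> _ _; exact: (G733_rational nz2 ms).
- move=> /setting_monomial ms; split.
    have [p1 [p2 [p3 [[_ defH _] [f1 f2 f3] [e1 e2 e3]]]]] := G753_p nz2 ms.
    by exists p1, p2, p3; split.
  move=> a b sa sb sa2 sb2 genK ba bb pa pb.
  have [X [Y [P1 [P2 [defG indep e]]]]] := G753_norm nz2 ms sa2 sb2 genK ba bb pa pb.
  by exists X, Y, P1, P2.
- move=> /setting_monomial ms [z z2]; split.
    have [t1 [t2 [t3 [[_ defH _] [e1 e2 e3]]]]] := G723_t nz2 ms z2.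
    by exists t1, t2, t3; split.
  by move=> _; exact: (G723_rational nz2 ms).
move=> _; split=> /setting_monomial ms.
- exact: (G723_rational nz2 ms).
- exact: (G733_rational nz2 ms).
- exact: (G753_rational nz2 ms).
Qed.
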